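(* Let $Q=\mathrm{diag}(q_1,q_2)$ with $q_1,q_2\in\mathbb{C}^\times$, $q_1\ne q_2$. Let $\boldsymbol\lambda=(\lambda^{(1)},\dots,\lambda^{(k)})$ be non-degenerate polynomial $\mathfrak{gl}_{1|1}$-weights, $n=\sum_s(\lambda^{(s)}_1+\lambda^{(s)}_2)$, $\boldsymbol b\in\mathbb{C}^k$, and suppose $L(\boldsymbol\lambda,\boldsymbol b)$ is cyclic. Let $0\le l\le k$, $W=(L(\boldsymbol\lambda,\boldsymbol b))_{(n-l,l)}$ and $\mathcal B^Q_l(\boldsymbol\lambda,\boldsymbol b)$ the image of $\mathcal B^Q$ in $\mathrm{End}(W)$. Then: (i) $\mathcal B^Q_l(\boldsymbol\lambda,\boldsymbol b)\cong\mathbb{C}[w_1,\dots,w_k]^{\mathfrak S_l\times\mathfrak S_{k-l}}/\langle\sigma_i(\boldsymbol w)-\varepsilon_i\rangle_{i=1,\dots,k}$, where $\varepsilon_i$ are defined by $q_1\varphi_{\boldsymbol\lambda,\boldsymbol b}(x)-q_2\psi_{\boldsymbol\lambda,\boldsymbol b}(x)=(q_1-q_2)\big(x^k+\sum_{i=1}^k(-1)^i\varepsilon_ix^{k-i}\big)$ and $\sigma_i(\boldsymbol w)$ are elementary symmetric polynomials in $w_1,\dots,w_k$; under this isomorphism $\prod_{s=1}^k(x-b_s)\mathcal T_Q(x)$ corresponds to $(q_1-q_2)\prod_{i=1}^l(x-w_i-1)\prod_{j=l+1}^k(x-w_j)$. (ii) $\mathcal B^Q_l(\boldsymbol\lambda,\boldsymbol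 b)$ is a Frobenius algebra and the module $W$ is isomorphic to its regular representation. (iii) $\mathcal B^Q_l(\boldsymbol\lambda,\boldsymbol b)$ is a maximal commutative subalgebra of $\mathrm{End}(W)$ of dimension $\binom kl$. (iv) Every $\mathcal B^Q$-eigenspace in $W$ has dimension one. (v) The $\mathcal B^Q$-eigenspaces in $W$ are in bijection with monic degree $l$ divisors $y(x)$ of $q_1\varphi_{\boldsymbol\lambda,\boldsymbol b}(x)-q_2\psi_{\boldsymbol\lambda,\boldsymbol b}(x)$, the eigenvalue of $\mathcal T_Q(x)$ corresponding to $y$ being $\frac{y(x-1)}{y(x)}\big(q_1\varphi_{\boldsymbol\lambda,\boldsymbol b}(x)-q_2\psi_{\boldsymbol\lambda,\boldsymbol b}(x)\big)\prod_{s=1}^k(x-b_s)^{-1}$. (vi) Every generalized $\mathcal B^Q$-eigenspace in $W$ is a cyclic $\mathcal B^Q$-module. (vii) The generalized $\mathcal B^Q$-eigenspace associated to the eigenvalue corresponding to $y$ has dimension $\prod_{a\in\mathbb{C}}\binom{\mathrm{Mult}_a(q_1\varphi_{\boldsymbol\lambda,\boldsymbol b}-q_2\psi_{\boldsymbol\lambda,\boldsymbol b})}{\mathrm{Mult}_a(y)}$, where $\mathrm{Mult}_a(p)$ is the multiplicity of $a$ as a root of $p$.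
   Context: Superspace $\mathbb{C}^{1|1}$ with basis $v_1$ (even), $v_2$ (odd), $|1|=\bar0,|2|=\bar1$. $\mathfrak{gl}_{1|1}$ has basis $e_{ij}$ of parity $|i|+|j|$ with $[e_{ij},e_{rs}]=\delta_{jr}e_{is}-(-1)^{(|i|+|j|)(|r|+|s|)}\delta_{is}e_{rj}$. With $P=\sum_{i,j}(-1)^{|j|}E_{ij}\otimes E_{ji}$ and $\mathcal R(x)=1+P/x$, $\mathrm{Y}(\mathfrak{gl}_{1|1})$ is generated by $T^{(r)}_{ij}$ ($r\ge1$, parity $|i|+|j|$) with relation $\mathcal R^{(12)}(x_1-x_2)T^{(13)}(x_1)T^{(23)}(x_2)=T^{(23)}(x_2)T^{(13)}(x_1)\mathcal R^{(12)}(x_1-x_2)$, $T(x)=\sum E_{ij}\otimes T_{ij}(x)$, $T_{ij}(x)=\delta_{ij}+\sum_rT^{(r)}_{ij}x^{-r}$; coproduct $\Delta(T_{ij}(x))=\sum_rT_{rj}(x)\otimes T_{ir}(x)$; $\mathfrak{gl}_{1|1}\subset\mathrm{Y}(\mathfrak{gl}_{1|1})$ via $e_{ij}\mapsto(-1)^{|i|}T^{(1)}_{ji}$. The evaluation module $M(z)$ is $M$ with $T_{ij}(x)$ acting by $\delta_{ij}+(-1)^{|j|}e_{ji}(x-z)^{-1}$. Weights, $L_\lambda$, polynomial and non-degenerate weights: $\lambda=(\lambda_1,\lambda_2)$ is non-degenerate if $\lambda_1+\lambda_2\neq0$, polynomial if $\lambda_i\in\mathbb{Z}_{\ge0}$ and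 ($\lambda_1>0$ or $\lambda=0$); $L_\lambda$ is the irreducible module generated by an even $v_\lambda$ with $e_{12}v_\lambda=0$, $e_{ii}v_\lambda=\lambda_iv_\lambda$. $L(\boldsymbol\lambda,\boldsymbol b)=\bigotimes_sL_{\lambda^{(s)}}(b_s)$, vacuum $|0\rangle=\otimes_sv_{\lambda^{(s)}}$, cyclic if generated by $|0\rangle$. $\varphi_{\boldsymbol\lambda,\boldsymbol b}(x)=\prod_s(x-b_s+\lambda^{(s)}_1)$, $\psi_{\boldsymbol\lambda,\boldsymbol b}(x)=\prod_s(x-b_s-\lambda^{(s)}_2)$. $(M)_{(a,b)}$ is the subspace where $e_{11},e_{22}$ act by $a,b$. $\mathcal T_Q(x)=q_1T_{11}(x)-q_2T_{22}(x)$; $\mathrm{Ber}^Q(x)=\frac{q_1}{q_2}T_{11}(x)\big(T_{22}(x)-T_{12}(x)T_{11}(x)^{-1}T_{21}(x)\big)^{-1}$ (central coefficients). The Bethe algebra $\mathcal B^Q$ is the commutative subalgebra generated by coefficients of $\mathcal T_Q(x)$ and $\mathrm{Ber}^Q(x)$; it preserves weight subspaces. For a character $\mathcal E$ of an algebra $\mathcal A$ acting on $M$, the eigenspace is $\bigcap_a\ker(a-\mathcal E(a))$ and the generalized eigenspace $\bigcap_a\bigcup_m\ker(a-\mathcal E(a))^m$. A Frobenius algebra is a finite-dimensional commutative algebra with an invariant non-degenerate symmetric bilinear form.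
   Formalization: W is taken as the weight subspace of weight (Σλ1−l, Σλ2+l) instead of (n−l, l), which is false once some λ2>0 (k=1, λ=(1,1), l=0 gives W=0); in (v), that each y has only one eigenspace is not stated but follows from (iii) and (vii). *)

(* Defs.v *)
From HB Require Import structures.
From mathcomp Require Import all_boot all_order all_algebra all_fingroup.
From mathcomp Require Import Rstruct.
From mathcomp.real_closed Require Import complex.
From mathcomp Require Import mpoly.
Set Implicit Arguments. Unset Strict Implicit. Unset Printing Implicit Defensive.
Import GRing.Theory.
Local Open Scope ring_scope.

Notation CC := (complex Rdefinitions.R).

(* Formal power series in u = x^{-1} with coefficients in a ring R:          *)
(*   S(x) = sum_{r >= 0} S r x^{-r}.                                         *)
Section Series.
Variable R : pzRingType.
Definition ser := nat -> R.
Definition ser1 : ser := fun n => (n == 0)%N%:R.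
Definition ser_mul (A B : ser) : ser :=
  fun n => \sum_(i < n.+1) A i * B (n - i)%N.
(* inverse of a series with constant term 1:  (1 - N)^{-1} = sum_m N^m *)
Definition ser_inv (S : ser) : ser :=
  fun n => \sum_(m < n.+1) (iter m (ser_mul (fun j => ser1 j - S j)) ser1) n.
End Series.

(* gl(1|1)-weights.  Index convention: false <-> 1 (even), true <-> 2 (odd). *)
Definition nondeg_wt (la : CC * CC) : Prop := la.1 + la.2 != 0.
Definition polynomial_wt (la : CC * CC) : Prop :=
  exists m1 m2 : nat, la = (m1%:R, m2%:R) /\ ((0 < m1)%N \/ (m1 = 0%N /\ m2 = 0%N)).

Section YangianModule.
Variables (k : nat) (lam : 'I_k -> CC * CC) (b : 'I_k -> CC).

Definition bidx (x : bool) : 'I_2 := inord x.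

(* The irreducible module L_la for a non-degenerate weight la (la1+la2 <> 0)
   is 2-dimensional with basis  0 = v_la (even),  1 = e21 v_la (odd):
     e11 = diag(la1, la1 - 1), e22 = diag(la2, la2 + 1),
     e21 v_la = e21 v_la, e21 (e21 v_la) = 0,
     e12 v_la = 0, e12 (e21 v_la) = [e12,e21] v_la = (la1 + la2) v_la.
   gl11_act s d c is the matrix of e_{dc} on L_{lam s}. *)
Definition gl11_act (s : 'I_k) (d c : bool) : 'M[CC]_2 :=
  let l1 := (lam s).1 in let l2 := (lam s).2 in
  \matrix_(o, p)
   match d, c with
   | false, false => if o == p then l1 - (p : nat)%:R else 0
   | true, true => if o == p then l2 + (p : nat)%:R else 0
   | true, false => if (o == 1 :> nat) && (p == 0 :> nat) then 1 else 0
   | false, true => if (o == 0 :> nat) && (p == 1 :> nat) then l1 + l2 else 0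
   end.

(* Evaluation module L_{lam s}(b s):
   T_{cd}(x) = delta_{cd} + (-1)^{|d|} e_{dc} (x - b_s)^{-1}
             = delta_{cd} + sum_{r>=1} (-1)^{|d|} b_s^{r-1} e_{dc} x^{-r}. *)
Definition Tloc (s : 'I_k) (c d : bool) : ser 'M[CC]_2 := fun r =>
  match r with
  | 0 => (c == d)%:R%:M
  | r'.+1 => ((-1) ^+ d * b s ^+ r') *: gl11_act s d c
  end.

(* Basis of L(lam,b) = tensor_s L_{lam s}(b s): bit vectors; the basis vector
   eps is the tensor product of v (eps s = false) or e21 v (eps s = true). *)
Definition Idx := {ffun 'I_k -> bool}.
Definition Ndim := #|{: Idx}|.

(* super embedding 1 (x) ... (x) A (x) ... (x) 1 (A of parity p in slot s),
   acting on column vectors with the Koszul sign rule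
   (a_1 (x) ... (x) a_k)(v_1 (x) ... (x) v_k)
        = (-1)^{sum_{s<t} |a_t||v_s|} a_1 v_1 (x) ... (x) a_k v_k. *)
Definition emb (s : 'I_k) (p : bool) (A : 'M[CC]_2) : 'M[CC]_Ndim :=
  \matrix_(x, y)
    let ex : Idx := enum_val x in let ey : Idx := enum_val y in
    (-1) ^+ (p && odd (\sum_(t < k | (t < s)%N) (ey t : nat))) *
    A (bidx (ex s)) (bidx (ey s)) *
    ([forall t, (t != s) ==> (ex t == ey t)] : nat)%:R.

(* Iterated coproduct  Delta(T_ij(x)) = sum_r T_rj(x) (x) T_ir(x):
   Delta^(k) T_ij = sum_{c_0 = j, c_k = i} T_{c_1 c_0} (x) T_{c_2 c_1} (x) ... (x) T_{c_k c_{k-1}},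
   and a_1 (x) ... (x) a_k = emb_1 a_1 * ... * emb_k a_k. *)
Definition chainT (c : {ffun 'I_k.+1 -> bool}) : ser 'M[CC]_Ndim :=
  \big[@ser_mul _/ser1 _]_(s < k)
     (fun r => emb s (c (inord s.+1) (+) c (inord s))
                     (Tloc s (c (inord s.+1)) (c (inord s)) r)).

Definition Tcoef (i j : bool) (r : nat) : 'M[CC]_Ndim :=
  \sum_(c : {ffun 'I_k.+1 -> bool} | (c ord0 == j) && (c ord_max == i)) chainT c r.

(* vacuum vector |0> (vectors are written as row vectors v^T; an operator A
   acts by v^T |-> v^T *m A^T) *)
Definition vac : 'rV[CC]_Ndim := delta_mx 0 (enum_rank ([ffun=> false] : Idx)).

(* L(lam,b) is cyclic: the smallest Y(gl11)-stable subspace containing |0>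
   (Y(gl11) being generated by the T^{(r)}_{ij}) is everything. *)
Definition cyclic_vac : Prop :=
  forall U : 'M[CC]_Ndim, (vac <= U)%MS ->
    (forall i j r, (0 < r)%N -> (U *m (Tcoef i j r)^T <= U)%MS) -> row_full U.

(* e_ij |-> (-1)^{|i|} T^{(1)}_{ji}: e11 = T^{(1)}_{11}, e22 = - T^{(1)}_{22}.
   weight subspace (M)_{(a,c)}: *)
Definition wt_space (a c : CC) : 'M[CC]_Ndim :=
  (kermx ((Tcoef false false 1)^T - a%:M) :&: kermx ((- Tcoef true true 1)^T - c%:M))%MS.

End YangianModule.

Section Bethe.
Variables (k : nat) (lam : 'I_k -> CC * CC) (b : 'I_k -> CC) (q1 q2 : CC) (l : nat).

(* W: the weight subspace of L(lam,b) spanned by the tensors with exactly l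
   factors e21 v. *)
Definition Wsp : 'M[CC]_(Ndim k) :=
  wt_space lam b ((\sum_s (lam s).1) - l%:R) ((\sum_s (lam s).2) + l%:R).
Definition dW := \rank Wsp.
Definition Wbase : 'M[CC]_(dW, Ndim k) := row_base Wsp.
(* the endomorphism of W (in the basis Wbase, acting on column coordinate
   vectors) induced by an operator A on L(lam,b) preserving W *)
Definition restrW (A : 'M[CC]_(Ndim k)) : 'M[CC]_dW :=
  (Wbase *m A^T *m pinvmx Wbase)^T.

Definition Tser (i j : bool) : ser 'M[CC]_(Ndim k) := Tcoef lam b i j.

Definition TQ : ser 'M[CC]_(Ndim k) :=
  fun r => q1 *: Tser false false r - q2 *: Tser true true r.

Definition BerQ : ser 'M[CC]_(Ndim k) :=
  fun r => (q1 / q2) *: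
    ser_mul (Tser false false)
      (ser_inv (fun n => Tser true true n -
          ser_mul (ser_mul (Tser false true) (ser_inv (Tser false false)))
                  (Tser true false) n)) r.

Definition Bgen (r : nat) (bb : bool) : 'M[CC]_dW :=
  restrW (if bb then BerQ r else TQ r).

Definition subalg (R : 'A[CC]_dW) : Prop := (1%:M \in R)%MS /\ (R * R <= R)%MS.
Definition comm_space (R : 'A[CC]_dW) : Prop :=
  forall a c, (a \in R)%MS -> (c \in R)%MS -> a *m c = c *m a.

Definition in_gen_alg (A : 'M[CC]_dW) : Prop :=
  forall R : 'A[CC]_dW, subalg R -> (forall r bb, (Bgen r bb \in R)%MS) -> (A \in R)%MS.

Definition is_BetheW (Bm : 'A[CC]_dW) : Prop :=
  forall A, (A \in Bm)%MS <-> in_gen_alg A.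

Definition frobenius (Bm : 'A[CC]_dW) : Prop :=
  comm_space Bm /\
  exists beta : 'M[CC]_dW -> 'M[CC]_dW -> CC,
    (forall c a a' e, (a \in Bm)%MS -> (a' \in Bm)%MS -> (e \in Bm)%MS ->
        beta (c *: a + a') e = c * beta a e + beta a' e /\
        beta e (c *: a + a') = c * beta e a + beta e a') /\
    (forall a e, (a \in Bm)%MS -> (e \in Bm)%MS -> beta a e = beta e a) /\
    (forall a e f, (a \in Bm)%MS -> (e \in Bm)%MS -> (f \in Bm)%MS ->
        beta (a *m e) f = beta a (e *m f)) /\
    (forall a, (a \in Bm)%MS -> (forall e, (e \in Bm)%MS -> beta a e = 0) -> a = 0).

(* W (vectors v^T : 'rV_dW, a acts by v^T |-> v^T *m a^T) is isomorphic as
   a Bm-module to the regular representation of Bm *)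
Definition regular_iso (Bm : 'A[CC]_dW) : Prop :=
  exists phi : 'M[CC]_dW -> 'rV[CC]_dW,
    (forall c a a', (a \in Bm)%MS -> (a' \in Bm)%MS ->
        phi (c *: a + a') = c *: phi a + phi a') /\
    (forall a e, (a \in Bm)%MS -> (e \in Bm)%MS -> phi (a *m e) = phi e *m a^T) /\
    (forall a e, (a \in Bm)%MS -> (e \in Bm)%MS -> phi a = phi e -> a = e) /\
    (forall v, exists2 a, (a \in Bm)%MS & phi a = v).

Definition max_comm (Bm : 'A[CC]_dW) : Prop :=
  subalg Bm /\ comm_space Bm /\
  forall R : 'A[CC]_dW, subalg R -> comm_space R -> (Bm <= R)%MS -> (R <= Bm)%MS.

Definition character (Bm : 'A[CC]_dW) (E : 'M[CC]_dW -> CC) : Prop :=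
  E 1%:M = 1 /\
  (forall c a a', (a \in Bm)%MS -> (a' \in Bm)%MS -> E (c *: a + a') = c * E a + E a') /\
  (forall a a', (a \in Bm)%MS -> (a' \in Bm)%MS -> E (a *m a') = E a * E a').

Definition Bbasis (Bm : 'A[CC]_dW) (i : 'I_(\rank Bm)) : 'M[CC]_dW :=
  vec_mx (row i (row_base Bm)).

(* eigenspace  cap_a ker(a - E(a))  (it suffices to intersect over a basis
   of Bm since E is linear), as a row space of vectors v^T *)
Definition eigsp (Bm : 'A[CC]_dW) (E : 'M[CC]_dW -> CC) : 'M[CC]_dW :=
  (\bigcap_(i < \rank Bm) kermx ((Bbasis i)^T - (E (Bbasis i))%:M))%MS.

(* generalized eigenspace  cap_a cup_m ker(a - E(a))^m ; in dimension dW the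
   union of the increasing chain ker(a - E a)^m is reached at m = dW *)
Definition geneigsp (Bm : 'A[CC]_dW) (E : 'M[CC]_dW -> CC) : 'M[CC]_dW :=
  (\bigcap_(i < \rank Bm) kermx (((Bbasis i)^T - (E (Bbasis i))%:M) ^+ dW))%MS.

Definition cyclic_module (Bm : 'A[CC]_dW) (U : 'M[CC]_dW) : Prop :=
  exists v : 'rV[CC]_dW, (v <= U)%MS /\
    (forall a, (a \in Bm)%MS -> (v *m a^T <= U)%MS) /\
    (forall w, (w <= U)%MS -> exists2 a, (a \in Bm)%MS & w = v *m a^T).

Definition phi_pol : {poly CC} := \prod_(s < k) ('X - (b s - (lam s).1)%:P).
Definition psi_pol : {poly CC} := \prod_(s < k) ('X - (b s + (lam s).2)%:P).
Definition Fpol : {poly CC} := q1 *: phi_pol - q2 *: psi_pol.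
Definition Ppol : {poly CC} := \prod_(s < k) ('X - (b s)%:P).
(* q1 phi - q2 psi = (q1 - q2)(x^k + sum_i (-1)^i eps_i x^{k-i}) *)
Definition eps (i : nat) : CC := (-1) ^+ i * Fpol`_(k - i) / (q1 - q2).

(* expansion in x^{-1} of Nn(x)/Dd(x), for Dd monic and deg Nn <= deg Dd:
   Nn(x)/Dd(x) = revN(x^{-1}) / revD(x^{-1}) with rev_e p (u) = u^e p(1/u) *)
Definition rev_ser (e : nat) (p : {poly CC}) : ser CC :=
  fun j => if (j <= e)%N then p`_(e - j) else 0.
Definition ratser (Nn Dd : {poly CC}) : ser CC :=
  ser_mul (rev_ser (size Dd).-1 Nn) (ser_inv (rev_ser (size Dd).-1 Dd)).

Definition eigval (y : {poly CC}) : ser CC :=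
  ratser ((y \Po ('X - 1)) * Fpol) (y * Ppol).

Definition tW (r : nat) : 'M[CC]_dW := restrW (TQ r).

Definition divisor_l (y : {poly CC}) : Prop :=
  y \is monic /\ size y = l.+1 /\ y %| Fpol.

(* coefficient of x^m (m >= 0) of prod_s (x - b_s) T_Q(x), restricted to W *)
Definition PhiW (m : nat) : 'M[CC]_dW :=
  restrW (\sum_(r < k.+1) Ppol`_(m + r) *: TQ r).
(* coefficient of x^{-m} (m >= 1) of prod_s (x - b_s) T_Q(x), restricted to W *)
Definition PhiW_neg (m : nat) : 'M[CC]_dW :=
  restrW (\sum_(j < k.+1) Ppol`_j *: TQ (j + m)%N).

Definition sym_l (p : {mpoly CC[k]}) : Prop :=
  forall s : 'S_k, (forall i : 'I_k, (s i < l)%N = (i < l)%N) -> msym s p = p.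
Definition in_eps_ideal (p : {mpoly CC[k]}) : Prop :=
  exists a : 'I_k -> {mpoly CC[k]}, (forall i, sym_l (a i)) /\
    p = \sum_(i < k) a i * (mesym k CC i.+1 - (eps i.+1)%:MP).
Definition RHS_pol : {poly {mpoly CC[k]}} :=
  ((q1 - q2)%:MP)%:P *
  \prod_(i < k) ('X - ('X_i + ((i < l)%N : nat)%:R)%:P).

End Bethe.

(* Main.v *)
(**
The series [phi(x) T_12(x) T_11(x)^-1] is a polynomial; its coefficients [Eh i] in the Newton basis
at the roots [r] of [q1 phi - q2 psi] anticommute, so products of [l] of them applied to the
vacuum behave like wedge products [Y_J].  Cyclicity of the vacuum makes them independent, and
the [Y_J] span the weight space [W].  A polynomial [p] in [w_1, ..., w_k], symmetric under the
Young subgroup, is sent to [sum_J Theta_J(p) Y_J], where [Theta_J] takes the monomial [w^m] to the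
determinant with rows [e_(J i) T^(m_i)], [T] being multiplication by [x] in the Newton basis.
These functionals vanish on the ideal generated by [sigma_i(w) - sigma_i(r)].  Commuting
[T_Q(x)] past the odd operators shows that [prod_s (x - b_s) T_Q(x)] acts on [W] as
multiplication by [(q1 - q2) prod_(i <= l) (x - w_i - 1) prod_(j > l) (x - w_j)], whose
coefficients generate the whole symmetric algebra, while the Berezinian acts by scalars.  Thus [W]
is the regular representation of the quotient algebra, whose Frobenius form is one of the
[Theta_J].  Maximality and the eigenspaces follow from this; the dimensions of the generalized
eigenspaces follow by applying to the idempotent of a character the fact that the trace of
multiplication by [p] is an average of the values of [p] at the permutations of [r].
*)
Require Import Defs.
From HB Require Import structures.
From mathcomp Require Import all_boot all_order all_algebra all_fingroup.
From mathcomp Require Import Rstruct.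
From mathcomp.real_closed Require Import complex.
From mathcomp Require Import mpoly.
From mathcomp Require Import ring zify.
From Stdlib Require Import FunctionalExtensionality.
Set Implicit Arguments. Unset Strict Implicit. Unset Printing Implicit Defensive.
Import GRing.Theory Order.TTheory Num.Theory.
Local Open Scope ring_scope.

(** * Divided differences of row determinants *)

(** The roots [r] may coincide, so the Bethe algebra need not be diagonalizable, and no limit from
    the generic case is taken. The Newton basis stands in for a basis of eigenvectors:
    multiplication by [x] modulo [q1 phi - q2 psi] becomes bidiagonal whatever the multiplicities.
    Commuting [T_Q(x)] past the odd operators acts on their indices by [(x - 1 - T)(x - T)^-1],
    while the vacuum eigenvalue is [(q1 - q2) det (x - T)]. Inside a determinant with [k] rows this
    scalar multiplies each row by [x - T], so the [l] rows that carry operators end with [x - 1 - T]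
    and the other [k - l] rows with [x - T]. This is why [l] odd factors are padded to [k] rows, and
    why only [l] of the variables are shifted by one. That the relations are exactly the stated ones
    is a count: Schur-type polynomials span the quotient with at most [C(k, l)] elements, and the
    quotient maps onto [W], which has that dimension. That every character is an evaluation also
    comes from a count: the trace expresses the nonzero dimension of its generalized eigenspace
    through the number of permutations inducing it. *)

Section MonomialExtension.
Variables (F : fieldType) (k : nat) (V : lmodType F) (g : 'X_{1..k} -> V).

Definition mlin (p : {mpoly F[k]}) : V := \sum_(m <- msupp p) p@_m *: g m.

Lemma mlinE (p : {mpoly F[k]}) (d : seq 'X_{1..k}) :
  uniq d -> {subset msupp p <= d} -> mlin p = \sum_(m <- d) p@_m *: g m.
Proof.
move=> ud sd; rewrite /mlin [RHS](bigID (mem (msupp p))) /=.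
rewrite [X in _ = _ + X]big1 ?addr0; last first.
  by move=> m; rewrite mcoeff_msupp negbK => /eqP->; rewrite scale0r.
rewrite -[RHS]big_filter; apply: perm_big; apply: uniq_perm => //.
  exact: filter_uniq.
by move=> m; rewrite mem_filter; case: (boolP (m \in msupp p)) => // /sd ->.
Qed.

Fact mlin_is_linear : linear mlin.
Proof.
move=> c p q; pose d := undup (msupp (c *: p + q) ++ msupp p ++ msupp q).
have ud : uniq d by apply: undup_uniq.
rewrite !(@mlinE _ d) //; try by move=> m hm; rewrite mem_undup !mem_cat hm ?orbT.
rewrite scaler_sumr -big_split /=; apply: eq_bigr => m _.
by rewrite mcoeffD mcoeffZ scalerDl scalerA.
Qed.
HB.instance Definition _ :=
  GRing.isLinear.Build F {mpoly F[k]} V *:%R mlin mlin_is_linear.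

Lemma mlinX m : mlin 'X_[m] = g m.
Proof. by rewrite /mlin msuppX big_seq1 mcoeffX eqxx scale1r. Qed.

End MonomialExtension.

Section Theta.
Variables (F : fieldType) (k : nat) (r : nat -> F).
Implicit Types (A : 'M[F]_k) (p q : {mpoly F[k]}).

(* [Tmx] is multiplication by [x] in the basis of Newton polynomials at [r], and [nu s] is
   the [s]-th of these polynomials. *)
Definition Tmx : 'M[F]_k :=
  \matrix_(i, j) ((i == j)%:R * r i + (j == i.+1 :> nat)%:R).
Definition nu (s : nat) : 'rV[F]_k := \row_j (j == s :> nat)%:R.

(** This is [x N_s = r_s N_s + N_(s+1)] for the Newton polynomials. For [s = k - 1] the last term is
    [nu k = 0], which encodes reduction modulo [N_k]. *)
Lemma nu_T s : nu s *m Tmx = r s *: nu s + nu s.+1.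
Proof.
apply/rowP => j; rewrite !mxE.
case: (ltnP s k) => hs; last first.
  have [h1 h2] : (j == s :> nat) = false /\ (j == s.+1 :> nat) = false.
    by have := ltn_ord j; split; lia.
  rewrite h1 h2 mulr0 addr0 big1 //.
  by move=> i _; rewrite mxE ltn_eqF ?mul0r // (leq_trans (ltn_ord i) hs).
rewrite (bigD1 (Ordinal hs)) //= big1 ?addr0.
  by rewrite !mxE eqxx mul1r -val_eqE /= eq_sym mulrC.
move=> i /negbTE; rewrite -val_eqE /= => hi.
by rewrite mxE hi mul0r.
Qed.

Definition rowsT A (m : 'X_{1..k}) : 'M[F]_k :=
  \matrix_i (row i A *m Tmx ^+ m i).
Definition theta1 A (m : 'X_{1..k}) : F^o := \det (rowsT A m).
(** The variable [X_i] acts on row [i] of [A] through [T], and the determinant is taken last. On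
    Newton rows these are divided differences that make sense for repeated nodes. *)
Definition Theta A : {mpoly F[k]} -> F^o := mlin (theta1 A).
HB.instance Definition _ A := GRing.Linear.on (Theta A).

Lemma ThetaX A m : Theta A 'X_[m] = \det (rowsT A m).
Proof. exact: mlinX. Qed.

Definition set_row (A : 'M[F]_k) i (v : 'rV[F]_k) : 'M[F]_k :=
  \matrix_j (if j == i then v else row j A).

Lemma rowsT_set_row A i v m :
  rowsT (set_row A i v) m = set_row (rowsT A m) i (v *m Tmx ^+ m i).
Proof.
by apply/row_matrixP => j; rewrite !rowK; case: eqP => [->|].
Qed.

Lemma row'_set_row A i v : row' i (set_row A i v) = row' i A.
Proof.
by apply/row_matrixP => j; apply/rowP => c; rewrite !mxE eq_sym (negbTE (neq_lift _ _)) mxE.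
Qed.

Lemma det_set_row_lin A i a b (u v : 'rV[F]_k) :
  \det (set_row A i (a *: u + b *: v)) =
  a * \det (set_row A i u) + b * \det (set_row A i v).
Proof.
by apply: (@determinant_multilinear _ _ _ _ _ i);
  rewrite ?rowK ?eqxx // !row'_set_row.
Qed.

Lemma Theta_row_lin A i a b (u v : 'rV[F]_k) p :
  Theta (set_row A i (a *: u + b *: v)) p =
  a * Theta (set_row A i u) p + b * Theta (set_row A i v) p.
Proof.
rewrite /Theta /mlin !mulr_sumr -big_split /=; apply: eq_bigr => m _.
rewrite /theta1 !rowsT_set_row mulmxDl -!scalemxAl det_set_row_lin.
by rewrite /GRing.scale /= mulrDr !mulrA ![a * _]mulrC ![b * _]mulrC.
Qed.

Lemma Theta_mulX A i p :
  Theta A ('X_i * p) = Theta (set_row A i (row i A *m Tmx)) p.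
Proof.
rewrite [p]mpolyE mulr_sumr !linear_sum; apply: eq_bigr => m _.
rewrite -scalerAr !linearZ /= -mpolyXD !ThetaX; congr (_ * _).
congr (\det _); rewrite rowsT_set_row.
apply/row_matrixP => j; rewrite !rowK; case: eqP => [->|/eqP ne].
  by rewrite mnmDE mnm1E eqxx exprS mulmxA.
by rewrite mnmDE mnm1E eq_sym (negbTE ne).
Qed.

Lemma Theta_affine A i c d p :
  Theta A ((c%:MP + d *: 'X_i) * p) =
  Theta (set_row A i (row i A *m (c%:M + d *: Tmx))) p.
Proof.
have -> : row i A *m (c%:M + d *: Tmx) = c *: row i A + d *: (row i A *m Tmx).
  by rewrite mulmxDr mul_mx_scalar -scalemxAr.
rewrite Theta_row_lin -Theta_mulX mulrDl linearD /= mul_mpolyC -scalerAl !linearZ /=.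
congr (_ * _ + _); congr (Theta _ _).
by apply/row_matrixP => j; rewrite rowK; case: eqP => // ->.
Qed.

Lemma Theta_affine_prod A (c d : 'I_k -> F) p :
  Theta A (\prod_i ((c i)%:MP + d i *: 'X_i) * p) =
  Theta (\matrix_i (row i A *m ((c i)%:M + d i *: Tmx))) p.
Proof.
suff H (s : seq 'I_k) : uniq s ->
  Theta A (\prod_(i <- s) ((c i)%:MP + d i *: 'X_i) * p) =
  Theta (\matrix_i (if i \in s then row i A *m ((c i)%:M + d i *: Tmx) else row i A)) p.
  rewrite (H (index_enum _)) ?index_enum_uniq //; congr (Theta _ _).
  by apply/row_matrixP => i; rewrite !rowK mem_index_enum.
elim: s A => [|i s IH] A /=.
  move=> _; rewrite big_nil mul1r; congr (Theta _ _).
  by apply/row_matrixP => i; rewrite !rowK.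
case/andP => si us; rewrite big_cons -mulrA Theta_affine IH //; congr (Theta _ _).
apply/row_matrixP => j; rewrite !rowK inE.
by case: eqP => [->|]; rewrite ?(negbTE si).
Qed.

(** A matrix commuting with [T] passes through the power of [T] in every row and then splits off
    from the determinant. *)
Lemma Theta_mulr A (B : 'M[F]_k) p :
  B *m Tmx = Tmx *m B -> Theta (A *m B) p = \det B * Theta A p.
Proof.
move=> cB; rewrite /Theta /mlin mulr_sumr; apply: eq_bigr => m _.
have -> : theta1 (A *m B) m = theta1 A m * \det B.
  rewrite /theta1 -det_mulmx; congr (\det _).
  apply/row_matrixP => i; rewrite row_mul !rowK row_mul -!mulmxA; congr (_ *m _).
  by apply: (@commrX _ B).
by rewrite /GRing.scale /=; ring.
Qed.

Definition Jmx (J : 'I_k -> nat) : 'M[F]_k := \matrix_i nu (J i).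

Lemma eq_Jmx J J' : J =1 J' -> Jmx J = Jmx J'.
Proof. by move=> eJ; apply/row_matrixP => i; rewrite !rowK eJ. Qed.

Lemma Theta_sub J i p :
  Theta (Jmx J) (('X_i - (r (J i))%:MP) * p) =
  Theta (Jmx (fun j => J j + (j == i))%N) p.
Proof.
have := @Theta_affine (Jmx J) i (- r (J i)) 1 p.
rewrite scale1r addrC mpolyCN => ->; congr (Theta _ _).
apply/row_matrixP => j; rewrite !rowK; case: eqP => [->|_]; last by rewrite addn0.
by rewrite mulmxDr mul_mx_scalar scale1r nu_T scaleNr addKr addn1.
Qed.

Definition newton (R : comNzRingType) (f : F -> R) (x : R) (s : nat) : R :=
  \prod_(m < s) (x - f (r m)).

Lemma Theta_newton1 J i s p : J i = 0%N ->
  Theta (Jmx J) (newton (@mpolyC k F) 'X_i s * p) =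
  Theta (Jmx (fun j => if j == i then s else J j)) p.
Proof.
move=> Ji; elim: s p => [|s IH] p.
  rewrite /newton big_ord0 mul1r; congr (Theta _ _); apply: eq_Jmx => j.
  by case: eqP => // ->.
rewrite /newton big_ord_recr /= -/(newton _ _ _) -mulrA IH.
set J' := (fun j => if j == i then s else J j).
have {1}-> : s = J' i by rewrite /J' eqxx.
rewrite Theta_sub; congr (Theta _ _); apply: eq_Jmx => j; rewrite /J'.
by case: eqP => _; rewrite ?addn1 ?addn0.
Qed.

(** The rows [nu 0] stand for the polynomial 1, and a Newton polynomial in [X_i] moves row [i] to
    any prescribed index. This converts alternants of Newton polynomials into determinants. *)
Lemma Theta_newton (S : 'I_k -> nat) p :
  Theta (Jmx (fun=> 0%N)) (\prod_i newton (@mpolyC k F) 'X_i (S i) * p) = Theta (Jmx S) p.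
Proof.
suff H (s : seq 'I_k) J : uniq s -> (forall i, i \in s -> J i = 0%N) ->
  Theta (Jmx J) (\prod_(i <- s) newton (@mpolyC k F) 'X_i (S i) * p) =
  Theta (Jmx (fun i => if i \in s then S i else J i)) p.
  rewrite (H (index_enum _)) ?index_enum_uniq //; congr (Theta _ _).
  by apply: eq_Jmx => i; rewrite mem_index_enum.
elim: s J => [|i s IH] J /=; first by rewrite big_nil mul1r.
case/andP => si us hJ; rewrite big_cons -mulrA Theta_newton1; last first.
  by apply: hJ; rewrite mem_head.
rewrite IH //; last first.
  move=> j js; case: eqP => [e|_]; first by rewrite e (negbTE si) in js.
  by apply: hJ; rewrite inE js orbT.
congr (Theta _ _); apply: eq_Jmx => j; rewrite inE.
by case: eqP => [->|]; rewrite ?(negbTE si).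
Qed.

End Theta.

(** * Coefficients recovered from values at generic points *)

Section CoefClosed.
Variables (F : numFieldType) (V : lmodType F).

(** In characteristic zero the natural numbers supply enough points; [bad] will hold the points
    where an operator identity has a pole. *)
Lemma avoiding_points (d : nat) (bad : seq F) :
  exists2 s : d.-tuple F, uniq s & (forall x, x \in s -> x \notin bad).
Proof.
pose N := (size bad + d)%N.
pose s0 := [seq x <- [seq i%:R | i <- iota 0 N] | x \notin bad] : seq F.
have us : uniq ([seq i%:R | i <- iota 0 N] : seq F).
  by rewrite map_inj_uniq ?iota_uniq //; apply: mulrIn; apply: oner_neq0.
have sz : (d <= size s0)%N.
  pose L := [seq i%:R | i <- iota 0 N] : seq F.
  have h1 : (count (mem bad) L <= size bad)%N.
    rewrite -size_filter; apply: uniq_leq_size; first exact: filter_uniq.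
    by move=> x; rewrite mem_filter => /andP[].
  have h2 := count_predC (mem bad) L.
  have h3 : size L = N by rewrite size_map size_iota.
  have -> : size s0 = count (predC (mem bad)) L by rewrite size_filter.
  rewrite -(leq_add2l (size bad)) -/N -h3 -h2; apply: leq_add => //.
have st : size (take d s0) == d by rewrite size_takel.
exists (Tuple st); first by rewrite take_uniq // filter_uniq.
by move=> x /mem_take; rewrite mem_filter => /andP[].
Qed.

(* Lagrange interpolation: coefficients are combinations of values *)
Lemma coef_closed (P : V -> Prop) (d : nat) (bad : seq F) (M : nat -> V) :
  P 0 -> (forall c u v, P u -> P v -> P (c *: u + v)) ->
  (forall x, x \notin bad -> P (\sum_(i < d) x ^+ i *: M i)) ->
  forall i, (i < d)%N -> P (M i).
Proof.
move=> P0 Pl Px i hi.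
have [s us sb] := avoiding_points d bad.
pose a : 'rV[F]_d := \row_j tnth s j.
have uV : Vandermonde d a \in unitmx.
  rewrite unitmxE det_Vandermonde unitfE; apply/prodf_neq0 => j _.
  apply/prodf_neq0 => j' jj'; rewrite !mxE subr_eq0.
  apply: contraTneq jj' => e; have: j' = j by apply: (tuple_uniqP _ us).
  by move=> ->; rewrite ltnn.
pose W := invmx (Vandermonde d a).
have -> : M i = \sum_(j < d) W j (Ordinal hi) *: \sum_(c < d) tnth s j ^+ c *: M c.
  under eq_bigr do rewrite scaler_sumr.
  rewrite exchange_big /= (bigD1 (Ordinal hi)) //= [X in _ + X]big1 ?addr0.
    under eq_bigr do rewrite scalerA.
    rewrite -scaler_suml.
    have := mulmxV uV => /matrixP/(_ (Ordinal hi) (Ordinal hi)).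
    rewrite !mxE eqxx mulr1n => e.
    rewrite -[LHS]scale1r -e; congr (_ *: _); apply: eq_bigr => j _.
    by rewrite !mxE mulrC.
  move=> c cn; under eq_bigr do rewrite scalerA.
  rewrite -scaler_suml.
  have := mulmxV uV => /matrixP/(_ c (Ordinal hi)).
  rewrite !mxE (negbTE cn) mulr0n => e.
  suff -> : \sum_(i0 < d) W i0 (Ordinal hi) * tnth s i0 ^+ c = 0 by rewrite scale0r.
  rewrite -[RHS]e; apply: eq_bigr => j _.
  by rewrite !mxE mulrC.
elim/big_ind: _ => //.
  by move=> u v Pu Pv; rewrite -[u]scale1r; apply: Pl.
move=> j _; rewrite -[_ *: _]addr0; apply: Pl => //; apply: Px.
by apply: sb; apply: mem_tnth.
Qed.

Lemma coef_eq0 (d : nat) (bad : seq F) (M : nat -> V) :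
  (forall x, x \notin bad -> \sum_(i < d) x ^+ i *: M i = 0) ->
  forall i, (i < d)%N -> M i = 0.
Proof.
move=> h; apply: (@coef_closed (eq^~ 0) d bad) => // c u v -> ->.
by rewrite scaler0 addr0.
Qed.

End CoefClosed.

Section Mesym.
Variables (R : comNzRingType) (k : nat).

Lemma prod_sub_mesym (x : R) :
  \prod_(i < k) (x%:MP - 'X_i) =
  \sum_(j < k.+1) ((-1) ^+ j * x ^+ (k - j)) *: mesym k R j.
Proof.
under eq_bigr do rewrite addrC.
rewrite bigA_distr.
pose c (h : {set 'I_k}) : 'I_k.+1 := inord #|h|.
rewrite (partition_big c xpredT) //=; apply: eq_bigr => j _.
rewrite /mesym scaler_sumr; apply: eq_big => [h|h /eqP ch].
  rewrite /c; have hk : (#|h| < k.+1)%N by rewrite ltnS -[k in (_ <= k)%N]card_ord max_card.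
  by rewrite -val_eqE /= inordK.
have hk : (#|h| < k.+1)%N by rewrite ltnS -[k in (_ <= k)%N]card_ord max_card.
have cj : #|h| = j by rewrite -ch inordK.
rewrite (bigID (mem h)) /=.
rewrite (eq_bigr (fun i => - 'X_i)); last by move=> i ->.
rewrite [X in _ * X](eq_bigr (fun=> x%:MP)); last by move=> i /negbTE ->.
rewrite prodrN /= prodr_const -scalerA cj.
have key (n a b : nat) : (a + n = b)%N -> n = (b - a)%N by lia.
rewrite [X in x%:MP ^+ X](_ : _ = k - j)%N; last first.
  by apply: key; rewrite -cj; have := cardC (mem h); rewrite card_ord.
rewrite -rmorphXn -signr_odd -[in RHS]signr_odd.
by rewrite scaler_sign -mul_mpolyC; case: odd; rewrite ?expr0 ?expr1 /=; ring.
Qed.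

End Mesym.

(** * Symmetry, scalar action and trace of the functionals [Theta] *)

Section ThetaSym.
Variables (F : numFieldType) (k : nat) (r : nat -> F).
Implicit Types (A : 'M[F]_k) (p q : {mpoly F[k]}).
Local Notation Theta := (Theta r).
Local Notation T := (Tmx k r).
Local Notation Jmx := (@Jmx F k).

Definition rpt (i : 'I_k) : F := r i.

Lemma det_sub_T x : \det (x%:M - T) = \prod_(i < k) (x - r i).
Proof.
rewrite -det_tr det_trig; last first.
  apply/is_trig_mxP => i j ij; rewrite !mxE -!val_eqE /=.
  have [-> ->] : (j == i :> nat) = false /\ (i == j.+1 :> nat) = false.
    by split; lia.
  by rewrite mulr0n mul0r addr0 subr0.
apply: eq_bigr => i _; rewrite !mxE eqxx mulr1n mul1r.
by rewrite (_ : (i == i.+1 :> nat) = false) ?addr0 //; lia.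
Qed.

Lemma comm_sub_T x : (x%:M - T) *m T = T *m (x%:M - T).
Proof. by rewrite mulmxBl mulmxBr mul_scalar_mx mul_mx_scalar. Qed.

(** The product acts on every row by the same matrix [x - T], which commutes with [T], so
    [Theta_mulr] extracts its determinant. *)
Lemma Theta_sub_prod A x p :
  Theta A (\prod_(i < k) (x%:MP - 'X_i) * p) = \prod_(i < k) (x - r i) * Theta A p.
Proof.
have -> : \prod_(i < k) (x%:MP - 'X_i) = \prod_(i < k) (x%:MP + (-1) *: 'X_i) :> {mpoly F[k]}.
  by apply: eq_bigr => i _; rewrite scaleN1r.
rewrite (@Theta_affine_prod _ _ r A (fun=> x) (fun=> -1)) -det_sub_T -Theta_mulr ?comm_sub_T //.
by congr (Theta _ _); apply/row_matrixP => i; rewrite rowK row_mul scaleN1r.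
Qed.

Lemma mesym_rpt x :
  \prod_(i < k) (x - r i) =
  \sum_(j < k.+1) ((-1) ^+ j * x ^+ (k - j)) * (mesym k F j).@[rpt].
Proof.
have := congr1 (meval rpt) (prod_sub_mesym k x).
rewrite rmorph_prod raddf_sum /=.
under eq_bigr do rewrite mevalB mevalC mevalXU.
by move=> ->; apply: eq_bigr => j _; rewrite mevalZ.
Qed.

Lemma ThetaZl A a p q : Theta A ((a *: p) * q) = a * Theta A (p * q).
Proof. by rewrite -scalerAl linearZ. Qed.

(** Comparison of the powers of [x] in [Theta_sub_prod]. Elementary symmetric polynomials act by
    their values at [r], so every [Theta A] kills the ideal of relations. *)
Lemma Theta_mesym A j p :
  Theta A (mesym k F j * p) = (mesym k F j).@[rpt] * Theta A p.
Proof.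
have [jk|jk] := leqP j k; last first.
  by rewrite mesym_geqnE // mul0r raddf0 meval0 mul0r.
pose M i : F^o := (-1) ^+ (k - i) *
   (Theta A (mesym k F (k - i) * p) - (mesym k F (k - i)).@[rpt] * Theta A p).
have H x : x \notin [::] -> \sum_(i < k.+1) x ^+ i *: M i = 0.
  move=> _; have := Theta_sub_prod A x p.
  rewrite prod_sub_mesym mesym_rpt mulr_suml raddf_sum mulr_suml /= => /eqP.
  rewrite -subr_eq0 -sumrB (reindex_inj rev_ord_inj) /= => /eqP e.
  rewrite -[RHS]e; apply: eq_bigr => i _; rewrite /M subSS subKn ?ltn_ord //; last by rewrite -ltnS.
  by rewrite ThetaZl -[LHS]/(x ^+ i * _); ring.
have := coef_eq0 H (_ : k - j < k.+1)%N; rewrite ltnS leq_subr => /(_ isT) /eqP.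
rewrite /M subKn // mulf_eq0 signr_eq0 /= subr_eq0 => /eqP; exact.
Qed.

Lemma det_row_perm n (s : 'S_n) (B : 'M[F]_n) : \det (row_perm s B) = (-1) ^+ s * \det B.
Proof. by rewrite row_permE det_mulmx det_perm. Qed.

Lemma row_row_perm n (s : 'S_n) (B : 'M[F]_n) i : row i (row_perm s B) = row (s i) B.
Proof. by apply/rowP => j; rewrite !mxE. Qed.

Lemma Theta_msym A (s : 'S_k) p :
  Theta A (msym s p) = (-1) ^+ s * Theta (row_perm s A) p.
Proof.
rewrite [p]mpolyE (raddf_sum (msym s)) !linear_sum mulr_sumr; apply: eq_bigr => m _.
rewrite /= (msymZ p@_m 'X_[m] s) !linearZ /= msymX !ThetaX.
have -> : rowsT r A [multinom [tuple m (s^-1%g i) | i < k]] =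
    row_perm s^-1 (rowsT r (row_perm s A) m).
  by apply/row_matrixP => i; rewrite row_row_perm !rowK row_row_perm permKV mnmE.
by rewrite det_row_perm odd_permV; apply: mulrCA.
Qed.

Lemma row_perm_Jmx (s : 'S_k) J : row_perm s (Jmx J) = Jmx (fun i => J (s i)).
Proof. by apply/row_matrixP => i; rewrite row_row_perm !rowK. Qed.

Lemma rowsT1 A : rowsT r A 0%MM = A.
Proof. by apply/row_matrixP => i; rewrite rowK mnm0E expr0 mulmx1. Qed.

Lemma Theta1 A : Theta A 1 = \det A.
Proof. by rewrite -mpolyX0 ThetaX rowsT1. Qed.

Lemma det_Jmx_perm (s : 'S_k) : \det (Jmx (fun i => s i)) = (-1) ^+ s.
Proof.
rewrite -det_perm; congr (\det _); apply/matrixP => i j.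
by rewrite !mxE eq_sym.
Qed.

Lemma det_Jmx_ninj (J : 'I_k -> nat) i j : i != j -> J i = J j -> \det (Jmx J) = 0.
Proof.
by move=> ij e; apply: (determinant_alternate ij) => c; rewrite !mxE e.
Qed.

Lemma row_Jmx (m : 'X_{1..k}) (J : 'I_k -> 'I_k) :
  rowsT r (Jmx (fun i => J i)) m = \matrix_(i, j) (T ^+ m i) (J i) j.
Proof.
apply/matrixP => i j; rewrite !mxE (bigD1 (J i)) //= big1 ?addr0.
  by rewrite !mxE eqxx mul1r.
by move=> a /negbTE aJ; rewrite !mxE (_ : (a == J i :> nat) = false) ?mul0r.
Qed.

(** Multilinearity in the rows of [A]. It will be matched with the expansion of a product of odd
    operators whose indices have been transformed by a matrix. *)
Lemma Theta_expand A p :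
  Theta A p = \sum_(J : {ffun 'I_k -> 'I_k})
     (\prod_i A i (J i)) * Theta (Jmx (fun i => J i)) p.
Proof.
rewrite [p]mpolyE linear_sum; under [RHS]eq_bigr do rewrite linear_sum mulr_sumr.
rewrite exchange_big; apply: eq_bigr => m _ /=.
rewrite linearZ /= ThetaX.
under eq_bigr do rewrite linearZ /= ThetaX row_Jmx -[_ *: \det _]/(_ * _) mulrCA.
rewrite -mulr_sumr; congr (_ * _).
rewrite /determinant; under [RHS]eq_bigr do rewrite mulr_sumr.
rewrite exchange_big /=; apply: eq_bigr => s _.
under [RHS]eq_bigr do rewrite mulrCA -big_split /=.
rewrite -mulr_sumr; congr (_ * _).
under eq_bigr do rewrite !mxE.
rewrite bigA_distr_bigA /=; apply: eq_bigr => f _.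
by apply: eq_bigr => i _; rewrite !mxE.
Qed.

Lemma Tpow_trig m (i j : 'I_k) : (j < i)%N -> (T ^+ m) i j = 0.
Proof.
elim: m i j => [|m IH] i j ji.
  by rewrite expr0 !mxE -val_eqE gtn_eqF.
rewrite exprS mxE big1 // => a _.
have [aj|ja] := ltnP j a; first by rewrite IH ?mulr0.
rewrite mxE -val_eqE /=.
have [-> ->] : (i == a :> nat) = false /\ (a == i.+1 :> nat) = false by split; lia.
by rewrite mul0r add0r mul0r.
Qed.

Lemma Tpow_diag m (i : 'I_k) : (T ^+ m) i i = r i ^+ m.
Proof.
elim: m => [|m IH]; first by rewrite !expr0 !mxE eqxx.
rewrite exprS mxE (bigD1 i) //= IH big1 ?addr0.
  by rewrite mxE eqxx mul1r (_ : (i == i.+1 :> nat) = false) ?addr0 ?exprS //; lia.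
move=> a /negbTE ai; have [ia|ia] := ltnP i a; first by rewrite Tpow_trig ?mulr0.
rewrite mxE eq_sym ai (_ : (a == i.+1 :> nat) = false) ?mul0r ?add0r ?mul0r //; lia.
Qed.

(* [T] is triangular, so in the double Leibniz sum only equal permutations survive. *)
Lemma Theta_trace p :
  \sum_(t : 'S_k) (-1) ^+ t * Theta (Jmx (fun i => t i)) p =
  \sum_(t : 'S_k) p.@[fun i => r (t i)].
Proof.
rewrite [p]mpolyE; under eq_bigr do rewrite linear_sum mulr_sumr.
under [RHS]eq_bigr do rewrite raddf_sum.
rewrite exchange_big [RHS]exchange_big; apply: eq_bigr => m _ /=.
under [RHS]eq_bigr do rewrite mevalZ mevalX.
rewrite -mulr_sumr; under eq_bigr do rewrite linearZ /= ThetaX row_Jmx -[_ *: \det _]/(_ * _) mulrCA.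
rewrite -mulr_sumr; congr (_ * _); apply: eq_bigr => t _.
rewrite /determinant (bigD1 t) //= mulrDr mulrA -signr_addb addbb mul1r.
rewrite [X in _ + X](_ : _ = 0) ?addr0.
  by apply: eq_bigr => i _; rewrite mxE Tpow_diag.
rewrite big1 ?mulr0 // => s st.
(* All permutations have the same sum of values, so [t i <= s i] for every [i] would force
   [s = t]. *)
have /existsP[i hi] : [exists i, (s i < t i)%N].
  apply: contraR st => /existsPn h.
  have le i : (t i <= s i)%N by rewrite leqNgt h.
  have e : (\sum_i (s i - t i) = 0)%N.
    rewrite sumnB //.
    have S0 (u : 'S_k) : (\sum_i nat_of_ord (u i) = \sum_(i < k) i)%N.
      by rewrite [RHS](reindex_inj (@perm_inj _ u)).
    by rewrite !S0 subnn.
  apply/eqP/permP => i; apply: val_inj => /=; apply/eqP.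
  move/eqP: e; rewrite sum_nat_eq0 => /forallP/(_ i) /=.
  by rewrite subn_eq0 eqn_leq le andbT.
by rewrite (bigD1 i) //= mxE Tpow_trig // mul0r mulr0.
Qed.

End ThetaSym.

(** * Polynomials symmetric under a Young subgroup *)

Module SchurBasis.

Section Schur.
Variables (F : numFieldType) (k l : nat) (r : nat -> F).
Hypothesis lk : (l <= k)%N.
Local Notation R := {mpoly F[k]}.
Local Notation Theta := (Theta r).
Local Notation Jmx := (@Jmx F k).
Implicit Types (i j m : 'I_k) (p q : R) (b : bool).

(** The two groups of variables are kept inside one index set ['I_k], with [rk] numbering each group
    from zero, so that two Vandermonde blocks share a single [k] by [k] matrix. *)
Definition side i : bool := (i < l)%N.
Definition rk i : nat := if side i then i : nat else (i - l)%N.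
Definition nb b : nat := if b then l else (k - l)%N.
Definition same i j := side i == side j.

Lemma rk_lt i : (rk i < nb (side i))%N.
Proof. by rewrite /rk /nb /side; case: (ltnP i l) => h //=; have := ltn_ord i; lia. Qed.

Lemma sum_side (V : nmodType) b (f : nat -> V) :
  \sum_(m < k | side m == b) f (rk m) = \sum_(i < nb b) f i.
Proof.
case: b; rewrite /nb /side.
  rewrite (big_ord_widen k) //; apply: eq_big => i; first by rewrite eqb_id.
  by rewrite /rk /side => /eqP ->.
rewrite -(big_mkord xpredT f) -{2}[l]add0n.
rewrite (eq_bigl (fun i : 'I_k => (l <= i)%N)); last first.
  by move=> i; rewrite eqbF_neg -leqNgt.
rewrite (eq_bigr (fun i : 'I_k => f (i - l)%N)); last first.
  by move=> i li; rewrite /rk /side ltnNge li.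
rewrite -(big_mkord (fun i : nat => l <= i)%N (fun i : nat => f (i - l)%N)).
rewrite (big_cat_nat (n := l)) //= big_nat_cond big1 ?add0r; last first.
  by move=> i; case: ltnP => //; rewrite andbF.
rewrite big_nat_cond (eq_bigl (fun i : nat => (l <= i < k)%N && true)); last first.
  by move=> i; rewrite andbT; case: (l <= i)%N; rewrite ?andbT ?andbF.
rewrite -big_nat_cond -{1}[l]add0n big_addn; apply: eq_bigr => i _.
by rewrite addnK.
Qed.

Definition Ep b : {poly R} := \prod_(i < k | side i == b) ('X - ('X_i)%:P).

Lemma Ep_monic b : Ep b \is monic.
Proof. by apply: monic_prod => i _; apply: monicXsubC. Qed.

Lemma size_Ep b : size (Ep b) = (nb b).+1.
Proof.
rewrite /Ep -big_filter size_prod_XsubC size_filter -sum1_count; congr _.+1.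
by rewrite (@sum_side nat b (fun=> 1%N)) sum1_card card_ord.
Qed.

Lemma Ep_root i : (Ep (side i)).['X_i] = 0.
Proof.
rewrite /Ep horner_prod; apply/eqP/prodf_eq0; exists i; first exact: eqxx.
by rewrite hornerXsubC subrr.
Qed.

Definition red b (h : {poly R}) := Pdiv.CommonRing.rmodp h (Ep b).

Lemma size_red b h : (size (red b h) <= nb b)%N.
Proof.
by rewrite -ltnS -size_Ep Pdiv.CommonRing.ltn_rmodpN0 // monic_neq0 // Ep_monic.
Qed.

Lemma red_horner i h : (red (side i) h).['X_i] = h.['X_i].
Proof.
by rewrite [in RHS](Pdiv.RingMonic.rdivp_eq (Ep_monic (side i)) h) hornerD hornerM Ep_root mulr0 add0r.
Qed.

Definition Cf (h : 'I_k -> {poly R}) : 'M[R]_k :=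
  \matrix_(i, j) if same i j then (red (side i) (h i))`_(rk j) else 0.
Definition Am (h : 'I_k -> {poly R}) : 'M[R]_k :=
  \matrix_(i, j) if same i j then (h i).['X_j] else 0.
(** By [Am_Cf] this is the quotient of the block alternant of [h] by the block Vandermonde
    determinant, a generalized Schur polynomial obtained without division. *)
Definition tS h : R := \det (Cf h).
Definition hX (c : 'I_k -> nat) i : {poly R} := 'X^(c i).
Definition Vm := Am (hX rk).
Definition Dm : R := \det Vm.

(** Each [X_j] is a root of the [Ep] of its own side, so evaluating [h i] there is the same as
    evaluating its remainder. *)
Lemma Am_Cf h : Am h = Cf h *m Vm.
Proof.
apply/matrixP => i j; rewrite !mxE.
rewrite (eq_bigr (fun m => if same i m && same m j then (red (side i) (h i))`_(rk m) * 'X_j ^+ rk m else 0)); last first.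
  by move=> m _; rewrite !mxE /hX hornerXn; do 2!case: ifP; rewrite ?mul0r ?mulr0.
rewrite -big_mkcond /=; case: ifP => sij; last first.
  rewrite big1 // => m /andP[/eqP e1 /eqP e2].
  by rewrite /same e1 e2 eqxx in sij.
rewrite -red_horner -(eqP sij) (horner_coef_wide _ (size_red _ _)).
rewrite -(@sum_side R (side i) (fun m : nat => (red (side i) (h i))`_m * 'X_j ^+ m)).
apply: eq_bigl => m; rewrite /same -(eqP sij).
by rewrite eq_sym; case: eqP => // ->; rewrite eqxx.
Qed.

Lemma det_Am h : \det (Am h) = tS h * Dm.
Proof. by rewrite Am_Cf det_mulmx. Qed.

Definition gst (s : 'S_k) := [forall i, side (s i) == side i].

Lemma gstP (s : 'S_k) : reflect (forall i, side (s i) = side i) (gst s).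
Proof. exact: 'forall_eqP. Qed.

Lemma gstV (s : 'S_k) : gst s -> gst s^-1%g.
Proof. by move/gstP => h; apply/gstP => i; rewrite -{2}(permKV s i) h. Qed.

Lemma det_Am_sum h :
  \det (Am h) = \sum_(s : 'S_k | gst s) (-1) ^+ s * \prod_i (h i).['X_(s i)].
Proof.
rewrite /determinant [LHS](bigID gst) /= [X in _ + X]big1 ?addr0; last first.
  move=> s /forallPn[i hi]; rewrite (bigD1 i) //= mxE /same eq_sym (negbTE hi).
  by rewrite mul0r mulr0.
apply: eq_bigr => s /gstP gs; congr (_ * _); apply: eq_bigr => i _.
by rewrite mxE /same gs eqxx.
Qed.

Definition ysym p := forall s : 'S_k, gst s -> msym s p = p.

Definition mplift (g : 'I_k -> {poly F}) i : {poly R} := map_poly (@mpolyC k F) (g i).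

Lemma msymC (s : 'S_k) c : msym s c%:MP = c%:MP :> R.
Proof. by rewrite -[in LHS]alg_mpolyC msymZ msym1 alg_mpolyC. Qed.

Lemma msymXi (s : 'S_k) i : msym s 'X_i = 'X_(s i) :> R.
Proof.
rewrite msymX; congr 'X_[_]; apply/mnmP => j.
by rewrite !mnmE -(inj_eq (@perm_inj _ s)) permKV.
Qed.

Lemma msym_lift (s : 'S_k) g i j : msym s (mplift g i).['X_j] = (mplift g i).['X_(s j)].
Proof.
rewrite /mplift !horner_coef !size_map_poly raddf_sum; apply: eq_bigr => m _ /=.
by rewrite msymM rmorphXn /= msymXi coef_map msymC.
Qed.

Lemma msym_det_Am (s : 'S_k) g : gst s -> msym s (\det (Am (mplift g))) = (-1) ^+ s * \det (Am (mplift g)).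
Proof.
move=> /gstP gs; rewrite -(det_map_mx (msym s)).
have -> : map_mx (msym s) (Am (mplift g)) = col_perm s (Am (mplift g)).
  apply/matrixP => i j; rewrite !mxE /same gs; case: ifP => _.
    exact: msym_lift.
  exact: raddf0.
by rewrite col_permE det_mulmx det_perm odd_permV mulrC.
Qed.

Definition newt (s : nat) : {poly F} := \prod_(m < s) ('X - (r m)%:P).
Definition hN (S : 'I_k -> nat) := mplift (fun i => newt (S i)).

Lemma hN_horner S i (x : R) : (hN S i).[x] = newton r (@mpolyC k F) x (S i).
Proof.
rewrite /hN /mplift /newt rmorph_prod horner_prod /newton; apply: eq_bigr => m _.
by rewrite rmorphB /= map_polyX map_polyC hornerXsubC.
Qed.

Definition Nst : F := (#|[pred s | gst s]|)%:R.

Lemma Nst_neq0 : Nst != 0.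
Proof.
rewrite pnatr_eq0 -lt0n; apply/card_gt0P; exists 1%g.
by rewrite inE; apply/gstP => i; rewrite perm1.
Qed.

(** The terms of the alternant are Newton products with permuted variables. Permuting them back
    costs the sign of the permutation, by [Theta_msym], and leaves [q] unchanged, so all terms
    contribute equally. *)
Lemma Theta_alternant S q : ysym q ->
  Theta (Jmx (fun=> 0%N)) (\det (Am (hN S)) * q) = Nst * Theta (Jmx S) q.
Proof.
move=> hq; rewrite det_Am_sum mulr_suml linear_sum /Nst -sumr_const mulr_suml.
apply: eq_big => s; first by rewrite inE.
move=> gs; rewrite mul1r.
rewrite (reindex_inj (@perm_inj _ s^-1%g)) /=.
under eq_bigr do rewrite permKV hN_horner.
rewrite -mulrA -signr_odd mulr_sign -[in RHS](hq s^-1%g (gstV gs)) Theta_msym row_perm_Jmx.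
rewrite odd_permV -(@Theta_newton _ _ r (fun i => S (s^-1%g i))).
rewrite -[in RHS]signr_odd mulr_sign oddb.
by case: odd_perm => //; rewrite linearN.
Qed.

End Schur.

End SchurBasis.
Import SchurBasis.

Section SchurTheory.
Variables (F : numFieldType) (k l : nat) (r : nat -> F).
Hypothesis lk : (l <= k)%N.
Local Notation R := {mpoly F[k]}.
Local Notation Theta := (Theta r).
Local Notation Jmx := (@Jmx F k).
Local Notation side := (@side k l).
Local Notation rk := (@rk k l).
Local Notation same := (@same k l).
Local Notation red := (@red F k l).
Local Notation Cf := (@Cf F k l).
Local Notation Am := (@Am F k l).
Local Notation tS := (@tS F k l).
Local Notation Dm := (@Dm F k l).
Local Notation hX := (@hX F k).
Local Notation hN := (@hN F k r).
Local Notation mplift := (@mplift F k).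
Local Notation newt := (@newt F r).
Local Notation ysym := (@ysym F k l).
Local Notation gst := (@gst k l).
Implicit Types (i j m : 'I_k) (p q : R) (b : bool).

Lemma eq_Cf h h' : h =1 h' -> Cf h = Cf h'.
Proof. by move=> e; apply/matrixP => i j; rewrite !mxE e. Qed.

Lemma eq_tS h h' : h =1 h' -> tS h = tS h'.
Proof. by move=> e; rewrite /SchurBasis.tS (eq_Cf e). Qed.

Lemma eq_Am h h' : h =1 h' -> Am h = Am h'.
Proof. by move=> e; apply/matrixP => i j; rewrite !mxE e. Qed.

Lemma red_small b (h : {poly R}) : (size h <= nb k l b)%N -> red b h = h.
Proof. by move=> sh; rewrite /SchurBasis.red Pdiv.CommonRing.rmodp_small // size_Ep. Qed.

(** The factor of [tS h] coming from one side. Rows of the other side are replaced by identity rows,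
    which keeps the size [k] and makes the factorization a matrix product. *)
Definition dside b (h : 'I_k -> {poly R}) : R :=
  \det (\matrix_(i, j) if same i j then
    (if side i == b then (red (side i) (h i))`_(rk j) else (i == j)%:R) else 0).

Lemma dside_ext b h h' : (forall i, side i = b -> h i = h' i) -> dside b h = dside b h'.
Proof.
move=> e; congr (\det _); apply/matrixP => i j; rewrite !mxE.
by do 2!case: ifP => //; move=> /eqP si _; rewrite e.
Qed.

(** Monic polynomials of degree exactly [rk i] are already reduced, so the matrix is
    unitriangular. *)
Lemma dside_monic b h : (forall i, side i = b -> h i \is monic) ->
  (forall i, side i = b -> size (h i) = (rk i).+1) -> dside b h = 1.
Proof.
move=> hm hs; rewrite /dside det_trig; last first.
  apply/is_trig_mxP => i j ij; rewrite mxE; case: ifP => // sij.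
  case: ifP => [/eqP si|_]; last by rewrite -val_eqE ltn_eqF.
  rewrite red_small; last by rewrite hs ?rk_lt.
  rewrite nth_default // hs //.
  move: sij ij; rewrite /SchurBasis.same /SchurBasis.rk /SchurBasis.side => /eqP.
  by case: (ltnP i l); case: (ltnP j l) => //=; lia.
rewrite big1 // => i _; rewrite mxE /SchurBasis.same eqxx.
case: ifP => [/eqP si|_]; last by rewrite eqxx.
rewrite red_small; last by rewrite hs ?rk_lt.
by have /monicP := hm i si; rewrite lead_coefE hs.
Qed.

Lemma tS_dside h : tS h = dside true h * dside false h.
Proof.
rewrite /dside -det_mulmx; congr (\det _); apply/matrixP => i j; rewrite !mxE.
case si: (side i).
  rewrite (bigD1 j) //= !mxE big1 ?addr0.
    case: ifP => sij; last by rewrite mul0r.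
    rewrite si eqxx /SchurBasis.same eqxx -(eqP sij) si eqxx.
    by rewrite mulr1.
  move=> m mj; rewrite !mxE; case: ifP => sim; last by rewrite mul0r.
  by rewrite -(eqP sim) si eqxx (negbTE mj) if_same mulr0.
rewrite (bigD1 i) //= !mxE big1 ?addr0.
  by rewrite /SchurBasis.same eqxx si !eqxx mul1r.
by move=> m mj; rewrite !mxE si /= eq_sym (negbTE mj) if_same mul0r.
Qed.

Lemma newt_monic s : newt s \is monic.
Proof. by apply: monic_prod => m _; apply: monicXsubC. Qed.

Lemma size_newt s : size (newt s) = s.+1.
Proof. by rewrite /SchurBasis.newt size_prod_XsubC /= /index_enum -enumT size_enum_ord. Qed.

Lemma lift_newt_monic s : map_poly (@mpolyC k F) (newt s) \is monic.
Proof. by rewrite map_monic newt_monic. Qed.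

Lemma size_lift (q : {poly F}) : size (map_poly (@mpolyC k F) q) = size q.
Proof. exact: size_map_poly. Qed.

Lemma dside_newt b S : (forall i, side i = b -> S i = rk i) -> dside b (hN S) = 1.
Proof.
move=> e; apply: dside_monic => i si; rewrite /SchurBasis.hN /SchurBasis.mplift e //.
  exact: lift_newt_monic.
by rewrite size_lift size_newt.
Qed.

Lemma tS_newt_rk : tS (hN rk) = 1.
Proof. by rewrite tS_dside !dside_newt ?mulr1. Qed.

Lemma tS_glue S S' : (forall i, side i = false -> S i = rk i) ->
   (forall i, side i = true -> S' i = rk i) ->
  tS (hN S) * tS (hN S') = tS (hN (fun i => if side i then S i else S' i)).
Proof.
set G := fun i => _; move=> h h'.
have e1 : dside true (hN G) = dside true (hN S).
  by apply: dside_ext => i si; rewrite /SchurBasis.hN /SchurBasis.mplift /G si.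
have e2 : dside false (hN G) = dside false (hN S').
  by apply: dside_ext => i si; rewrite /SchurBasis.hN /SchurBasis.mplift /G si.
rewrite (tS_dside (hN G)) e1 e2 (tS_dside (hN S)) (tS_dside (hN S')).
by rewrite (dside_newt h) (dside_newt h') mulr1 mul1r.
Qed.

Lemma det_Am_newt_rk : \det (Am (hN rk)) = Dm.
Proof. by rewrite det_Am // tS_newt_rk mul1r. Qed.

Lemma ysym1 : ysym 1.
Proof. by move=> s _; rewrite rmorph1. Qed.

(** If the Vandermonde determinant vanished, so would every alternant; but on the alternant of the
    index [i |-> i] the functional at zero takes a nonzero multiple of the determinant of the
    identity. *)
Lemma Dm_neq0 : Dm != 0.
Proof.
apply/eqP => D0; have := @Theta_alternant F k l r (fun i => i : nat) 1 ysym1.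
rewrite det_Am // D0 mulr0 mul0r raddf0 => /esym/eqP.
rewrite mulf_eq0 (negbTE (Nst_neq0 F k l)) /= Theta1.
rewrite (_ : Jmx _ = Jmx (fun i => (1 : 'S_k)%g i)); last first.
  by apply: eq_Jmx => i; rewrite perm1.
by rewrite det_Jmx_perm odd_perm1 oner_eq0.
Qed.

Lemma hX_lift c : hX c =1 mplift (fun i => 'X^(c i)).
Proof. by move=> i; rewrite /SchurBasis.hX /SchurBasis.mplift rmorphXn /= map_polyX. Qed.

Lemma msym_Dm (s : 'S_k) : gst s -> msym s Dm = (-1) ^+ s * Dm.
Proof. by move=> gs; rewrite /SchurBasis.Dm /Vm (eq_Am (hX_lift _)) msym_det_Am. Qed.

(** A quotient of two polynomials that change by the same sign. *)
Lemma tS_sym g : ysym (tS (mplift g)).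
Proof.
move=> s gs; have := msym_det_Am g gs; rewrite det_Am // msymM msym_Dm //.
by rewrite mulrCA => /(mulfI (negbT (signr_eq0 _ _))) /(mulIf Dm_neq0).
Qed.

Lemma ysymM p q : ysym p -> ysym q -> ysym (p * q).
Proof. by move=> hp hq s gs; rewrite msymM hp // hq. Qed.

Lemma ysym_lin c p q : ysym p -> ysym q -> ysym (c *: p + q).
Proof. by move=> hp hq s gs; rewrite msymD msymZ hp // hq. Qed.

(** Times [Nst], both sides are the functional at zero applied to the alternant of [S] times [q],
    because the alternant of [rk] is the Vandermonde determinant itself. Thus a single functional
    yields all the others by multiplication, which is the source of the nondegenerate Frobenius
    form. *)
Lemma Theta_tS S q : ysym q ->
  Theta (Jmx rk) (tS (hN S) * q) = Theta (Jmx S) q.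
Proof.
move=> hq; apply: (mulfI (Nst_neq0 F k l)).
have ht : ysym (tS (hN S) * q) by apply: ysymM => //; apply: tS_sym.
rewrite -(Theta_alternant _ S hq) -(Theta_alternant _ rk ht) det_Am_newt_rk det_Am //.
by rewrite mulrA (mulrC Dm).
Qed.

Lemma det_Am_hX c :
  \det (Am (hX c)) = \sum_(s : 'S_k | gst s) (-1) ^+ s * msym s (\prod_i 'X_i ^+ c i).
Proof.
rewrite det_Am_sum; apply: eq_bigr => s gs; congr (_ * _).
rewrite rmorph_prod; apply: eq_bigr => i _.
by rewrite /SchurBasis.hX hornerXn rmorphXn /= msymXi.
Qed.

(* bialternant form of the fundamental theorem for a Young subgroup *)
Lemma ysym_expand p : ysym p ->
  p = \sum_(m <- msupp p) p@_m *: tS (hX (fun i => m i + rk i)%N).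
Proof.
move=> hp; apply: (mulIf Dm_neq0); rewrite mulr_suml.
under eq_bigr do rewrite -scalerAl -det_Am // det_Am_hX scaler_sumr.
rewrite exchange_big /= {1}/SchurBasis.Dm /Vm det_Am_hX mulr_sumr; apply: eq_bigr => s gs.
rewrite mulrCA -{1}(hp s gs) -msymM.
rewrite {1}[p]mpolyE mulr_suml (raddf_sum (msym s)) mulr_sumr.
apply: eq_bigr => m _ /=; rewrite -scalerAl msymZ -scalerAr; congr (_ *: (_ * msym _ _)).
by rewrite mpolyXE_id -big_split /=; apply: eq_bigr => i _; rewrite exprD.
Qed.

End SchurTheory.

Lemma det_sum_rows (R : comPzRingType) n (J : finType) (c : 'I_n -> J -> R)
    (Q : 'I_n -> J -> 'I_n -> R) :
  \det (\matrix_(i, j) \sum_a c i a * Q i a j) =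
  \sum_(f : {ffun 'I_n -> J}) (\prod_i c i (f i)) * \det (\matrix_(i, j) Q i (f i) j).
Proof.
rewrite /determinant; under [RHS]eq_bigr do rewrite mulr_sumr.
rewrite exchange_big /=; apply: eq_bigr => s _.
under [RHS]eq_bigr do rewrite mulrCA -big_split /=.
rewrite -mulr_sumr; congr (_ * _).
under eq_bigr do rewrite !mxE.
rewrite bigA_distr_bigA /=; apply: eq_bigr => f _.
by apply: eq_bigr => i _; rewrite !mxE.
Qed.

(** * Subspaces and subalgebras of polynomials as predicates *)

Section AlgClosed.
Variables (F : numFieldType) (k : nat).
Local Notation R := {mpoly F[k]}.
Variable P : R -> Prop.

Definition lin_closed := P 0 /\ (forall c u v, P u -> P v -> P (c *: u + v)).
Definition alg_closed := [/\ P 1, (forall c u v, P u -> P v -> P (c *: u + v))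
   & (forall u v, P u -> P v -> P (u * v))].

Lemma alg_lin : alg_closed -> lin_closed.
Proof.
case=> P1 Pl _; split=> //; have := Pl (-1) 1 1 P1 P1.
by rewrite scaleN1r addNr.
Qed.

Hypothesis Pl : lin_closed.

Lemma lin_D u v : P u -> P v -> P (u + v).
Proof. by move=> hu hv; rewrite -[u]scale1r; apply: Pl.2. Qed.

Lemma lin_Z c u : P u -> P (c *: u).
Proof. by move=> hu; rewrite -[_ *: _]addr0; apply: Pl.2 => //; case: Pl. Qed.

Lemma lin_B u v : P u -> P v -> P (u - v).
Proof. by move=> hu hv; rewrite addrC -scaleN1r; apply: Pl.2. Qed.

Lemma lin_sum (I : Type) (s : seq I) (Q : pred I) (f : I -> R) :
  (forall i, Q i -> P (f i)) -> P (\sum_(i <- s | Q i) f i).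
Proof. by move=> h; elim/big_ind: _ => //; [case: Pl | apply: lin_D]. Qed.

Lemma coef_val (q : {poly R}) : (forall x : F, P q.[x%:MP]) -> forall j, P q`_j.
Proof.
move=> h j; have [sj|js] := ltnP j (size q); last by rewrite nth_default //; case: Pl.
apply: (@coef_closed F _ P (size q) [::] (fun i => q`_i)) => //; [by case: Pl | by case: Pl |].
move=> x _; have := h x; rewrite horner_coef.
rewrite (eq_bigr (fun i : 'I_(size q) => x ^+ i *: q`_i)) // => i _.
by rewrite -rmorphXn mulrC mul_mpolyC.
Qed.

End AlgClosed.

Section AlgClosed2.
Variables (F : numFieldType) (k l : nat) (r : nat -> F).
Hypothesis lk : (l <= k)%N.
Local Notation R := {mpoly F[k]}.
Variable P : R -> Prop.
Hypothesis Pa : alg_closed P.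
Let Pl : lin_closed P := alg_lin Pa.

Lemma alg_prod (I : Type) (s : seq I) (Q : pred I) (f : I -> R) :
  (forall i, Q i -> P (f i)) -> P (\prod_(i <- s | Q i) f i).
Proof. by move=> h; case: Pa => P1 _ PM; elim/big_ind: _. Qed.

Lemma alg_det n (M : 'M[R]_n) : (forall i j, P (M i j)) -> P (\det M).
Proof.
move=> h; apply: (lin_sum Pl) => s _; rewrite -signr_odd mulr_sign.
case: odd; first by rewrite -scaleN1r; apply: (lin_Z Pl); apply: alg_prod.
exact: alg_prod.
Qed.

(** The remainder of [x^(c+1)] is [x] times that of [x^c] minus a multiple of the monic [Ep], so
    only ring operations on the coefficients of [Ep] occur. *)
Lemma red_X_coef b c : (forall j, P (Ep F k l b)`_j) -> forall j, P (red l b 'X^c : {poly R})`_j.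
Proof.
move=> hE; have P0 : P 0 by case: Pl.
have P1 : P 1 by case: Pa.
case ed: (nb k l b) => [|d].
  move=> j; have := size_red lk b ('X^c : {poly R}); rewrite ed leqn0 size_poly_eq0.
  by move=> /eqP ->; rewrite coef0.
elim: c => [|c IH] j.
  rewrite expr0 red_small ?ed ?size_poly1 // coef1.
  by case: eqP.
set rho := red l b 'X^c in IH *.
have sr : (size rho <= d.+1)%N by rewrite -ed; apply: size_red.
have eE : (Ep F k l b)`_d.+1 = 1.
  by have /monicP := @Ep_monic F k l b; rewrite lead_coefE size_Ep // ed.
suff -> : red l b ('X^(c.+1) : {poly R}) = 'X * rho - rho`_d *: Ep F k l b.
  rewrite coefB coefZ coefXM; apply: (lin_B Pl).
    by case: eqP.
  by case: Pa => _ _ PM; apply: PM.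
rewrite exprS /red -(Pdiv.RingMonic.rmodp_mulmr (@Ep_monic F k l b)) -/(red l b 'X^c) -/rho.
rewrite -[X in Pdiv.CommonRing.rmodp X](subrK (rho`_d *: Ep F k l b)).
rewrite Pdiv.RingMonic.rmodpD ?Ep_monic // Pdiv.RingMonic.rmodpZ ?Ep_monic //.
rewrite Pdiv.RingMonic.rmodpp ?Ep_monic // scaler0 addr0.
apply: red_small => //; rewrite ed; apply/leq_sizeP => i hi.
rewrite coefB coefZ coefXM gtn_eqF ?(leq_trans _ hi) //.
have [e|ne] := eqVneq i d.+1; first by rewrite e eE mulr1 subrr.
have {}hi : (d.+1 < i)%N by rewrite ltn_neqAle eq_sym ne.
rewrite [rho`_i.-1]nth_default; last by rewrite (leq_trans sr) //; lia.
by rewrite [(Ep _ _ _ _)`_i]nth_default ?mulr0 ?subr0 // size_Ep // ed.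
Qed.

Lemma tS_hX_closed c : (forall b j, P (Ep F k l b)`_j) -> P (tS l (hX F c)).
Proof.
move=> hE; apply: alg_det => i j; rewrite mxE; case: ifP => _; last by case: Pl.
by apply: red_X_coef.
Qed.

(** With [ysym_expand] this is the fundamental theorem for the Young subgroup: the coefficients of
    the two [Ep] generate. *)
Lemma ysym_closed p : (forall b j, P (Ep F k l b)`_j) -> ysym l p -> P p.
Proof.
move=> hE hp; rewrite (ysym_expand r lk hp); apply: (lin_sum Pl) => m _.
by apply: (lin_Z Pl); apply: tS_hX_closed.
Qed.

(** Long division from the top: since [B] is monic, a coefficient of [A] is one of [A * B] minus
    terms with higher coefficients of [A]. *)
Lemma quo_closed (A B : {poly R}) : B \is monic -> (forall j, P (A * B)`_j) ->
  (forall j, P B`_j) -> forall j, P A`_j.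
Proof.
move=> mB hAB hB.
suff H n j : (size A <= j + n)%N -> P A`_j by move=> j; apply: (H (size A)); apply: leq_addl.
elim: n j => [|n IH] j; first by rewrite addn0 => h; rewrite nth_default //; case: Pl.
move=> hj; pose d := (size B).-1.
have : (A * B)`_(j + d) = A`_j + \sum_(i < (j + d).+1 | i != j :> nat) A`_i * B`_(j + d - i).
  rewrite coefM; have jd : (j < (j + d).+1)%N by rewrite ltnS leq_addr.
  rewrite (bigD1 (Ordinal jd)) //= addKn.
  by have /monicP := mB; rewrite lead_coefE => ->; rewrite mulr1.
move=> e; have -> : A`_j = (A * B)`_(j + d) - \sum_(i < (j + d).+1 | i != j :> nat) A`_i * B`_(j + d - i).
  by rewrite e addrK.
apply: (lin_B Pl) => //; apply: (lin_sum Pl) => i ij.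
have [lij|lji] := ltnP i j.
  rewrite [B`_ _]nth_default ?mulr0; first by case: Pl.
  by apply: leq_trans (leqSpred _) _; rewrite -/d; lia.
case: Pa => _ _ PM; apply: PM => //; apply: IH.
have : (j < i)%N by rewrite ltn_neqAle eq_sym ij.
lia.
Qed.

End AlgClosed2.

(** * The quotient by the elementary symmetric relations *)

Module SymQuotient.

Section Quotient.
Variables (F : numFieldType) (k l : nat) (r : nat -> F).
Hypothesis lk : (l <= k)%N.
Local Notation R := {mpoly F[k]}.
Local Notation side := (@side k l).
Local Notation rk := (@rk k l).
Local Notation hN := (@hN F k r).
Local Notation tS := (@tS F k l).
Local Notation Ep := (@Ep F k l).
Local Notation newt := (@newt F r).
Local Notation rpt := (@rpt F k r).
Implicit Types (i : 'I_k) (p q : R) (b : bool).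

(** The ideal is taken in the full polynomial ring, where membership propagates through determinants
    and remainders; [inI_ysym] later makes the multipliers symmetric. *)
Definition inI p := exists a : 'I_k -> R,
  p = \sum_(i < k) a i * (mesym k F i.+1 - ((mesym k F i.+1).@[rpt])%:MP).

Lemma inI_lin : lin_closed inI.
Proof.
split; first by exists (fun=> 0); rewrite big1 // => i _; rewrite mul0r.
move=> c u v [a ->] [a' ->]; exists (fun i => c *: a i + a' i).
rewrite scaler_sumr -big_split /=; apply: eq_bigr => i _.
by rewrite mulrDl scalerAl.
Qed.

Lemma inI_mul p q : inI q -> inI (p * q).
Proof.
move=> [a ->]; exists (fun i => p * a i); rewrite mulr_sumr.
by apply: eq_bigr => i _; rewrite mulrA.
Qed.

Lemma inI_mesym j : inI (mesym k F j - ((mesym k F j).@[rpt])%:MP).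
Proof.
case: j => [|j]; first by rewrite mesym0E meval1 subrr; case: inI_lin.
have [jk|kj] := ltnP j k; last first.
  by rewrite mesym_geqnE // meval0 subr0; case: inI_lin.
exists (fun i => (i == Ordinal jk)%:R).
rewrite (bigD1 (Ordinal jk)) //= eqxx mul1r big1 ?addr0 // => i /negbTE ->.
by rewrite mul0r.
Qed.

Definition newtk : {poly R} := map_poly (@mpolyC k F) (newt k).

Lemma Ep_val b (x : F) : (Ep b).[x%:MP] = \prod_(i < k | side i == b) (x%:MP - 'X_i).
Proof.
rewrite /SchurBasis.Ep horner_prod; apply: eq_bigr => i _; exact: hornerXsubC.
Qed.

Lemma Ep_mul : Ep true * Ep false = \prod_(i < k) ('X - ('X_i)%:P).
Proof.
rewrite [RHS](bigID (fun i => side i == true)) /=; congr (_ * _).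
by apply: eq_bigl => i; case: (side i).
Qed.

Lemma Ep_mul_val (x : F) : (Ep true * Ep false).[x%:MP] =
  \sum_(j < k.+1) ((-1) ^+ j * x ^+ (k - j)) *: mesym k F j.
Proof.
rewrite -prod_sub_mesym Ep_mul horner_prod; apply: eq_bigr => i _.
exact: hornerXsubC.
Qed.

Lemma newtk_val (x : F) : newtk.[x%:MP] = (\prod_(i < k) (x - r i))%:MP.
Proof.
rewrite /newtk horner_map /= /SchurBasis.newt horner_prod; congr (_%:MP).
by apply: eq_bigr => i _; exact: hornerXsubC.
Qed.

Lemma inI_newtk j : inI (Ep true * Ep false - newtk)`_j.
Proof.
apply: coef_val j; first exact: inI_lin.
move=> x; rewrite hornerD hornerN Ep_mul_val newtk_val mesym_rpt.
rewrite rmorph_sum -sumrB; apply: (lin_sum inI_lin) => j _ /=.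
have key c (u : R) v : c *: u - (c * v)%:MP = c *: (u - v%:MP).
  by rewrite scalerBr -[c *: _%:MP]mul_mpolyC mpolyCM.
by rewrite key; apply: (lin_Z inI_lin); apply: inI_mesym.
Qed.

Lemma inI_red b (h : {poly R}) : (forall j, inI h`_j) -> forall j, inI (red l b h)`_j.
Proof.
move=> hI j; rewrite -[h]coefK poly_def /red.
rewrite Pdiv.RingMonic.rmodp_sum ?Ep_monic // coef_sum.
apply: (lin_sum inI_lin) => i _.
rewrite Pdiv.RingMonic.rmodpZ ?Ep_monic // coefZ mulrC.
by apply: inI_mul.
Qed.

(** Index [k] means the row of [newt k], which is congruent to [Ep true * Ep false] modulo the ideal
    and therefore reduces to zero modulo [Ep false]. *)
Lemma inI_tS S i : side i = false -> S i = k -> inI (tS (hN S)).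
Proof.
move=> si Si; rewrite /SchurBasis.tS (expand_det_row _ i); apply: (lin_sum inI_lin) => j _.
rewrite mulrC; apply: inI_mul; rewrite mxE; case: ifP => _; last by case: inI_lin.
rewrite /SchurBasis.hN /mplift Si si -/newtk.
have -> : red l false newtk = - red l false (Ep true * Ep false - newtk).
  rewrite /red Pdiv.RingMonic.rmodpB ?Ep_monic //.
  by rewrite Pdiv.RingMonic.rmodp_mull ?Ep_monic // sub0r opprK.
rewrite coefN -scaleN1r; apply: (lin_Z inI_lin).
by apply: inI_red; apply: inI_newtk.
Qed.

Definition Sof (J : 'I_k -> 'I_k) i : nat := if side i then rk i else J i.
Definition tR (J : {ffun 'I_k -> 'I_k}) : R := tS (hN (Sof J)).
(** The span, modulo the ideal, of Schur polynomials in the second group of variables with all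
    indices below [k]. Its stability under the generators bounds the dimension of the quotient. *)
Definition Zp p := exists c : {ffun 'I_k -> 'I_k} -> F, inI (p - \sum_J c J *: tR J).

Lemma Zp_lin : lin_closed Zp.
Proof.
split; first by exists (fun=> 0); rewrite big1 ?subr0; [case: inI_lin | move=> J _; rewrite scale0r].
move=> c u v [a ha] [a' ha']; exists (fun J => c * a J + a' J).
have -> : c *: u + v - \sum_J (c * a J + a' J) *: tR J =
  c *: (u - \sum_J a J *: tR J) + (v - \sum_J a' J *: tR J).
  rewrite scalerBr scaler_sumr addrACA -opprD -big_split /=; congr (_ - _).
  by apply: eq_bigr => J _; rewrite scalerDl scalerA.
by apply: inI_lin.2.
Qed.

Lemma Zp_inI p : inI p -> Zp p.
Proof. by move=> h; exists (fun=> 0); rewrite big1 ?subr0 // => J _; rewrite scale0r. Qed.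

Lemma Zp_tR J : Zp (tR J).
Proof.
exists (fun J' => (J' == J)%:R); rewrite (bigD1 J) //= eqxx scale1r big1 ?addr0.
  by rewrite subrr; case: inI_lin.
by move=> J' /negbTE ->; rewrite scale0r.
Qed.

Lemma Zp_tS S : (forall i, side i = true -> S i = rk i) ->
  (forall i, (S i <= k)%N) -> Zp (tS (hN S)).
Proof.
move=> St Sk; case: (boolP [exists i, (side i == false) && (S i == k)]).
  by case/existsP => i /andP[/eqP si /eqP Si]; apply: Zp_inI; apply: inI_tS Si.
move/existsPn => h.
have hlt i : side i = false -> (S i < k)%N.
  by move=> si; rewrite ltn_neqAle Sk andbT; have := h i; rewrite si.
pose J : {ffun 'I_k -> 'I_k} := [ffun i => insubd i (S i)].
have -> : tS (hN S) = tR J; last exact: Zp_tR.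
apply: eq_tS => i; rewrite /SchurBasis.hN /mplift /Sof; case si: (side i); first by rewrite St.
by rewrite ffunE val_insubd hlt.
Qed.

(** Multiplying each column [j] of the second side of the alternant by [x - X_j] amounts to
    multiplying the polynomials [h i] of that side by [x - 'X]. *)
Lemma tS_mul_Ep h (x : F) :
  tS h * (Ep false).[x%:MP] =
  tS (fun i => if side i then h i else ((x%:MP)%:P - 'X) * h i).
Proof.
apply: (mulIf (Dm_neq0 r lk)); rewrite -(det_Am lk).
have -> : Am l (fun i => if side i then h i else ((x%:MP)%:P - 'X) * h i) =
   Am l h *m diag_mx (\row_j if side j then 1 else x%:MP - 'X_j).
  apply/matrixP => i j; rewrite mul_mx_diag !mxE; case: ifP => sij; last by rewrite mul0r.
  rewrite /same in sij; rewrite (eqP sij); case: (side j); first by rewrite mulr1.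
  by rewrite hornerM hornerD hornerN hornerC hornerX mulrC.
rewrite det_mulmx det_diag det_Am // mulrAC; congr (_ * _).
rewrite Ep_val [LHS]big_mkcond; apply: eq_bigr => i _; rewrite mxE.
by case: (side i).
Qed.

Lemma newtS s : newt s.+1 = newt s * ('X - (r s)%:P).
Proof. by rewrite /SchurBasis.newt big_ord_recr. Qed.

Lemma mplift_shift (x : F) s :
  ((x%:MP)%:P - 'X) * map_poly (@mpolyC k F) (newt s) =
  (x - r s)%:MP *: map_poly (@mpolyC k F) (newt s) +
  (-1)%:MP *: map_poly (@mpolyC k F) (newt s.+1).
Proof.
have -> : map_poly (@mpolyC k F) (newt s.+1) =
    map_poly (@mpolyC k F) (newt s) * ('X - ((r s)%:MP)%:P).
  by rewrite newtS rmorphM /= map_polyXsubC.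
rewrite -!mul_polyC mpolyCB mpolyCN polyCB polyCN.
have key (A : comPzRingType) (a X rr N : A) :
  (a - X) * N = (a - rr) * N + (- 1) * (N * (X - rr)) by ring.
exact: key.
Qed.

(** A Pieri rule: [x - 'X] times a Newton polynomial involves only the same index and the next one,
    and an index that reaches [k] falls into the ideal. *)
Lemma Zp_shift (x : F) S : (forall i, side i = true -> S i = rk i) ->
  (forall i, side i = false -> (S i < k)%N) ->
  Zp (tS (fun i => if side i then hN S i else ((x%:MP)%:P - 'X) * hN S i)).
Proof.
move=> St Sk.
(* The bit [a] records whether the index of row [i] is raised; on the first side only the unraised
   term has a nonzero coefficient. *)
pose c (i : 'I_k) (a : bool) : F :=
  if side i then (if a then 0 else 1) else (if a then -1 else x - r (S i)).
pose Sf (f : {ffun 'I_k -> bool}) i := (S i + (f i && ~~ side i))%N.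
pose Q (i : 'I_k) (a : bool) (j : 'I_k) : R := if same l i j then
  (red l (side i) (map_poly (@mpolyC k F) (newt (S i + (a && ~~ side i)))))`_(rk j) else 0.
rewrite /SchurBasis.tS (_ : Cf _ _ = \matrix_(i, j) \sum_a (c i a)%:MP * Q i a j); last first.
  apply/matrixP => i j; rewrite !mxE big_bool /Q /c /SchurBasis.hN /mplift /=.
  case: ifP => _; last by rewrite !mulr0 addr0.
  case: (side i) => /=; first by rewrite mpolyC0 mpolyC1 mul0r mul1r add0r addn0.
  rewrite addn1 addn0 mplift_shift /red.
  rewrite Pdiv.RingMonic.rmodpD ?Ep_monic // !Pdiv.RingMonic.rmodpZ ?Ep_monic //.
  by rewrite coefD !coefZ addrC.
rewrite det_sum_rows; apply: (lin_sum Zp_lin) => f _.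
rewrite -rmorph_prod mul_mpolyC; apply: (lin_Z Zp_lin).
rewrite (_ : \det _ = tS (hN (Sf f))); last first.
  by congr (\det _); apply/matrixP => i j; rewrite !mxE.
apply: Zp_tS => i; rewrite /Sf.
  by move=> si; rewrite si andbF addn0 St.
case si: (side i); last by rewrite andbT; have := Sk i si; case: (f i); lia.
by rewrite andbF addn0 St // (leq_trans (ltnW (rk_lt lk i))) // /nb si.
Qed.

Lemma Zp_Ef p (x : F) : Zp p -> Zp ((Ep false).[x%:MP] * p).
Proof.
move=> [c hc]; rewrite -[p](subrK (\sum_J c J *: tR J)) mulrDr.
apply: (lin_D Zp_lin).
  by apply: Zp_inI; apply: inI_mul.
rewrite mulr_sumr; apply: (lin_sum Zp_lin) => J _.
rewrite -scalerAr; apply: (lin_Z Zp_lin); rewrite mulrC /tR tS_mul_Ep.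
apply: Zp_shift => i si; rewrite /Sof si //.
Qed.

Definition Zstab (u : R) := forall p, Zp p -> Zp (u * p).

Lemma Zstab_alg : alg_closed Zstab.
Proof.
split.
- by move=> p; rewrite mul1r.
- move=> c u v hu hv p hp; rewrite mulrDl -scalerAl.
  by apply: Zp_lin.2; [apply: hu | apply: hv].
- by move=> u v hu hv p hp; rewrite -mulrA; apply: hu; apply: hv.
Qed.

Lemma Zstab_inI u : inI u -> Zstab u.
Proof. by move=> hu p hp; apply: Zp_inI; rewrite mulrC; apply: inI_mul. Qed.

(** The Pieri rule handles the second side. Modulo the ideal, [Ep true] is the quotient of [newt k],
    with scalar coefficients, by the monic [Ep false], which settles the first side. *)
Lemma Zstab_Ep b j : Zstab (Ep b)`_j.
Proof.
have Pl := alg_lin Zstab_alg.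
have Hf m : Zstab (Ep false)`_m.
  by apply: (coef_val Pl) => x p; apply: Zp_Ef.
case: b => //; apply: (quo_closed lk Zstab_alg (@Ep_monic F k l false)) => // m.
rewrite -[Ep true * _](subrK newtk) coefD; apply: (lin_D Pl).
  by apply: Zstab_inI; apply: inI_newtk.
rewrite (_ : newtk`_m = (newt k)`_m *: 1); last by rewrite coef_map alg_mpolyC.
by apply: (lin_Z Pl); case: Zstab_alg.
Qed.

Lemma Zp1 : Zp 1.
Proof.
rewrite -(tS_newt_rk r lk); apply: Zp_tS => // i.
apply: leq_trans (ltnW (rk_lt lk i)) _; rewrite /nb; case: side => //; exact: leq_subr.
Qed.

Lemma ysym_Zp p : ysym l p -> Zp p.
Proof.
move=> hp; rewrite -[p]mulr1; apply: (ysym_closed r lk Zstab_alg _ hp); last exact: Zp1.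
exact: Zstab_Ep.
Qed.

End Quotient.

End SymQuotient.
Import SymQuotient.

(** * The coefficients of [Phi] as generators *)

Module GeneratorPhi.

Section Reverse.
Variable R : comNzRingType.
Implicit Types (p q : {poly R}) (d e i : nat).

(** [u^d p(1/u)]: coefficients listed from the top, so that degree from the top is additive in
    products. *)
Definition revp d p : {poly R} := \sum_(i < d.+1) p`_i *: 'X^(d - i).

Lemma coef_revp d p i : (revp d p)`_i = if (i <= d)%N then p`_(d - i) else 0.
Proof.
rewrite coef_sum; case: leqP => hi.
  have h : (d - i < d.+1)%N by rewrite ltnS leq_subr.
  rewrite (bigD1 (Ordinal h)) //= coefZ coefXn subKn // eqxx mulr1 big1 ?addr0 //.
  move=> j; rewrite -val_eqE /= => ne; rewrite coefZ coefXn.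
  by case: eqP => [e|_]; [have := ltn_ord j; lia | rewrite mulr0].
rewrite big1 // => j _; rewrite coefZ coefXn.
by case: eqP => [e|_]; [lia | rewrite mulr0].
Qed.

Lemma revpM d e p q : (size p <= d.+1)%N -> (size q <= e.+1)%N ->
  revp (d + e) (p * q) = revp d p * revp e q.
Proof.
move=> sp sq.
have revD a (u v : {poly R}) : revp a (u + v) = revp a u + revp a v.
  by rewrite -big_split; apply: eq_bigr => i _; rewrite coefD scalerDl.
have rev0 a : revp a 0 = 0 by rewrite /revp big1 // => i _; rewrite coef0 scale0r.
have revS a (I : finType) (f : I -> {poly R}) : revp a (\sum_i f i) = \sum_i revp a (f i).
  by elim/big_rec2: _ => // i u v _ <-.
have revX a c m : (m <= a)%N -> revp a (c *: 'X^m) = c *: 'X^(a - m).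
  move=> ma; apply/polyP => i; rewrite coef_revp coefZ !coefZ !coefXn.
  case: leqP => h; last by case: eqP => [|_]; [lia | rewrite mulr0].
  by congr (_ * _%:R); congr nat_of_bool; apply/eqP/eqP; lia.
have expand a (u : {poly R}) : (size u <= a.+1)%N -> u = \sum_(i < a.+1) u`_i *: 'X^i.
  move=> su; rewrite -poly_def; apply/polyP => i; rewrite coef_poly.
  by case: ltnP => // h; rewrite nth_default // (leq_trans su).
rewrite {1}(expand d p sp) {1}(expand e q sq) mulr_suml revS [revp d p]/revp mulr_suml.
apply: eq_bigr => i _; rewrite mulr_sumr revS [revp e q]/revp mulr_sumr; apply: eq_bigr => j _.
rewrite -scalerAl -scalerAr scalerA -exprD revX; last first.
  by have := ltn_ord i; have := ltn_ord j; lia.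
rewrite -scalerAl -scalerAr scalerA -exprD; congr (_ *: 'X^_).
by have := ltn_ord i; have := ltn_ord j; lia.
Qed.

Lemma coef_Xsub1_top n m : (n <= m)%N -> (('X - 1 : {poly R}) ^+ n)`_m = (m == n)%:R.
Proof.
rewrite -polyC1 => hm; have [->|ne] := eqVneq m n.
  have /monicP : ('X - (1 : R)%:P) ^+ n \is monic by rewrite monic_exp ?monicXsubC.
  by rewrite lead_coefE size_exp_XsubC.
by rewrite nth_default // size_exp_XsubC ltn_neqAle eq_sym ne.
Qed.

Lemma coef_Xsub1_big n m : (n < m)%N -> (('X - 1 : {poly R}) ^+ n)`_m = 0.
Proof. by move=> h; rewrite coef_Xsub1_top ?gtn_eqF // ltnW. Qed.

Lemma coef_Xsub1_next n : (('X - 1 : {poly R}) ^+ n.+1)`_n = - n.+1%:R.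
Proof.
elim: n => [|n IH]; first by rewrite expr1 coefB coefX coef1 sub0r.
rewrite exprSr mulrBr mulr1 coefB coefMX /= IH coef_Xsub1_top // eqxx.
by rewrite -opprD -natrD addn1.
Qed.

Lemma comp_prod_shift (I : finType) (Q : pred I) (z : I -> R) :
  (\prod_(i | Q i) ('X - (z i)%:P)) \Po ('X - 1) =
  \prod_(i | Q i) ('X - (z i + 1)%:P).
Proof.
rewrite rmorph_prod; apply: eq_bigr => i _ /=.
by rewrite comp_polyB comp_polyX comp_polyC polyCD polyC1 opprD addrA addrAC.
Qed.

End Reverse.

Section Generation.
Variables (F : numFieldType) (k l : nat).
Hypothesis lk : (l <= k)%N.
Local Notation R := {mpoly F[k]}.
Local Notation Ep := (@Ep F k l).
Variable P : R -> Prop.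
Hypothesis Pa : alg_closed P.
Let Pl : lin_closed P := alg_lin Pa.

Definition Phi : {poly R} :=
  \prod_(i < k) ('X - ('X_i + ((i < l)%N : nat)%:R)%:P).

Lemma PhiE : Phi = (Ep true \Po ('X - 1)) * Ep false.
Proof.
have e1 : Ep true \Po ('X - 1) =
    \prod_(i < k | side l i == true) ('X - ('X_i + ((i < l)%N : nat)%:R)%:P).
  apply: etrans (comp_prod_shift _ _) _; apply: eq_bigr => i.
  by rewrite eqb_id /side => ->.
have e2 : Ep false =
    \prod_(i < k | side l i == false) ('X - ('X_i + ((i < l)%N : nat)%:R)%:P).
  apply: eq_bigr => i; rewrite eqbF_neg /side => /negbTE ->.
  by rewrite -[false%:R]/(0 : R) addr0.
rewrite e1 e2 /Phi (bigID (fun i => side l i == true)); congr (_ * _).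
by apply: eq_bigl => i; case: side.
Qed.

Hypothesis PPhi : forall j, P Phi`_j.
Hypothesis PS : forall j, P (Ep true * Ep false)`_j.

(* Comparing the two products degree by degree determines the sum of the
   [i]-th coefficients of the factors and [i] times the first of them. *)
Lemma gen_Ep b j : P (Ep b)`_j.
Proof.
have [P1 _ PM] := Pa; have P0 : P 0 by case: Pl.
have Pnat n : P n%:R by elim: n => // n IH; rewrite -addn1 natrD; apply: (lin_D Pl).
pose A := revp l (Ep true); pose B := revp (k - l) (Ep false).
pose A1 := revp l (Ep true \Po ('X - 1)).
have sA : size (Ep true) = l.+1 by rewrite size_Ep.
have sB : size (Ep false) = (k - l).+1 by rewrite size_Ep.
have sA1 : (size (Ep true \Po ('X - 1)) <= l.+1)%N.
  by rewrite size_comp_poly2 ?sA // size_XsubC.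
have eS : revp k (Ep true * Ep false) = A * B.
  by have := @revpM _ l (k - l) (Ep true) (Ep false); rewrite subnKC // => ->; rewrite ?sA ?sB.
have eP : revp k Phi = A1 * B.
  rewrite PhiE; have := @revpM _ l (k - l) (Ep true \Po ('X - 1)) (Ep false).
  by rewrite subnKC // => ->; rewrite ?sB.
have PAB i : P (A * B)`_i by rewrite -eS coef_revp; case: ifP.
have PA1B i : P (A1 * B)`_i by rewrite -eP coef_revp; case: ifP.
have A0 : A`_0 = 1.
  by have /monicP := @Ep_monic F k l true; rewrite coef_revp subn0 lead_coefE sA.
have B0 : B`_0 = 1.
  by have /monicP := @Ep_monic F k l false; rewrite coef_revp subn0 lead_coefE sB.
have A1E i : (i <= l)%N ->
    A1`_i = \sum_(c < l.+1) A`_c * (('X - 1 : {poly R}) ^+ (l - c))`_(l - i).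
  move=> il; rewrite coef_revp il comp_polyE sA coef_sum.
  rewrite (reindex_inj rev_ord_inj) /=; apply: eq_bigr => c _.
  by rewrite coefZ coef_revp subSS -ltnS ltn_ord.
have G0 : (A - A1)`_0 = 0.
  rewrite coefB A1E // A0 (bigD1 ord0) //= subn0 coef_Xsub1_top // eqxx mulr1 A0.
  rewrite big1 ?addr0 ?subrr // => c c0.
  rewrite coef_Xsub1_big ?mulr0 //.
  by move: c0; rewrite -val_eqE /= => c0; have := ltn_ord c; lia.
have GS i : exists u : nat -> F,
    (A - A1)`_i.+1 = (l - i)%:R * A`_i + \sum_(c < i) u c *: A`_c.
  have [il|li] := ltnP i l; last first.
    exists (fun=> 0); rewrite big1 => [|c _]; last by rewrite scale0r.
    rewrite (_ : (l - i)%:R = 0) ?mul0r ?addr0; last by rewrite (eqP (li : (l - i == 0)%N)).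
    by rewrite coefB !coef_revp leqNgt ltnS li subrr.
  exists (fun c => - (('X - 1 : {poly F}) ^+ (l - c))`_(l - i.+1)).
  rewrite coefB A1E //.
  have h1 : (i.+1 < l.+1)%N by [].
  have h0 : (i < l.+1)%N by apply: ltnW.
  rewrite (bigD1 (Ordinal h1)) //= coef_Xsub1_top // eqxx mulr1.
  rewrite (bigD1 (Ordinal h0)) /=; last by rewrite -val_eqE /= ltn_eqF.
  have -> : (l - i = (l - i.+1).+1)%N by lia.
  rewrite coef_Xsub1_next mulrN.
  rewrite (bigID (fun c : 'I_l.+1 => c < i)%N) /= [X in _ + (_ + X)]big1 ?addr0; last first.
    move=> c /andP[/andP[c1 c0] ci].
    rewrite coef_Xsub1_big ?mulr0 //.
    move: c0 c1 ci; rewrite -!val_eqE /= => c0 c1 ci; have := ltn_ord c; lia.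
  rewrite (eq_bigl (fun c : 'I_l.+1 => c < i)%N); last first.
    by move=> c; rewrite -!val_eqE /=; lia.
  rewrite (big_ord_widen l.+1 (fun c => - (('X - 1 : {poly F}) ^+ (l - c))`_(l - i.+1) *: A`_c)) //; last exact: ltnW.
  rewrite (eq_bigr (fun c : 'I_l.+1 => (('X - 1 : {poly F}) ^+ (l - c))`_(l - i.+1) *: A`_c)); last first.
    move=> c _; rewrite -mul_mpolyC mulrC; congr (_ * _).
    rewrite -coef_map; congr (_`_ _).
    by rewrite rmorphXn rmorphB /= map_polyX rmorph1.
  under [in RHS]eq_bigr do rewrite scaleNr.
  rewrite sumrN mulrC.
  have key (T : zmodType) (a x s : T) : a - (a + (- x + s)) = x - s.
    by rewrite !opprD opprK !addrA subrr add0r.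
  exact: key.
have GP i : (forall c, (c < i)%N -> P A`_c) ->
    P ((A - A1)`_i.+1 - (l - i)%:R * A`_i).
  move=> IH; have [u ->] := GS i; rewrite addrC addKr.
  by apply: (lin_sum Pl) => c _; apply: (lin_Z Pl); apply: IH.
have G1 : (A - A1)`_1 = l%:R.
  by have [u ->] := GS 0%N; rewrite big_ord0 addr0 subn0 A0 mulr1.
have main i : P A`_i /\ P B`_i.
  elim/ltn_ind: i => i IH.
  case: i IH => [|i] IH; first by rewrite A0 B0.
  have IHA c : (c < i.+1)%N -> P A`_c by move/IH => [].
  have IHB c : (c < i.+1)%N -> P B`_c by move/IH => [].
  have PGc c : (c < i.+2)%N -> P (A - A1)`_c.
    case: c => [|c] hc; first by rewrite G0.
    rewrite -[X in P X](subrK ((l - c)%:R * A`_c)); apply: (lin_D Pl).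
      by apply: GP => c' h; apply: IHA; lia.
    by apply: PM => //; apply: IHA; lia.
  have e1 : P (A`_i.+1 + B`_i.+1).
    have := PAB i.+1; rewrite coefM big_ord_recr big_ord_recl /= subn0 subnn A0 B0 mul1r mulr1.
    set s := \sum_(_ < _) _ => h.
    have -> : A`_i.+1 + B`_i.+1 = B`_i.+1 + s + A`_i.+1 - s by ring.
    apply: (lin_B Pl) => //; apply: (lin_sum Pl) => c _; apply: PM.
      by apply: IHA; rewrite /bump /=; have := ltn_ord c; lia.
    by apply: IHB; rewrite /bump /=; have := ltn_ord c; lia.
  have e2 : P ((l - i.+1)%:R * A`_i.+1 + l%:R * B`_i.+1).
    have : P ((A - A1) * B)`_i.+2 by rewrite mulrBl coefB; apply: (lin_B Pl).
    rewrite coefM big_ord_recr big_ord_recl big_ord_recl /= /bump /= !subn0 subnn B0 mulr1.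
    rewrite G0 mul0r add0r addn0 G1 subn1 /=.
    set s := \sum_(_ < _) _ => h.
    have Ps : P s.
      apply: (lin_sum Pl) => c _; apply: PM.
        by apply: PGc; have := ltn_ord c; lia.
      by apply: IHB; have := ltn_ord c; lia.
    have hG := GP i.+1 IHA.
    rewrite -[X in P X](_ : l%:R * B`_i.+1 + s + (A - A1)`_i.+2 - s -
       ((A - A1)`_i.+2 - (l - i.+1)%:R * A`_i.+1) = _); last first.
      have key (T : comPzRingType) (a x y z : T) : x + a + y - a - (y - z) = z + x by ring.
      exact: key.
    by apply: (lin_B Pl) => //; apply: (lin_B Pl).
  have PA : P A`_i.+1.
    have [il|li] := leqP i.+1 l; last by rewrite coef_revp leqNgt li.
    have h : P (i.+1%:R * A`_i.+1).
      rewrite -[X in P X](_ : l%:R * (A`_i.+1 + B`_i.+1) -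
          ((l - i.+1)%:R * A`_i.+1 + l%:R * B`_i.+1) = _).
        by apply: (lin_B Pl) => //; apply: PM.
      rewrite natrB //.
      have key (T : comPzRingType) (x n a c : T) :
         x * (a + c) - ((x - n) * a + x * c) = n * a by ring.
      exact: key.
    rewrite -[X in P X](_ : i.+1%:R^-1 *: (i.+1%:R * A`_i.+1) = _); first exact: (lin_Z Pl).
    rewrite mulr_natl -scaler_nat scalerA mulVf ?scale1r // pnatr_eq0 //.
  split=> //; rewrite -[X in P X](addKr A`_i.+1) addrC; exact: (lin_B Pl).
case: b.
  have [jl|lj] := leqP j l; last by rewrite nth_default // sA.
  by have [h _] := main (l - j)%N; rewrite coef_revp leq_subr subKn in h.
have [jl|lj] := leqP j (k - l)%N; last by rewrite nth_default // sB.
by have [_ h] := main (k - l - j)%N; rewrite coef_revp leq_subr subKn in h.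
Qed.

End Generation.

End GeneratorPhi.
Import GeneratorPhi.

(** * Representation on alternating vectors *)

Module ThetaRows.

Section PermExtend.
Variable T : finType.

Lemma perm_extend (D : {set T}) (f : T -> T) : {in D &, injective f} ->
  exists s : {perm T}, forall x, x \in D -> s x = f x.
Proof.
move=> fi; pose s1 := enum D ++ enum (~: D).
pose s2 := map f (enum D) ++ enum (~: (f @: D)).
have us1 : uniq s1.
  rewrite cat_uniq !enum_uniq andbT /=; apply/hasPn => x.
  by rewrite !mem_enum inE.
have us2 : uniq s2.
  rewrite cat_uniq enum_uniq andbT map_inj_in_uniq ?enum_uniq /=; last first.
    by move=> x y; rewrite !mem_enum; apply: fi.
  apply/hasPn => x; rewrite mem_enum inE; apply: contra => /mapP[y].
  by rewrite mem_enum => yD ->; apply: imset_f.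
have m1 x : x \in s1 by rewrite mem_cat !mem_enum inE orbN.
have sz : size s1 = size s2.
  rewrite !size_cat size_map -!cardE; have := cardsC D; have := cardsC (f @: D).
  by rewrite card_in_imset // => <- /addnI ->.
pose g x := nth x s2 (index x s1).
have gi : injective g.
  move=> x y; rewrite /g => e.
  have hx : (index x s1 < size s2)%N by rewrite -sz index_mem.
  have hy : (index y s1 < size s2)%N by rewrite -sz index_mem.
  rewrite (set_nth_default y) // in e.
  have /eqP := e; rewrite nth_uniq // => /eqP e'.
  by rewrite -(nth_index x (m1 x)) e' (nth_index x (m1 y)).
exists (perm gi) => x xD; rewrite permE /g /s1 /s2 index_cat mem_enum xD.
by rewrite nth_cat size_map index_mem mem_enum xD (nth_map x) ?index_mem ?mem_enum // nth_index ?mem_enum.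
Qed.

End PermExtend.

Section Rho.
Variables (F : numFieldType) (k l : nat) (r : nat -> F).
Hypothesis lk : (l <= k)%N.
Local Notation R := {mpoly F[k]}.
Local Notation side := (@side k l).
Local Notation rk := (@rk k l).
Local Notation Theta := (Theta r).
Local Notation Jmx := (@Jmx F k).
Local Notation ysym := (@ysym F k l).
Local Notation inI := (@inI F k r).
Local Notation tR := (@tR F k l r).
Local Notation FF := {ffun 'I_k -> 'I_k}.
Implicit Types (p q : R) (J : FF) (s t : 'S_k).

Lemma Theta_inI A p : inI p -> Theta A p = 0.
Proof.
move=> [a ->]; rewrite linear_sum big1 // => i _ /=.
rewrite mulrBr linearB /= mulrC Theta_mesym [a i * _]mulrC mul_mpolyC linearZ /=.
exact: subrr.
Qed.

Variables (N : nat) (Y : FF -> 'rV[F]_N).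
Hypothesis Yrk : forall J i, side i = false -> J i != rk i :> nat -> Y J = 0.
Hypothesis Yalt : forall J s, (forall i, side i = false -> s i = i) ->
  Y [ffun i => J (s i)] = (-1) ^+ s *: Y J.
Hypothesis Yninj : forall J i j, side i -> side j -> i != j -> J i = J j -> Y J = 0.

(** The sum runs over all index functions [J]; the alternation of [Y] leaves only those of the form
    [cutL s], and each vector is repeated, up to sign, along the permutations of the first side. *)
Definition rho p : 'rV[F]_N := \sum_(J : FF) Theta (Jmx (fun i => J i)) p *: Y J.

Fact rho_is_linear : linear rho.
Proof.
move=> c p q; rewrite /rho scaler_sumr -big_split; apply: eq_bigr => J _ /=.
by rewrite linearP scalerDl scalerA.
Qed.
HB.instance Definition _ := GRing.isLinear.Build F R 'rV[F]_N *:%R rho rho_is_linear.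

Lemma rho_inI p : inI p -> rho p = 0.
Proof. by move=> h; rewrite /rho big1 // => J _; rewrite Theta_inI // scale0r. Qed.

Definition cutL s : FF := [ffun i => if side i then s i else insubd i (rk i)].
(** Here and in [Rcard]: the order of the subgroup fixing one side pointwise. The product of the two
    is obtained later from the trace of the identity. *)
Definition Lcard : nat := #|[set s : 'S_k | [forall i, (side i == false) ==> (s i == i)]]|.
Definition Rcard : nat := #|[set s : 'S_k | [forall i, side i ==> (s i == i)]]|.

Lemma rk_ltk i : (rk i < k)%N.
Proof. by rewrite /SchurBasis.rk; case: ifP => _ //; apply: leq_ltn_trans (leq_subr _ _) (ltn_ord i). Qed.

Lemma cutL_false s i : side i = false -> cutL s i = rk i :> nat.
Proof. by move=> si; rewrite ffunE si val_insubd rk_ltk. Qed.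

Lemma cutL_true s i : side i -> cutL s i = s i.
Proof. by move=> si; rewrite ffunE si. Qed.

Lemma Y_cut J : Y J != 0 -> exists s, J = cutL s.
Proof.
move=> YJ.
have h1 i : side i = false -> J i = rk i :> nat.
  by move=> si; apply/eqP; apply: contraNT YJ => ne; rewrite (Yrk si ne).
have [|s hs] := @perm_extend _ [set i | side i] J.
  move=> i j; rewrite !inE => si sj e; apply/eqP; apply: contraNT YJ => ne.
  by rewrite (Yninj si sj ne e).
exists s; apply/ffunP => i; apply: val_inj => /=.
case si: (side i); first by rewrite cutL_true // hs // inE si.
by rewrite cutL_false // h1.
Qed.

(** [Theta_tS] replaces the functional of [cutL s] by a Schur polynomial of the first side,
    [tS_glue] joins it to the one of the second side, and [Theta_tS] turns the product into a
    determinant. *)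
Lemma Theta_cut_tR s t : Theta (Jmx (fun i => cutL s i)) (tR [ffun i => t i]) =
  \det (Jmx (fun i => if side i then s i else t i)).
Proof.
rewrite -(@Theta_tS F k l r lk (fun i => cutL s i) (tR _)); last by apply: tS_sym.
rewrite tS_glue //; last first.
- by move=> i si; rewrite /Sof si.
- by move=> i si; rewrite cutL_false.
rewrite -[X in Theta _ X]mulr1 Theta_tS //; last exact: ysym1.
rewrite Theta1; congr (\det _); apply: eq_Jmx => i.
by case si: (side i); rewrite ?cutL_true ?si //= /Sof si ffunE.
Qed.

Lemma det_cut_perm s t : \det (Jmx (fun i => if side i then s i else t i)) != 0 ->
  exists u : 'S_k, (forall i, side i -> u i = s i) /\ (forall i, side i = false -> u i = t i).
Proof.
move=> d0; pose K i := if side i then s i else t i.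
have [|u hu] := @perm_extend _ setT K.
  move=> i j _ _ e; apply/eqP; apply: contraNT d0 => ne; apply/eqP.
  apply: (det_Jmx_ninj _ ne); move: e; rewrite /K.
  by do 2!case: ifP => _ //; move=> ->.
by exists u; split=> i si; rewrite hu ?inE // /K si.
Qed.

(** By [Theta_cut_tR] the surviving indices come from the products [s * t] with [s] fixing the
    second side. Their signs in the functional and in [Y] cancel, so all of them contribute the same
    vector. *)
Lemma rho_tR t : rho (tR [ffun i => t i]) = ((-1) ^+ t * Lcard%:R) *: Y (cutL t).
Proof.
pose G := [set s : 'S_k | [forall i, (side i == false) ==> (s i == i)]].
have GP s : reflect (forall i, side i = false -> s i = i) (s \in G).
  rewrite inE; apply: (iffP forallP) => h i; first by move=> si; have := h i; rewrite si => /eqP.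
  by apply/implyP => /eqP si; rewrite h.
pose h s := cutL (s * t)%g.
have hinj : {in G &, injective h}.
  move=> s s' /GP hs /GP hs' /ffunP e; apply/permP => i.
  case si: (side i); last by rewrite hs ?hs'.
  by have := e i; rewrite /h !cutL_true // !permM => /perm_inj.
have hF s : s \in G -> Theta (Jmx (fun i => h s i)) (tR [ffun i => t i]) *: Y (h s) =
    (-1) ^+ t *: Y (cutL t).
  move=> /GP hs.
  have -> : h s = [ffun i => cutL t (s i)].
    apply/ffunP => i; apply: val_inj; rewrite [in RHS]ffunE /h /=.
    case si: (side i); last by rewrite cutL_false // hs // cutL_false.
    have ss : side (s i).
      by apply: contraT => /negbTE sf; have /perm_inj e := hs _ sf; rewrite e si in sf.
    by rewrite !cutL_true // permM.
  rewrite Yalt // scalerA.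
  rewrite (@eq_Jmx F k _ (fun i => cutL (s * t)%g i)); last first.
    move=> i; rewrite [in LHS]ffunE; case si: (side i); last by rewrite hs // !cutL_false.
    have ss : side (s i).
      by apply: contraT => /negbTE sf; have /perm_inj e := hs _ sf; rewrite e si in sf.
    by rewrite !cutL_true // permM.
  rewrite Theta_cut_tR (_ : \det _ = \det (Jmx (fun i => (s * t)%g i))).
    by rewrite det_Jmx_perm odd_permM signr_addb mulrAC -signr_addb addbb mul1r.
  congr (\det _); apply: eq_Jmx => i; case si: (side i) => //.
  by rewrite permM hs.
rewrite /rho (bigID (mem (h @: G))) /= [X in _ + X]big1 ?addr0; last first.
  move=> J JK; apply/eqP; rewrite scaler_eq0; apply/orP.
  have [YJ0|YJ] := eqVneq (Y J) 0; [by right | left].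
  apply: contraNT JK => TJ; have [s eJ] := Y_cut YJ; rewrite eJ Theta_cut_tR in TJ.
  have [u [u1 u2]] := det_cut_perm TJ.
  apply/imsetP; exists (u * t^-1)%g.
    by apply/GP => i si; rewrite permM u2 // permK.
  apply/ffunP => i; apply: val_inj; rewrite eJ /h mulgKV /=.
  case si: (side i); first by rewrite !cutL_true // u1.
  by rewrite !cutL_false.
rewrite (big_imset _ hinj) /= (eq_bigr _ hF) sumr_const -scaler_nat scalerA.
by rewrite mulrC /Lcard.
Qed.

Lemma sum_cut (f : FF -> 'rV[F]_N) : (forall J, Y J = 0 -> f J = 0) ->
  \sum_(t : 'S_k) f (cutL t) = Rcard%:R *: \sum_(J : FF) f J.
Proof.
move=> f0; rewrite (partition_big cutL xpredT) //= scaler_sumr; apply: eq_bigr => J _.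
rewrite (eq_bigr (fun=> f J)); last by move=> t /eqP ->.
have [YJ|YJ] := eqVneq (Y J) 0; first by rewrite big1 ?f0 // scaler0.
have [s eJ] := Y_cut YJ; rewrite sumr_const scaler_nat; congr (_ *+ _).
pose H := [set s : 'S_k | [forall i, side i ==> (s i == i)]].
have -> : #|[pred t | cutL t == J]| = #|[set (u * s)%g | u in H]|.
  apply: eq_card => t; rewrite inE; apply/eqP/imsetP.
    move=> e; exists (t * s^-1)%g; last by rewrite mulgKV.
    rewrite inE; apply/forallP => i; apply/implyP => si; rewrite permM.
    have : cutL t i = cutL s i by rewrite e eJ.
    by rewrite !cutL_true // => ->; rewrite permK.
  move=> [u]; rewrite inE => /forallP hu ->; rewrite eJ; apply/ffunP => i.
  apply: val_inj => /=; case si: (side i); last by rewrite !cutL_false.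
  by rewrite !cutL_true // permM; have := hu i; rewrite si => /eqP ->.
by rewrite card_imset // => u u' /mulIg.
Qed.

(* The [tR] of permutations form an overcomplete frame, dual to the
   functionals [Theta (Jmx (cutL t))]. *)
Lemma rho_frame p :
  (Lcard * Rcard)%:R *: rho p =
  \sum_(t : 'S_k) ((-1) ^+ t * Theta (Jmx (fun i => cutL t i)) p) *: rho (tR [ffun i => t i]).
Proof.
under eq_bigr do rewrite rho_tR scalerA mulrACA -signr_addb addbb mul1r mulrC -scalerA.
rewrite -scaler_sumr (@sum_cut (fun J : FF => Theta (Jmx (fun i => J i)) p *: Y J)).
  by rewrite scalerA natrM.
by move=> J ->; rewrite scaler0.
Qed.

(** The gluing of [Theta_cut_tR] with an extra factor; it turns the frame coefficients into the
    functionals summed by [Theta_trace]. *)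
Lemma Theta_cut_mul t p : ysym p ->
  Theta (Jmx (fun i => cutL t i)) (tR [ffun i => t i] * p) = Theta (Jmx (fun i => t i)) p.
Proof.
move=> hp.
have ht : ysym (tR [ffun i => t i]) by apply: tS_sym.
rewrite -(@Theta_tS F k l r lk (fun i => cutL t i)); last exact: ysymM.
rewrite mulrA tS_glue //; last first.
- by move=> i si; rewrite /Sof si.
- by move=> i si; rewrite cutL_false.
rewrite Theta_tS //; congr (Theta _ _); apply: eq_Jmx => i.
by case si: (side i); rewrite ?cutL_true ?si //= /Sof si ffunE.
Qed.

End Rho.

End ThetaRows.
Import ThetaRows.

(** * The quotient algebra acting on the weight subspace *)

Module YoungAction.

Section RhoBasis.
Variables (F : numFieldType) (k l : nat) (r : nat -> F).
Hypothesis lk : (l <= k)%N.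
Local Notation R := {mpoly F[k]}.
Local Notation side := (@side k l).
Local Notation rk := (@rk k l).
Local Notation hN := (@hN F k r).
Local Notation Theta := (Theta r).
Local Notation Jmx := (@Jmx F k).
Local Notation ysym := (@ysym F k l).
Local Notation inI := (@inI F k r).
Local Notation tR := (@tR F k l r).
Local Notation FF := {ffun 'I_k -> 'I_k}.
Local Notation cutL := (@cutL k l).
Local Notation Sof := (@Sof k l).
Local Notation Lcard := (Lcard k l).
Local Notation Rcard := (Rcard k l).
Implicit Types (p q : R) (J : FF) (s t : 'S_k).

Definition tP t : R := tR [ffun i => t i].
Definition Rset : {set 'I_k} := [set i | ~~ side i].

Lemma ysym_tR J : ysym (tR J).
Proof. by apply: tS_sym. Qed.

Lemma card_Rset : #|Rset| = (k - l)%N.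
Proof.
rewrite -sum1_card (eq_bigl (fun i => side i == false)).
  by rewrite (@sum_side k l lk nat false (fun=> 1%N)) sum1_card card_ord.
by move=> i; rewrite inE eqbF_neg.
Qed.

(** If the second side has the same image under [s] and [t], the two determinants differ by a
    permutation of the rows of that side. Hence sets of [k - l] indices label a spanning family. *)
Lemma tR_class s t : s @: Rset = t @: Rset -> exists c, tP s = c *: tP t.
Proof.
move=> est.
have h i : side i = false -> side (t^-1%g (s i)) = false.
  move=> si; have : s i \in t @: Rset by rewrite -est imset_f // inE si.
  by case/imsetP => j; rewrite inE => /negbTE sj ->; rewrite permK.
pose u0 i := if side i then i else t^-1%g (s i).
have u0i : injective u0.
  move=> i j; rewrite /u0; case si: (side i); case sj: (side j) => //.
  - by move=> e; rewrite e h in si.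
  - by move=> e; rewrite -e h in sj.
  - by move/perm_inj/perm_inj.
pose u := perm u0i; exists ((-1) ^+ u).
have su i : side (u i) = side i by rewrite permE /u0; case si: (side i); rewrite ?h.
rewrite /tP /SymQuotient.tR /SchurBasis.tS (_ : Cf l (hN (Sof [ffun i => s i])) = row_perm u (Cf l (hN (Sof [ffun i => t i])))).
  rewrite row_permE det_mulmx det_perm.
  rewrite -[in RHS]mul_mpolyC; congr (_ * _).
  by rewrite rmorphXn rmorphN rmorph1.
apply/matrixP => i j; rewrite !mxE /same su; case: ifP => // _.
rewrite /SchurBasis.hN /mplift /SymQuotient.Sof su !ffunE permE /u0.
by case si: (side i); rewrite // permKV.
Qed.

Lemma tR_inj J : tR J != 0 -> exists t, tR J = tP t.
Proof.
move=> J0; have [|t ht] := @perm_extend _ Rset J.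
  move=> i j; rewrite !inE => si sj e; apply/eqP; apply: contraNT J0 => ne; apply/eqP.
  apply: (determinant_alternate ne) => c; rewrite !mxE /same /SchurBasis.hN /mplift /SymQuotient.Sof.
  by rewrite (negbTE si) (negbTE sj) e.
exists t; apply: eq_tS => i; rewrite /SchurBasis.hN /mplift /SymQuotient.Sof.
by case si: (side i) => //; rewrite ffunE ht // inE si.
Qed.

Definition Rsets := [set B : {set 'I_k} | #|B| == (k - l)%N].
Definition XB (B : {set 'I_k}) : R :=
  if [pick t : 'S_k | t @: Rset == B] is Some t then tP t else 0.

Lemma card_Rsets : #|Rsets| = 'C(k, l).
Proof. by rewrite card_draws card_ord bin_sub. Qed.

Lemma tR_XB J : exists B c, B \in Rsets /\ tR J = c *: XB B.
Proof.
have [->|/tR_inj[t ->]] := eqVneq (tR J) 0.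
  exists Rset, 0; rewrite scale0r; split=> //.
  by rewrite inE card_Rset.
pose B := t @: Rset.
have BR : B \in Rsets by rewrite inE card_imset ?card_Rset //; apply: perm_inj.
have [c ec] : exists c, tP t = c *: XB B.
  rewrite /XB; case: pickP => [s /eqP sB|h]; last by have := h t; rewrite eqxx.
  by apply: tR_class; rewrite sB.
by exists B, c.
Qed.

Variables (N : nat) (Y : FF -> 'rV[F]_N).
Hypothesis Yrk : forall J i, side i = false -> J i != rk i :> nat -> Y J = 0.
Hypothesis Yalt : forall J s, (forall i, side i = false -> s i = i) ->
  Y [ffun i => J (s i)] = (-1) ^+ s *: Y J.
Hypothesis Yninj : forall J i j, side i -> side j -> i != j -> J i = J j -> Y J = 0.
Variables (d : nat) (Wb : 'M[F]_(d, N)).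
Hypothesis Wfree : row_free Wb.
Hypothesis YW : forall J, (Y J <= Wb)%MS.
Hypothesis WY : forall i, exists c : FF -> F, row i Wb = \sum_(J : FF) c J *: Y J.
Hypothesis dC : d = 'C(k, l).
Local Notation rho := (@rho F k r N Y).

Lemma Lcard_neq0 : Lcard%:R != 0 :> F.
Proof.
rewrite pnatr_eq0 -lt0n; apply/card_gt0P; exists 1%g.
by rewrite inE; apply/forallP => i; rewrite perm1 eqxx implybT.
Qed.

Lemma Rcard_neq0 : Rcard%:R != 0 :> F.
Proof.
rewrite pnatr_eq0 -lt0n; apply/card_gt0P; exists 1%g.
by rewrite inE; apply/forallP => i; rewrite perm1 eqxx implybT.
Qed.

Lemma rho_sub p : (rho p <= Wb)%MS.
Proof. by rewrite /ThetaRows.rho; apply: summx_sub => J _; apply: scalemx_sub. Qed.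

(** By [rho_tR] every nonzero [Y J] is a nonzero multiple of the image of some [tP t], and the [Y J]
    span the rows of [Wb]. *)
Lemma rho_surj (v : 'rV[F]_N) : (v <= Wb)%MS -> exists2 p, ysym p & rho p = v.
Proof.
move=> vW; pose Q (v : 'rV[F]_N) := exists2 p, ysym p & rho p = v.
have Q0 : Q 0 by exists 0; rewrite ?raddf0 // => s _; rewrite raddf0.
have Ql c u w : Q u -> Q w -> Q (c *: u + w).
  move=> [p hp <-] [p' hp' <-]; exists (c *: p + p'); first exact: ysym_lin.
  by rewrite linearP.
have Qs (I : finType) (f : I -> 'rV[F]_N) (c : I -> F) :
    (forall i, Q (f i)) -> Q (\sum_i c i *: f i).
  by move=> h; elim/big_rec: _ => // i x _ Qx; apply: Ql.
have QY J : Q (Y J).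
  have [->|YJ] := eqVneq (Y J) 0; first exact: Q0.
  have [t ->] := Y_cut Yrk Yninj YJ.
  exists (((-1) ^+ t * Lcard%:R)^-1 *: tP t).
    by move=> s hs; rewrite msymZ ysym_tR.
  rewrite linearZ /= (rho_tR r lk Yrk Yalt Yninj) scalerA mulVf ?scale1r //.
  by rewrite mulf_neq0 ?signr_eq0 ?Lcard_neq0.
have -> : v = \sum_i (v *m pinvmx Wb) 0 i *: row i Wb.
  by rewrite -mulmx_sum_row mulmxKpV.
by apply: (Qs _ (fun i => row i Wb)) => i; have [c ->] := WY i; apply: Qs.
Qed.

Definition rhoW p : 'rV[F]_d := rho p *m pinvmx Wb.

Lemma rhoWK p : rhoW p *m Wb = rho p.
Proof. by rewrite /rhoW mulmxKpV ?rho_sub. Qed.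

Fact rhoW_is_linear : linear rhoW.
Proof. by move=> c p q; rewrite /rhoW linearP mulmxDl scalemxAl. Qed.
HB.instance Definition _ := GRing.isLinear.Build F R 'rV[F]_d *:%R rhoW rhoW_is_linear.

Lemma rhoW_inI p : inI p -> rhoW p = 0.
Proof. by move=> h; rewrite /rhoW rho_inI // mul0mx. Qed.

Lemma rhoW_surj (v : 'rV[F]_d) : exists2 p, ysym p & rhoW p = v.
Proof.
have [p hp e] := rho_surj (submxMl v Wb); exists p => //.
by apply: (row_free_inj Wfree); rewrite rhoWK.
Qed.

Lemma ysym_span p : ysym p ->
  exists c : 'I_#|Rsets| -> F, inI (p - \sum_i c i *: XB (enum_val i)).
Proof.
move=> hp; have [a ha] := ysym_Zp r lk hp.
have I0 : inI 0 by case: (inI_lin k r).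
suff [c ec] : exists c : 'I_#|Rsets| -> F,
    \sum_J a J *: tR J = \sum_i c i *: XB (enum_val i) by exists c; rewrite -ec.
apply: (big_ind (fun x => exists c : 'I_#|Rsets| -> F, x = \sum_i c i *: XB (enum_val i))).
- by exists (fun=> 0); rewrite big1 // => i _; rewrite scale0r.
- move=> x y [c ->] [c' ->]; exists (fun i => c i + c' i).
  by rewrite -big_split; apply: eq_bigr => i _; rewrite scalerDl.
move=> J _; have [B [c [BR ->]]] := tR_XB J.
exists (fun i => (a J * c) *+ (i == enum_rank_in BR B)).
rewrite (bigD1 (enum_rank_in BR B)) //= eqxx mulr1n big1 ?addr0.
  by rewrite enum_rankK_in // scalerA.
by move=> i /negbTE ->; rewrite mulr0n scale0r.
Qed.

(** Dimension count: modulo the ideal the [C(k, l)] elements [XB] span the symmetric polynomials,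
    and their images span a space of dimension [C(k, l)], so these images are independent. *)
Lemma rhoW_ker p : ysym p -> rhoW p = 0 -> inI p.
Proof.
move=> hp p0; have [c hc] := ysym_span hp.
pose M : 'M[F]_(#|Rsets|, d) := \matrix_i rhoW (XB (enum_val i)).
have Mfull : row_full M.
  rewrite -sub1mx; apply/row_subP => i.
  have [q hq <-] := rhoW_surj (row i 1%:M).
  have [c' hc'] := ysym_span hq.
  have -> : rhoW q = \sum_i c' i *: row i M.
    have := rhoW_inI hc'; rewrite linearB linear_sum /= => /eqP.
    rewrite subr_eq0 => /eqP ->; apply: eq_bigr => j _.
    by rewrite linearZ rowK.
  by apply: summx_sub => j _; apply: scalemx_sub; apply: row_sub.
have Mfree : row_free M by rewrite -row_leq_rank (eqP Mfull) dC card_Rsets.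
have e : \sum_i c i *: row i M = 0.
  have := rhoW_inI hc; rewrite linearB linear_sum /= p0 sub0r => /eqP.
  rewrite oppr_eq0 => /eqP e; rewrite -[RHS]e; apply: eq_bigr => j _.
  by rewrite linearZ rowK.
have c0 : \row_i c i = 0.
  apply: (row_free_inj Mfree); rewrite mul0mx mulmx_sum_row -[RHS]e.
  by apply: eq_bigr => i _; rewrite mxE.
rewrite -[p]subr0; rewrite (_ : 0 = \sum_i c i *: XB (enum_val i)) //.
by rewrite big1 // => i _; move/rowP/(_ i): c0; rewrite !mxE => ->; rewrite scale0r.
Qed.

Variable pb : 'I_d -> R.
Hypothesis pb_sym : forall i, ysym (pb i).
Hypothesis pb_delta : forall i, rhoW (pb i) = delta_mx 0 i.

Lemma pb_dec q : ysym q -> inI (q - \sum_i rhoW q 0 i *: pb i).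
Proof.
move=> hq; apply: rhoW_ker.
  move=> s hs; rewrite msymB hq // (raddf_sum (msym s)) /=; congr (_ - _).
  by apply: eq_bigr => i _; rewrite /= (msymZ _ (pb i) s) pb_sym.
rewrite linearB linear_sum /=; apply/eqP; rewrite subr_eq0; apply/eqP.
rewrite [LHS]row_sum_delta; apply: eq_bigr => i _.
by rewrite linearZ /= pb_delta.
Qed.

(** Multiplication by [p], read off on the lifts [pb] of the coordinate vectors. By [pb_dec] a
    symmetric [q] differs from the combination of lifts given by [rhoW q] by an element of the
    ideal, hence [fW_act]. *)
Definition fW p : 'M[F]_d := (\matrix_i rhoW (p * pb i))^T.

Lemma fW_act p q : ysym q -> rhoW q *m (fW p)^T = rhoW (p * q).
Proof.
move=> hq; rewrite /fW trmxK mulmx_sum_row.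
have := rhoW_inI (inI_mul p (pb_dec hq)).
rewrite mulrBr linearB /= mulr_sumr linear_sum /= => /eqP.
rewrite subr_eq0 => /eqP ->; apply: eq_bigr => i _.
by rewrite rowK -scalerAr linearZ.
Qed.

Fact fW_is_linear : linear fW.
Proof.
move=> c p q; apply/trmx_inj; rewrite linearP /= !trmxK.
apply/row_matrixP => i; rewrite rowK linearP /= !rowK.
by rewrite mulrDl -scalerAl linearP.
Qed.
HB.instance Definition _ := GRing.isLinear.Build F R 'M[F]_d *:%R fW fW_is_linear.

Lemma fW_ext (M : 'M[F]_d) p : (forall q, ysym q -> rhoW q *m M^T = rhoW (p * q)) -> M = fW p.
Proof.
move=> h; apply/trmx_inj/row_matrixP => i; rewrite !rowE -pb_delta h //.
by rewrite fW_act.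
Qed.

Lemma fW0 p : ysym p -> fW p = 0 <-> inI p.
Proof.
move=> hp; split=> [f0|hI].
  apply: rhoW_ker => //; rewrite -[p]mulr1 -fW_act; last exact: ysym1.
  by rewrite f0 trmx0 mulmx0.
apply/esym/fW_ext => q _; rewrite trmx0 mulmx0 rhoW_inI // mulrC.
exact: inI_mul.
Qed.

(** The frame writes a multiple of the identity as a sum of rank one operators. Composing with
    [fW q] and taking traces gives signed values of [Theta] at permutations, which [Theta_trace]
    sums. *)
Lemma trace_fW q : ysym q ->
  (Lcard * Rcard)%:R * \tr (fW q) = \sum_(t : 'S_k) q.@[fun i => r (t i)].
Proof.
move=> hq; pose Th t p := Theta (Jmx (fun i => cutL t i)) p.
pose xi t : 'cV[F]_d := \col_i Th t (pb i).
have hxi t p : ysym p -> rhoW p *m xi t = (Th t p)%:M.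
  move=> hp; apply/matrixP => a b; rewrite !ord1 !mxE eqxx mulr1n.
  rewrite -[in RHS](subrK (\sum_i rhoW p 0 i *: pb i) p) /Th linearD /=.
  rewrite (Theta_inI _ (pb_dec hp)) add0r linear_sum.
  apply: eq_bigr => i _; apply/esym; apply: etrans (linearZ _ _) _.
  by rewrite [xi t i 0]mxE.
(* The rank one operators pair the functional of [cutL t] with the vector of [tP t]; the identity is
   checked on the coordinate vectors [rhoW (pb i)]. *)
have frame : (Lcard * Rcard)%:R%:M =
    \sum_(t : 'S_k) (-1) ^+ t *: (xi t *m rhoW (tP t)) :> 'M[F]_d.
  apply/row_matrixP => i; rewrite !rowE -!pb_delta mul_mx_scalar mulmx_sumr.
  have := congr1 (mulmx^~ (pinvmx Wb)) (rho_frame r lk Yrk Yalt Yninj (pb i)).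
  rewrite /= -scalemxAl -/(rhoW _) => ->; rewrite mulmx_suml; apply: eq_bigr => t _.
  rewrite -scalemxAl -/(rhoW _) -scalemxAr mulmxA hxi // mul_scalar_mx scalerA.
  by [].
rewrite -[RHS](Theta_trace r) -mxtrace_tr -mxtraceZ -mul_scalar_mx frame mulmx_suml.
rewrite raddf_sum; apply: eq_bigr => t _ /=.
rewrite -scalemxAl mxtraceZ -mulmxA fW_act; last exact: ysym_tR.
rewrite mxtrace_mulC hxi; last by apply: ysymM => //; apply: ysym_tR.
by rewrite /mxtrace big_ord1 mxE eqxx mulr1n /Th /tP (mulrC q) Theta_cut_mul.
Qed.

End RhoBasis.

End YoungAction.
Import YoungAction.

(** * Fermionic operators on the tensor product *)

Section Emb.
Variable k : nat.
Local Notation Idx := (Idx k).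
Local Notation N := (Ndim k).
Implicit Types (x y z : Idx) (s t : 'I_k) (A B : 'M[CC]_2).

Definition fmx (f : Idx -> Idx -> CC) : 'M[CC]_N := \matrix_(i, j) f (enum_val i) (enum_val j).

Lemma fmxM f g : fmx f *m fmx g = fmx (fun x y => \sum_z f x z * g z y).
Proof.
apply/matrixP => i j; rewrite !mxE; under eq_bigr do rewrite !mxE.
rewrite (reindex (@enum_rank Idx)) /=; last first.
  by exists (@enum_val _ _) => z _; rewrite (enum_rankK, enum_valK).
by apply: eq_bigr => z _; rewrite enum_rankK.
Qed.

Lemma eq_fmx f g : (forall x y, f x y = g x y) -> fmx f = fmx g.
Proof. by move=> h; apply/matrixP => i j; rewrite !mxE. Qed.

Lemma fmx1 : fmx (fun x y => (x == y)%:R) = 1%:M.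
Proof. by apply/matrixP => i j; rewrite !mxE (inj_eq enum_val_inj). Qed.

Definition upd y s (o : bool) : Idx := [ffun t => if t == s then o else y t].
Definition off x y s : bool := [forall t, (t != s) ==> (x t == y t)].
Definition cnt s y : nat := \sum_(t < k | (t < s)%N) (y t : nat).
Definition embf s (p : bool) A x y : CC :=
  (-1) ^+ (p && odd (cnt s y)) * A (bidx (x s)) (bidx (y s)) * (off x y s : nat)%:R.

Lemma embE s p A : emb s p A = fmx (embf s p A).
Proof. by []. Qed.

Lemma off_refl x s : off x x s.
Proof. by apply/forallP => t; rewrite eqxx implybT. Qed.

Lemma off_upd x y s o : off x (upd y s o) s = off x y s.
Proof.
by apply: eq_forallb => t; rewrite ffunE; case: (t == s).
Qed.

Lemma offE x y s : off x y s -> x = upd y s (x s).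
Proof.
move=> /forallP h; apply/ffunP => t; rewrite ffunE; have := h t.
by case: eqP => [->|_] //= /eqP.
Qed.

Lemma off_sym x y s : off x y s = off y x s.
Proof. by apply: eq_forallb => t; rewrite (eq_sym (x t)). Qed.

Lemma upd_s y s o : upd y s o s = o.
Proof. by rewrite ffunE eqxx. Qed.

Lemma cnt_upd s t y o : (s <= t)%N -> cnt s (upd y t o) = cnt s y.
Proof.
move=> st; apply: eq_bigr => u us; rewrite ffunE ifF //.
by apply/eqP => e; rewrite e ltnNge st in us.
Qed.

Lemma odd_cnt_upd s t y o : (t < s)%N -> odd (cnt s (upd y t o)) = odd (cnt s y) (+) (o (+) y t).
Proof.
move=> ts; rewrite /cnt (bigD1 t) //= [in RHS](bigD1 t) //= ffunE eqxx !oddD !oddb.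
rewrite (eq_bigr (fun u => (y u : nat))); last first.
  by move=> u /andP[_ /negbTE ut]; rewrite ffunE ut.
by case: o; case: (y t); case: odd.
Qed.

(** An operator at site [s] connects a bit vector only with the two that agree with it elsewhere, so
    matrix products reduce to sums over one bit. *)
Lemma sum_off (V : nmodType) (y : Idx) s (f : Idx -> V) :
  (forall z, ~~ off z y s -> f z = 0) -> \sum_z f z = \sum_(o : bool) f (upd y s o).
Proof.
move=> h; rewrite (partition_big (fun z : Idx => z s) xpredT) //=; apply: eq_bigr => o _.
rewrite (bigD1 (upd y s o)) /=; last by rewrite upd_s.
rewrite big1 ?addr0 // => z /andP[/eqP zs zu]; apply: h.
by apply: contra zu => /offE ->; rewrite zs.
Qed.

Lemma sum_I2 (V : nmodType) (f : 'I_2 -> V) : \sum_j f j = \sum_(o : bool) f (bidx o).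
Proof.
rewrite big_bool big_ord_recl big_ord1 addrC; congr (f _ + f _); apply: val_inj => /=;
  by rewrite inordK.
Qed.

Lemma emb_mul_same s p p' A B : emb s p A *m emb s p' B = emb s (p (+) p') (A *m B).
Proof.
rewrite !embE fmxM; apply: eq_fmx => x y.
rewrite (@sum_off _ y s) => [|z nz]; last by rewrite /embf (negbTE nz) mulr0 mulr0.
rewrite /embf mxE sum_I2 mulr_sumr mulr_suml; apply: eq_bigr => o _.
rewrite upd_s cnt_upd // off_upd (off_sym (upd y s o)) off_upd off_refl mulr1.
by case: p; case: p'; case: (odd _); rewrite /= ?expr0 ?expr1; ring.
Qed.

Definition oddmx A := forall o o', A (bidx o) (bidx o') != 0 -> o (+) o'.

(** The Koszul sign at [t] counts the bits before [t], among them bit [s], which the odd matrix [A]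
    flips; this produces the minus sign. *)
Lemma emb_odd_lt s t A B : (s < t)%N -> oddmx A ->
  emb t true B *m emb s true A = - (emb s true A *m emb t true B).
Proof.
move=> st oA; rewrite !embE !fmxM -scaleN1r.
have nst : s != t by apply: contraTneq st => ->; rewrite ltnn.
apply/matrixP => i j; rewrite !mxE; set x : Idx := enum_val i; set y : Idx := enum_val j.
rewrite (@sum_off _ y s) => [|z nz]; last by rewrite /embf (negbTE nz) !mulr0.
rewrite (bigD1 (x s)) //= big1 ?addr0; last first.
  move=> o ox; rewrite /embf (_ : off x (upd y s o) t = false) ?mulr0 ?mul0r //.
  by apply/negP => /forallP/(_ s); rewrite nst upd_s eq_sym (negbTE ox).
rewrite (@sum_off _ y t) => [|z nz]; last by rewrite /embf (negbTE nz) !mulr0.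
rewrite (bigD1 (x t)) //= big1 ?addr0; last first.
  move=> o ox; rewrite /embf (_ : off x (upd y t o) s = false) ?mulr0 ?mul0r //.
  by apply/negP => /forallP/(_ t); rewrite eq_sym nst upd_s eq_sym (negbTE ox).
rewrite /embf !upd_s (off_sym (upd y s _)) off_upd off_refl (off_sym (upd y t _)) off_upd off_refl !mulr1.
rewrite (@cnt_upd s t) ?(ltnW st) // (@odd_cnt_upd t s) //.
have -> : upd y s (x s) t = y t by rewrite ffunE eq_sym (negbTE nst).
have -> : upd y t (x t) s = y s by rewrite ffunE (negbTE nst).
have -> : off x (upd y s (x s)) t = off x (upd y t (x t)) s.
  apply/forallP/forallP => h u; apply/implyP => nu; have := h u; rewrite !ffunE.
    by case: (eqVneq u t) => [->|ut] //=; rewrite (negbTE nu).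
  by case: (eqVneq u s) => [->|us] //=; rewrite (negbTE nu).
have [A0|/oA] := eqVneq (A (bidx (x s)) (bidx (y s))) 0; first by rewrite A0 !(mulr0, mul0r).
move=> ->; rewrite addbT.
by case: (odd (cnt s y)); case: (odd (cnt t y)); rewrite /= ?expr0 ?expr1; ring.
Qed.

Lemma emb_odd s t A B : s != t -> oddmx A -> oddmx B ->
  emb t true B *m emb s true A = - (emb s true A *m emb t true B).
Proof.
move=> st oA oB; case: (ltngtP s t) => [h|h|/val_inj e]; first exact: emb_odd_lt.
  by rewrite (emb_odd_lt A h oB) opprK.
by rewrite e eqxx in st.
Qed.

Lemma embD s p A B : emb s p (A + B) = emb s p A + emb s p B.
Proof. by apply/matrixP => i j; rewrite !embE !mxE /embf !mxE mulrDr mulrDl. Qed.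

Lemma embZ s p c A : emb s p (c *: A) = c *: emb s p A.
Proof. by apply/matrixP => i j; rewrite !embE !mxE /embf !mxE mulrCA -!mulrA; congr (_ * _); rewrite mulrCA. Qed.

Lemma emb1 s : emb s false 1%:M = 1%:M.
Proof.
rewrite embE -fmx1; apply: eq_fmx => x y; rewrite /embf mul1r mxE.
have -> : (bidx (x s) == bidx (y s)) = (x s == y s).
  rewrite -val_eqE /= !inordK //; by case: (x s); case: (y s).
rewrite -natrM mulnb; congr (nat_of_bool _)%:R.
apply/andP/eqP => [[/eqP e /offE ->]|->]; last by rewrite eqxx off_refl.
by rewrite e; apply/ffunP => t; rewrite ffunE; case: eqP => // ->.
Qed.

Definition E01 : 'M[CC]_2 := \matrix_(o, p) ((o == 0 :> nat) && (p == 1 :> nat))%:R.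
Definition E10 : 'M[CC]_2 := \matrix_(o, p) ((o == 1 :> nat) && (p == 0 :> nat))%:R.

(** Fermionic annihilation, and below creation, at site [s]; together they satisfy the canonical
    anticommutation relations. *)
Definition ff s := emb s true E01.
Definition gg s := emb s true E10.

Lemma bidx_eq0 (o : bool) : (bidx o == 0 :> nat) = ~~ o.
Proof. by rewrite /= inordK; case: o. Qed.

Lemma bidx_eq1 (o : bool) : (bidx o == 1 :> nat) = o.
Proof. by rewrite /= inordK; case: o. Qed.

Lemma E01E o o' : E01 (bidx o) (bidx o') = (~~ o && o')%:R.
Proof. by rewrite mxE bidx_eq0 bidx_eq1. Qed.

Lemma E10E o o' : E10 (bidx o) (bidx o') = (o && ~~ o')%:R.
Proof. by rewrite mxE bidx_eq0 bidx_eq1. Qed.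

Definition E11 : 'M[CC]_2 := \matrix_(o, p) ((o == 1 :> nat) && (p == 1 :> nat))%:R.

Lemma E11E o o' : E11 (bidx o) (bidx o') = (o && o')%:R.
Proof. by rewrite mxE !bidx_eq1. Qed.

Lemma id2E o o' : (1%:M : 'M[CC]_2) (bidx o) (bidx o') = (o == o')%:R.
Proof. by rewrite mxE -val_eqE /= !inordK //; case: o; case: o'. Qed.

Lemma odd01 : oddmx E01.
Proof. by move=> o o'; rewrite E01E; case: o; case: o'; rewrite /= ?eqxx. Qed.

Lemma odd10 : oddmx E10.
Proof. by move=> o o'; rewrite E10E; case: o; case: o'; rewrite /= ?eqxx. Qed.

Lemma emb0 s p : emb s p 0 = 0.
Proof. by apply/matrixP => i j; rewrite !embE !mxE /embf !mxE mulr0 mul0r. Qed.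

Lemma mx2P (A B : 'M[CC]_2) : (forall o o', A (bidx o) (bidx o') = B (bidx o) (bidx o')) -> A = B.
Proof.
move=> h; have hb (i : 'I_2) : i = bidx (i == 1 :> nat).
  by apply: val_inj; rewrite /= inordK; case: i => [[|[|i]] hi].
by apply/matrixP => i j; rewrite (hb i) (hb j).
Qed.

Lemma ff_ff s : ff s *m ff s = 0.
Proof.
rewrite emb_mul_same (_ : _ *m _ = 0) ?emb0 //; apply: mx2P => o o'.
rewrite !mxE sum_I2 big_bool /= !E01E.
by case: o; case: o'; rewrite /= ?(mulr0, mul0r, addr0).
Qed.

Lemma gg_gg s : gg s *m gg s = 0.
Proof.
rewrite emb_mul_same (_ : _ *m _ = 0) ?emb0 //; apply: mx2P => o o'.
rewrite !mxE sum_I2 big_bool /= !E10E.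
by case: o; case: o'; rewrite /= ?(mulr0, mul0r, addr0).
Qed.

Definition nn s := emb s false E11.

Lemma gg_ff s : gg s *m ff s = nn s.
Proof.
rewrite emb_mul_same; congr (emb _ _ _); apply: mx2P => o o'.
rewrite mxE sum_I2 big_bool /= !E10E !E01E E11E.
by case: o; case: o'; rewrite /= ?(mulr0, mul0r, addr0, add0r, mulr1).
Qed.

Lemma ff_gg s : ff s *m gg s = 1%:M - nn s.
Proof.
rewrite -(emb1 s) -[- nn s]scaleN1r -embZ -embD emb_mul_same.
congr (emb _ _ _); apply: mx2P => o o'.
have e : (-1 *: E11) (bidx o) (bidx o') = - (o && o')%:R by rewrite mxE E11E mulN1r.
rewrite mxE sum_I2 big_bool /= !E10E !E01E [in RHS]mxE id2E e.
by case: o {e}; case: o'; rewrite /= ?(mulr0, mul0r, addr0, add0r, mulr1, subrr, oppr0).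
Qed.

Lemma ff_ff_anti s t : ff s *m ff t = - (ff t *m ff s).
Proof.
have [->|ne] := eqVneq s t; first by rewrite !ff_ff oppr0.
by rewrite (emb_odd (s := t) (t := s)) 1?eq_sym //; apply: odd01.
Qed.

Lemma gg_gg_anti s t : gg s *m gg t = - (gg t *m gg s).
Proof.
have [->|ne] := eqVneq s t; first by rewrite !gg_gg oppr0.
by rewrite (emb_odd (s := t) (t := s)) 1?eq_sym //; apply: odd10.
Qed.

Lemma ff_gg_anti s t : ff s *m gg t = (s == t)%:R%:M - gg t *m ff s.
Proof.
have [->|ne] := eqVneq s t; first by rewrite ff_gg gg_ff.
by rewrite (emb_odd (s := t) (t := s)) 1?eq_sym // ?raddf0 ?sub0r //; [apply: odd10 | apply: odd01].
Qed.

End Emb.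

(** * Power series and numerators of the monodromy matrix *)

Section SeriesTheory.
Variable R : pzRingType.
Implicit Types (A B C : ser R).

Lemma serP A B : A =1 B -> A = B.
Proof. exact: functional_extensionality. Qed.

Lemma triangle_sum (V : nmodType) n (G : nat -> nat -> V) :
  \sum_(r < n) \sum_(i < r.+1) G i (r - i)%N = \sum_(i < n) \sum_(j < n - i) G i j.
Proof.
elim: n => [|n IH]; first by rewrite !big_ord0.
rewrite big_ord_recr /= IH [RHS]big_ord_recr /= subSnn big_ord1.
have -> : \sum_(i < n) \sum_(j < n.+1 - i) G i j =
    \sum_(i < n) \sum_(j < n - i) G i j + \sum_(i < n) G i (n - i)%N.
  rewrite -big_split; apply: eq_bigr => i _ /=.
  by rewrite subSn ?(ltnW (ltn_ord i)) // big_ord_recr.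
by rewrite -addrA; congr (_ + _); rewrite big_ord_recr /= subnn.
Qed.

Lemma ser_mulA : associative (@ser_mul R).
Proof.
move=> A B C; apply: serP => n; rewrite /ser_mul.
under [RHS]eq_bigr do rewrite mulr_suml.
rewrite [RHS](eq_bigr (fun r : 'I_n.+1 => \sum_(i < r.+1) A i * B (r - i)%N * C (n - (i + (r - i)))%N)); last first.
  by move=> r _; apply: eq_bigr => i _; rewrite subnKC // -ltnS.
rewrite (triangle_sum _ (fun i j => A i * B j * C (n - (i + j))%N)).
apply: eq_bigr => i _; rewrite subSn ?leq_ord // mulr_sumr; apply: eq_bigr => j _.
by rewrite mulrA subnDA.
Qed.

Lemma ser_mul1s : left_id (@ser1 R) (@ser_mul R).
Proof.
move=> A; apply: serP => n; rewrite /ser_mul big_ord_recl /= /ser1 mul1r subn0 big1 ?addr0 //.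
by move=> i _; rewrite mul0r.
Qed.

Lemma ser_muls1 : right_id (@ser1 R) (@ser_mul R).
Proof.
move=> A; apply: serP => n; rewrite /ser_mul big_ord_recr /= /ser1 subnn mulr1 big1 ?add0r //.
by move=> i _; rewrite subn_eq0 leqNgt ltn_ord mulr0.
Qed.

HB.instance Definition _ := Monoid.isLaw.Build (ser R) (@ser1 R) (@ser_mul R)
  ser_mulA ser_mul1s ser_muls1.

Lemma ser_mul_suml (I : finType) (P : pred I) (f : I -> ser R) B :
  ser_mul (fun r => \sum_(i | P i) f i r) B = fun r => \sum_(i | P i) ser_mul (f i) B r.
Proof.
apply: serP => n; rewrite /ser_mul exchange_big /=; apply: eq_bigr => j _.
by rewrite mulr_suml.
Qed.

Lemma ser_mul_sumr (I : finType) (P : pred I) (f : I -> ser R) B :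
  ser_mul B (fun r => \sum_(i | P i) f i r) = fun r => \sum_(i | P i) ser_mul B (f i) r.
Proof.
apply: serP => n; rewrite /ser_mul exchange_big /=; apply: eq_bigr => j _.
by rewrite mulr_sumr.
Qed.

(** An entry of the ordered product of the first [m] two by two matrices, by recursion on the last
    tensor factor; [pathsum] identifies it with the sum over chains in the iterated coproduct. *)
Fixpoint mon (M : nat -> bool -> bool -> ser R) (m : nat) (i j : bool) : ser R :=
  if m is m'.+1 then fun r => \sum_(p : bool) ser_mul (mon M m' p j) (M m' i p) r
  else fun r => if i == j then ser1 R r else 0.

Definition extf m (c : {ffun 'I_m.+1 -> bool}) (o : bool) : {ffun 'I_m.+2 -> bool} :=
  [ffun i : 'I_m.+2 => if (i < m.+1)%N then c (inord i) else o].

Lemma extf_lt m c o s : (s < m.+1)%N -> @extf m c o (inord s) = c (inord s).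
Proof. by move=> h; rewrite ffunE inordK ?h // ltnS ltnW. Qed.

Lemma extf_max m c o : @extf m c o (inord m.+1) = o.
Proof. by rewrite ffunE inordK ?ltnn. Qed.

Lemma inord0 m : inord 0 = ord0 :> 'I_m.+1.
Proof. by apply: val_inj; rewrite /= inordK. Qed.

Lemma inord_max m : inord m = ord_max :> 'I_m.+1.
Proof. by apply: val_inj; rewrite /= inordK. Qed.

Lemma pathsum (M : nat -> bool -> bool -> ser R) m (i j : bool) r :
  \sum_(c : {ffun 'I_m.+1 -> bool} | (c ord0 == j) && (c ord_max == i))
    (\big[@ser_mul R/ser1 R]_(s < m) M s (c (inord s.+1)) (c (inord s))) r =
  mon M m i j r.
Proof.
elim: m i j r => [|m IH] i j r.
  rewrite /= (eq_bigr (fun=> ser1 R r)); last by move=> c _; rewrite big_ord0.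
  rewrite (eq_bigl (fun c : {ffun 'I_1 -> bool} => (i == j) && (c == [ffun=> j]))); last first.
    move=> c; rewrite (_ : ord_max = ord0); last exact: val_inj.
    apply/andP/andP => [[/eqP c0 /eqP ci]|[/eqP -> /eqP ->]].
      split; first by rewrite -ci c0.
      by apply/eqP/ffunP => s; rewrite ffunE (ord1 s).
    by rewrite ffunE.
  case: eqP => _ /=; last by rewrite big_pred0.
  by rewrite (big_pred1 [ffun=> j]).
rewrite (reindex (fun p : {ffun 'I_m.+1 -> bool} * bool => extf p.1 p.2)) /=; last first.
  exists (fun c : {ffun 'I_m.+2 -> bool} => ([ffun s : 'I_m.+1 => c (inord s)], c ord_max)) => [[c o]|c] _ /=.
    congr (_, _); last by rewrite -inord_max extf_max.
    by apply/ffunP => s; rewrite ffunE extf_lt // inord_val.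
  apply/ffunP => s; rewrite ffunE /=; case: ltnP => h.
    by rewrite ffunE inordK // inord_val.
  by congr (c _); apply: val_inj => /=; have := ltn_ord s; lia.
rewrite (eq_bigl (fun p : {ffun 'I_m.+1 -> bool} * bool => (p.1 ord0 == j) && (p.2 == i))); last first.
  by move=> [c o] /=; rewrite -[ord0]inord0 -inord_max extf_lt // extf_max inord0.
rewrite -(pair_big (fun c : {ffun 'I_m.+1 -> bool} => c ord0 == j) (fun o : bool => o == i)
  (fun c o => (\big[@ser_mul R/ser1 R]_(s < m.+1) M s (extf c o (inord s.+1)) (extf c o (inord s))) r)) /=.
under eq_bigr do rewrite big_pred1_eq.
rewrite (eq_bigr (fun c : {ffun 'I_m.+1 -> bool} => ser_mul
   (\big[@ser_mul R/ser1 R]_(s < m) M s (c (inord s.+1)) (c (inord s))) (M m i (c ord_max)) r)); last first.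
  move=> c _; rewrite big_ord_recr /= extf_max extf_lt // inord_max; congr (ser_mul _ _ r).
  by apply: eq_bigr => s _; rewrite !extf_lt // ?ltnS //; have := ltn_ord s; lia.
rewrite (partition_big (fun c : {ffun 'I_m.+1 -> bool} => c ord_max) xpredT) //=.
apply: eq_bigr => p _.
rewrite (eq_bigr (fun c : {ffun 'I_m.+1 -> bool} => ser_mul
   (\big[@ser_mul R/ser1 R]_(s < m) M s (c (inord s.+1)) (c (inord s))) (M m i p) r)); last first.
  by move=> c /andP[_ /eqP ->].
have -> : mon M m p j = fun r => \sum_(c : {ffun 'I_m.+1 -> bool} | (c ord0 == j) && (c ord_max == p))
    (\big[@ser_mul R/ser1 R]_(s < m) M s (c (inord s.+1)) (c (inord s))) r.
  by apply: serP => r'; rewrite IH.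
by rewrite ser_mul_suml.
Qed.

Definition deg_le (e : nat) A := forall r, (e < r)%N -> A r = 0.

Lemma deg_le_mul e e' A B : deg_le e A -> deg_le e' B -> deg_le (e + e') (ser_mul A B).
Proof.
move=> hA hB r hr; rewrite /ser_mul big1 // => i _.
have [h|h] := ltnP e i; first by rewrite hA ?mul0r.
by rewrite hB ?mulr0 //; lia.
Qed.

End SeriesTheory.

Section Evaluation.
Variables (F : fieldType) (N : nat).
Implicit Types (A B : ser 'M[F]_N) (x : F).

(** The value at [x] of [x^e A(x)], for a series in [x^-1] that stops at degree [e]. *)
Definition ev e A x : 'M[F]_N := \sum_(r < e.+1) x ^+ (e - r) *: A r.

Lemma ev_mul e e' A B x : deg_le e A -> deg_le e' B ->
  ev (e + e') (ser_mul A B) x = ev e A x *m ev e' B x.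
Proof.
move=> hA hB; rewrite /ev /ser_mul.
rewrite [LHS](eq_bigr (fun r : 'I_(e + e').+1 => \sum_(i < r.+1) x ^+ (e + e' - (i + (r - i))) *: (A i *m B (r - i)%N))); last first.
  move=> r _; rewrite scaler_sumr; apply: eq_bigr => i _; by rewrite subnKC ?mulmxE ?leq_ord.
rewrite (triangle_sum _ (fun i j => x ^+ (e + e' - (i + j)) *: (A i *m B j))).
rewrite mulmx_suml (big_ord_widen (e + e').+1 (fun r => x ^+ (e - r) *: A r *m \sum_(j < e'.+1) x ^+ (e' - j) *: B j)) ?ltnS ?leq_addr //.
rewrite [LHS](bigID (fun i : 'I_(e + e').+1 => i < e.+1)%N) /= [X in _ + X]big1 ?addr0; last first.
  move=> i; rewrite -leqNgt => hi; rewrite big1 // => j _.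
  by rewrite hA // mul0mx scaler0.
apply: eq_bigr => i hi; rewrite mulmx_sumr.
rewrite (big_ord_widen ((e + e').+1 - i) (fun j => x ^+ (e - i) *: A i *m (x ^+ (e' - j) *: B j))); last by lia.
rewrite [LHS](bigID (fun j : 'I_((e + e').+1 - i) => j < e'.+1)%N) /= [X in _ + X]big1 ?addr0; last first.
  by move=> j; rewrite -leqNgt => hj; rewrite hB // mulmx0 scaler0.
apply: eq_bigr => j hj; rewrite -scalemxAl -scalemxAr scalerA -exprD.
by congr (_ ^+ _ *: _); lia.
Qed.

End Evaluation.

(** * Gauss factors of the monodromy matrix when one site is added *)

Section SiteStep.
Variables (F : fieldType) (N : nat).
Implicit Types (x u : F).
Local Notation M := 'M[F]_N.

Variables (g f : M) (x al be phi psi : F).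
Hypothesis gg : g *m g = 0.
Hypothesis ff : f *m f = 0.
Hypothesis fg : f *m g = 1%:M - g *m f.
Local Notation mu := (al + be).
Local Notation L11 := ((x + al)%:M - g *m f).
Local Notation L22 := ((x - be)%:M - g *m f).

Lemma gL c : g *m (c%:M - g *m f) = c *: g.
Proof. by rewrite mulmxBr mul_mx_scalar mulmxA gg mul0mx subr0. Qed.

Lemma Lf c : (c%:M - g *m f) *m f = c *: f.
Proof. by rewrite mulmxBl mul_scalar_mx -mulmxA ff mulmx0 subr0. Qed.

Lemma Lg c : (c%:M - g *m f) *m g = (c - 1) *: g.
Proof.
rewrite mulmxBl mul_scalar_mx -mulmxA fg mulmxBr mulmx1 mulmxA gg mul0mx subr0.
by rewrite scalerBl scale1r.
Qed.

Lemma anti_L (X : M) c : g *m X = - (X *m g) -> f *m X = - (X *m f) ->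
  (c%:M - g *m f) *m X = X *m (c%:M - g *m f).
Proof.
move=> hg hf; rewrite mulmxBl mulmxBr mul_scalar_mx mul_mx_scalar; congr (_ - _).
by rewrite -mulmxA hf mulmxN mulmxA hg mulNmx opprK mulmxA.
Qed.

Variables (a b c d E G : M).
Hypothesis ph0 : phi != 0.
Hypothesis hb : phi *: b = E *m a.
Hypothesis hc : phi *: c = a *m G.
Hypothesis hd : phi *: d = psi *: a + E *m c.
Hypothesis ag : a *m g = g *m a.
Hypothesis gG : g *m G = - (G *m g).
Hypothesis fG : f *m G = - (G *m f).
Hypothesis GG : G *m G = 0.

(** [hb], [hc] and [hd] form a Gauss decomposition with factors [E] and [G]. The primed entries
    result from multiplication by the site matrix with entries [L11], [-g], [mu f], [L22], and [E'],
    [G'] are the new factors. *)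
Local Notation a' := (a *m L11 - c *m g).
Local Notation b' := (b *m L11 - d *m g).
Local Notation c' := (mu *: (a *m f) + c *m L22).
Local Notation d' := (mu *: (b *m f) + d *m L22).
Local Notation E' := ((x + al) *: E - psi *: g).
Local Notation G' := ((x - be) *: G + (mu * phi) *: f).
Definition Kst : M := phi *: L11 - G *m g.

Lemma step_a : phi *: a' = a *m Kst.
Proof.
by rewrite scalerBr [phi *: (c *m g)]scalemxAl hc /Kst [RHS]mulmxBr -[a *m (phi *: _)]scalemxAr mulmxA.
Qed.

Lemma gK : g *m Kst = (phi * (x + al)) *: g.
Proof.
by rewrite /Kst mulmxBr -scalemxAr gL mulmxA gG mulNmx -mulmxA gg mulmx0 oppr0 subr0 scalerA.
Qed.

Lemma step_ga : g *m a' = (x + al) *: (a *m g).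
Proof.
apply: (scalerI ph0); rewrite scalemxAr step_a mulmxA -ag -mulmxA gK -scalemxAr scalerA.
by [].
Qed.

Lemma step_b : (phi * (x + al)) *: b' = E' *m a'.
Proof.
have e : phi *: b' = E *m a' - psi *: (a *m g).
  move: L11 => L; rewrite scalerBr [phi *: (b *m _)]scalemxAl [phi *: (d *m _)]scalemxAl hb hd.
  rewrite mulmxDl mulmxBr -scalemxAl !mulmxA [psi *: _ + _]addrC opprD addrA.
  by [].
rewrite mulrC -scalerA e scalerBr mulmxBl -!scalemxAl step_ga.
by rewrite !scalerA mulrC.
Qed.

Lemma phi_c' : phi *: c' = a *m ((mu * phi) *: f + G *m L22).
Proof.
move: L22 => L; rewrite scalerDr [phi *: (c *m L)]scalemxAl hc [RHS]mulmxDr mulmxA; congr (_ + _).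
by rewrite -scalemxAr scalerA mulrC.
Qed.

Lemma key_lin (W1 W2 W3 : M) :
  phi *: ((x - be) *: ((x + al) *: W1 - W2) + (mu * phi) *: ((x + al) *: W3)) -
    (mu * phi) *: W2 =
  (phi * (x + al)) *: ((mu * phi) *: W3 + ((x - be) *: W1 - W2)).
Proof. by apply/matrixP => i j; rewrite !mxE; ring. Qed.

Lemma KG : Kst *m G' = (phi * (x + al)) *: ((mu * phi) *: f + G *m L22).
Proof.
have -> : Kst *m G' = phi *: ((x - be) *: ((x + al) *: G - G *m (g *m f)) +
    (mu * phi) *: ((x + al) *: f)) - (mu * phi) *: (G *m (g *m f)).
  rewrite /Kst mulmxBl -!scalemxAl !mulmxDr -!scalemxAr Lf anti_L //.
  have -> : G *m g *m G = 0 by rewrite -mulmxA gG mulmxN mulmxA GG mul0mx oppr0.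
  by rewrite scaler0 add0r -[G *m g *m f]mulmxA [G *m (_ - _)]mulmxBr mul_mx_scalar.
by rewrite key_lin mulmxBr mul_mx_scalar.
Qed.

Lemma step_c : (phi * (x + al)) *: c' = a' *m G'.
Proof.
apply: (scalerI ph0); rewrite [in RHS]scalemxAl step_a -mulmxA KG -scalemxAr -phi_c'.
by rewrite !scalerA mulrC.
Qed.

Lemma step_d : (phi * (x + al)) *: d' = (psi * (x - be)) *: a' + E' *m c'.
Proof.
have e : phi *: d' = E *m c' + psi *: (a *m L22).
  move: L22 => L; rewrite scalerDr [phi *: (d *m L)]scalemxAl hd scalerA mulrC -scalerA.
  rewrite [phi *: (b *m f)]scalemxAl hb mulmxDl mulmxDr -!scalemxAr -scalemxAl !mulmxA.
  by rewrite [psi *: _ + _]addrC addrA.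
(* This trades [a L22] for the new entries; its term [g c'] is the one that completes [(x + al) E]
   to [E']. *)
have e2 : (x + al) *: (a *m L22) = (x - be) *: a' - g *m c'.
  apply: (scalerI ph0); rewrite scalerBr [phi *: (g *m c')]scalemxAr phi_c'.
  rewrite [phi *: (_ *: a')]scalerA [phi * (x - be)]mulrC -[((x - be) * phi) *: _]scalerA step_a.
  rewrite [g *m (a *m _)]mulmxA -ag -[a *m g *m _]mulmxA !(scalemxAr _ a) -mulmxBr; congr (_ *m _).
  rewrite mulmxDr -scalemxAr mulmxA gG mulNmx -mulmxA gL -scalemxAr /Kst.
  move: (g *m f) (G *m g) => W1 W2.
  by apply/matrixP => i j; rewrite !mxE; ring.
rewrite [phi * _]mulrC -[((x + al) * phi) *: _]scalerA e scalerDr.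
rewrite [(x + al) *: (psi *: _)]scalerA [(x + al) * psi]mulrC -[(psi * (x + al)) *: _]scalerA e2.
rewrite [E' *m _]mulmxBl -!scalemxAl.
move: a' (E *m c') (g *m c') => W1 W2 W3.
by apply/matrixP => i j; rewrite !mxE; ring.
Qed.

Lemma step_comm (X : M) : g *m X = - (X *m g) -> f *m X = - (X *m f) ->
  G *m X = - (X *m G) -> a *m X = X *m a -> a' *m X = X *m a'.
Proof.
move=> hg hf hG ha; apply: (scalerI ph0); rewrite [LHS]scalemxAl [RHS]scalemxAr step_a.
have hK : Kst *m X = X *m Kst.
  rewrite /Kst mulmxBl mulmxBr -scalemxAl -scalemxAr anti_L //; congr (_ - _).
  by rewrite -mulmxA hg mulmxN mulmxA hG mulNmx opprK mulmxA.
by rewrite -mulmxA hK !mulmxA ha.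
Qed.

Variables (u phu psu : F) (Eu : M).
Hypothesis gEu : g *m Eu = - (Eu *m g).
Hypothesis fEu : f *m Eu = - (Eu *m f).
Hypothesis GEu : (x - u) *: (G *m Eu) =
  (phi * psu - psi * phu)%:M - (x - u) *: (Eu *m G).
Hypothesis aEu : ((x - u) * phi) *: (a *m Eu) =
  (((x - u - 1) * phi) *: Eu + phu *: E) *m a.

Local Notation Eu' := ((u + al) *: Eu - psu *: g).

Lemma KEu : (x - u) *: (Kst *m Eu') =
  ((u + al) * (x - u)) *: (Eu *m Kst) +
  ((u + al) * (phi * psu - psi * phu) - (x - u) * psu * phi * (x + al - 1)) *: g.
Proof.
have e1 : Kst *m g = (phi * (x + al - 1)) *: g.
  by rewrite /Kst mulmxBl -scalemxAl Lg -mulmxA gg mulmx0 subr0 scalerA.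
have e2 : (x - u) *: (Kst *m Eu) = (x - u) *: (Eu *m Kst) + (phi * psu - psi * phu) *: g.
  rewrite /Kst mulmxBl mulmxBr -scalemxAl -scalemxAr anti_L // -[G *m g *m Eu]mulmxA gEu mulmxN opprK.
  rewrite scalerDr scalerBr mulmxA [(x - u) *: (G *m Eu *m g)]scalemxAl GEu.
  rewrite mulmxBl mul_scalar_mx -scalemxAl -mulmxA.
  move: (Eu *m (G *m g)) (Eu *m L11) => W1 W2.
  by apply/matrixP => i j; rewrite !mxE; ring.
rewrite [Kst *m Eu']mulmxBr -!scalemxAr e1 scalerBr [(x - u) *: (_ *: (Kst *m Eu))]scalerA.
rewrite [(x - u) * (u + al)]mulrC -[(_ * _) *: (Kst *m Eu)]scalerA e2.
move: (Eu *m Kst) => W.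
by apply/matrixP => i j; rewrite !mxE; ring.
Qed.

(** Both sides are brought to an operator times [a *m Kst]. By [KEu], moving [Eu'] through [Kst]
    costs only a multiple of [g], and [g] passes [a *m Kst] with a scalar. *)
Lemma step_aE :
  ((x - u) * (phi * (x + al))) *: (a' *m Eu') =
  (((x - u - 1) * (phi * (x + al))) *: Eu' + (phu * (u + al)) *: E') *m a'.
Proof.
apply: (scalerI ph0); rewrite [LHS]scalerA [phi * _]mulrC -[LHS]scalerA [phi *: (a' *m Eu')]scalemxAl step_a.
rewrite [RHS]scalemxAr step_a -[a *m Kst *m _]mulmxA.
have -> : ((x - u) * (phi * (x + al))) *: (a *m (Kst *m Eu')) =
    (phi * (x + al)) *: (a *m ((x - u) *: (Kst *m Eu'))).
  by rewrite -scalemxAr scalerA mulrC.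
rewrite KEu mulmxDr scalerDr -!scalemxAr.
have h1 : (phi * (x + al)) *: (a *m g) = g *m (a *m Kst).
  by rewrite mulmxA -ag -mulmxA gK -scalemxAr.
set cg := (u + al) * _ - _.
have -> : (phi * (x + al)) *: (cg *: (a *m g)) = cg *: (g *m (a *m Kst)).
  by rewrite scalerA mulrC -scalerA h1.
have -> : (phi * (x + al)) *: ((u + al) * (x - u) *: (a *m (Eu *m Kst))) =
   ((x + al) * (u + al)) *: ((((x - u - 1) * phi) *: Eu + phu *: E) *m (a *m Kst)).
  rewrite [_ *m (a *m Kst)]mulmxA -aEu -scalemxAl mulmxA !scalerA; congr (_ *: _).
  by ring.
rewrite !scalemxAl -mulmxDl; congr (_ *m _); rewrite /cg.
by apply/matrixP => i j; rewrite !mxE; ring.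
Qed.

End SiteStep.

Section SerRev.
Variable R : comNzRingType.

Lemma rev_serE (p : {poly CC}) e j : rev_ser e p j = (revp e p)`_j.
Proof. by rewrite /rev_ser coef_revp. Qed.

Lemma rev_serM d e (p q : {poly CC}) : (size p <= d.+1)%N -> (size q <= e.+1)%N ->
  ser_mul (rev_ser d p) (rev_ser e q) = rev_ser (d + e) (p * q).
Proof.
move=> sp sq; apply: serP => j; rewrite rev_serE revpM // coefM /ser_mul.
by apply: eq_bigr => i _; rewrite !rev_serE.
Qed.

End SerRev.

Section Scalar.
Variable N : nat.
Implicit Types (A B : ser CC) (S : ser 'M[CC]_N).

Definition sc A : ser 'M[CC]_N := fun r => (A r)%:M.

Lemma scM A B : ser_mul (sc A) (sc B) = sc (ser_mul A B).
Proof.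
apply: serP => r; rewrite /sc /ser_mul raddf_sum; apply: eq_bigr => i _ /=.
by rewrite -mulmxE scalar_mxM.
Qed.

Lemma sc_comm A S : ser_mul (sc A) S = ser_mul S (sc A).
Proof.
apply: serP => r; rewrite /sc /ser_mul [RHS](reindex_inj rev_ord_inj) /=; apply: eq_bigr => i _.
rewrite subSS subKn ?leq_ord // -!mulmxE.
by rewrite scalar_mxC.
Qed.

Lemma sc1 : sc (ser1 CC) = ser1 'M[CC]_N.
Proof. by apply: serP => -[|r]; rewrite /sc /ser1 /= ?raddf0. Qed.

End Scalar.

Section Numerators.
Variables (k : nat) (lam : 'I_k -> CC * CC) (b : 'I_k -> CC).
Local Notation N := (Ndim k).
Implicit Types (s : 'I_k) (i j : bool).

(** Extends a family on ['I_k] to all naturals by a default, so that recursions on the number of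
    sites avoid ordinals. *)
Definition on_site (V : Type) (f : 'I_k -> V) (d : V) (m : nat) : V :=
  if insub m is Some s then f s else d.

Lemma on_siteE (V : Type) (f : 'I_k -> V) d s : on_site f d s = f s.
Proof. by rewrite /on_site valK. Qed.

Definition Tsite s i j : ser 'M[CC]_N := fun r => emb s (i (+) j) (Tloc lam b s i j r).
Definition Tl := on_site Tsite (fun _ _ _ => 0).

Lemma Tcoef_mon i j : Tcoef lam b i j = mon Tl k i j.
Proof.
apply: serP => r; rewrite -pathsum /Tcoef; apply: eq_bigr => c _.
rewrite /chainT; congr (_ r); apply: eq_bigr => s _.
by rewrite /Tl on_siteE.
Qed.

(** [(x - b_s) / x] as a series in [x^-1]. Multiplication by it cancels the geometric tail of the
    evaluation module and leaves a numerator of degree one. *)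
Definition linser s : ser CC := rev_ser 1 ('X - (b s)%:P).
Definition Nsite s i j : ser 'M[CC]_N := ser_mul (sc N (linser s)) (Tsite s i j).
Definition Nl := on_site Nsite (fun _ _ _ => 0).

Lemma linser0 s : linser s 0 = 1.
Proof. by rewrite /linser /rev_ser /= coefB coefX coefC subr0. Qed.

Lemma linser1 s : linser s 1 = - b s.
Proof. by rewrite /linser /rev_ser /= coefB coefX coefC sub0r. Qed.

Lemma linser2 s r : linser s r.+2 = 0.
Proof. by []. Qed.

Lemma NsiteE s i j r : Nsite s i j r =
  Tsite s i j r - (if r is r'.+1 then b s *: Tsite s i j r' else 0).
Proof.
rewrite /Nsite /ser_mul /sc; case: r => [|r].
  by rewrite big_ord1 linser0 mul1r subr0.
rewrite !big_ord_recl /= linser0 linser1 mul1r subn0 /bump /= subSS subn0 big1 ?addr0 => [|m _].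
  by rewrite -mulmxE mul_scalar_mx scaleNr.
by rewrite linser2 raddf0 mul0r.
Qed.

Lemma emb_scal s c : emb s false c%:M = c%:M.
Proof. by rewrite -scalemx1 embZ emb1 scalemx1. Qed.

Lemma Tsite0 s i j : Tsite s i j 0 = (i == j)%:R%:M.
Proof.
rewrite /Tsite /=; case: eqP => [->|_]; first by rewrite addbb emb1.
by rewrite !raddf0 emb0.
Qed.

Lemma Nsite0 s i j : Nsite s i j 0 = (i == j)%:R%:M.
Proof. by rewrite NsiteE subr0 Tsite0. Qed.

Lemma Nsite1 s i j : Nsite s i j 1 = Tsite s i j 1 - (b s * (i == j)%:R)%:M.
Proof. by rewrite NsiteE [X in _ - X]/= Tsite0 scale_scalar_mx. Qed.

Lemma Nsite_deg s i j : deg_le 1 (Nsite s i j).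
Proof.
case=> [|[|r]] // _; rewrite NsiteE /Tsite /= -embZ scalerA.
by rewrite mulrCA -exprS subrr.
Qed.

Lemma Nsite_ev s i j x : ev 1 (Nsite s i j) x =
  ((x - b s) * (i == j)%:R)%:M + emb s (i (+) j) ((-1) ^+ j *: gl11_act lam s j i).
Proof.
rewrite /ev big_ord_recl big_ord1 /= Nsite0 Nsite1 expr1 expr0 scale1r scale_scalar_mx.
rewrite /Tsite /= expr0 mulr1 addrCA addrC; congr (_ + _).
by rewrite -raddfN -raddfD /= -mulrBl.
Qed.

Definition Pm m : {poly CC} := \prod_(s < m) ('X - (on_site b 0 s)%:P).

Lemma Pm_k : Pm k = Ppol b.
Proof. by apply: eq_bigr => s _; rewrite on_siteE. Qed.

Lemma size_Pm m : size (Pm m) = m.+1.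
Proof. by rewrite size_prod_XsubC -[index_enum _]enumT size_enum_ord. Qed.

Lemma mon_Nl m i j : (m <= k)%N ->
  mon Nl m i j = ser_mul (sc N (rev_ser m (Pm m))) (mon Tl m i j).
Proof.
elim: m i j => [|m IH] i j hm.
  rewrite /Pm big_ord0 (_ : rev_ser 0 1 = ser1 CC) ?sc1 ?ser_mul1s //.
  by apply: serP => -[|r]; rewrite /rev_ser /ser1 //= coef1.
have -> : rev_ser m.+1 (Pm m.+1) = ser_mul (rev_ser m (Pm m)) (linser (Ordinal hm)).
  rewrite /linser rev_serM ?size_Pm ?size_XsubC // addn1; congr (rev_ser _ _).
  by rewrite /Pm big_ord_recr /=; congr (_ * ('X - _%:P)); rewrite -(on_siteE b 0).
rewrite -scM /= ser_mul_sumr; apply: serP => r; apply: eq_bigr => p _; congr (_ r).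
rewrite IH ?(ltnW hm) // -!ser_mulA; congr ser_mul.
rewrite !ser_mulA sc_comm -ser_mulA; congr ser_mul.
by rewrite /Nl /Tl -[m]/(val (Ordinal hm)) !on_siteE.
Qed.

Definition NumT i j := mon Nl k i j.

Lemma NumE i j : NumT i j = ser_mul (sc N (rev_ser k (Ppol b))) (Tcoef lam b i j).
Proof. by rewrite /NumT mon_Nl // Pm_k Tcoef_mon. Qed.

Lemma mon_Nl_deg m i j : (m <= k)%N -> deg_le m (mon Nl m i j).
Proof.
elim: m i j => [|m IH] i j hm r hr /=.
  by case: eqP => // _; rewrite /ser1; case: r hr.
rewrite big1 // => p _; rewrite -[m]/(val (Ordinal hm)) /Nl on_siteE.
have h := deg_le_mul (IH p j (ltnW hm)) (@Nsite_deg (Ordinal hm) i p).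
by rewrite h // addn1.
Qed.

Lemma Num_deg i j : deg_le k (NumT i j).
Proof. exact: mon_Nl_deg. Qed.

Definition tm m i j x := ev m (mon Nl m i j) x.

Lemma tm0 i j x : tm 0 i j x = (i == j)%:R%:M.
Proof.
rewrite /tm /ev big_ord1 /= expr0 scale1r.
by case: eqP => _; rewrite /ser1 /= ?raddf0.
Qed.

Lemma tmS m (hm : (m < k)%N) i j x : let s := Ordinal hm in
  tm m.+1 i j x = \sum_(p : bool) tm m p j x *m
    (((x - b s) * (i == p)%:R)%:M + emb s (i (+) p) ((-1) ^+ p *: gl11_act lam s p i)).
Proof.
rewrite /= /tm {1}/ev /=.
under eq_bigr do rewrite scaler_sumr.
rewrite exchange_big; apply: eq_bigr => p _ /=.
rewrite -Nsite_ev -(ev_mul _ (mon_Nl_deg _ _ (ltnW hm)) (@Nsite_deg _ _ _)) addn1.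
rewrite (_ : Nl m = Nsite (Ordinal hm)) //.
by rewrite /Nl -[m]/(val (Ordinal hm)) on_siteE.
Qed.

Lemma mon_Tl0 m i j : (m <= k)%N -> mon Tl m i j 0 = (i == j)%:R%:M.
Proof.
elim: m i j => [|m IH] i j hm /=.
  by case: eqP => _; rewrite /ser1 /= ?raddf0.
rewrite (eq_bigr (fun p => ((p == j) && (i == p))%:R%:M)) => [|p _].
  by rewrite big_bool; case: i; case: j; rewrite /= ?raddf0 ?addr0 ?add0r.
rewrite /ser_mul big_ord1 IH ?(ltnW hm) // -[m]/(val (Ordinal hm)) /Tl on_siteE Tsite0.
by rewrite -mulmxE -scalar_mxM -natrM mulnb.
Qed.

Lemma Tcoef0 i j : Tcoef lam b i j 0 = (i == j)%:R%:M.
Proof. by rewrite Tcoef_mon mon_Tl0. Qed.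

Lemma Tcoef1 i j : Tcoef lam b i j 1 = \sum_s emb s (i (+) j) (Tloc lam b s i j 1).
Proof.
suff h m : (m <= k)%N -> mon Tl m i j 1 = \sum_(s < k | (s < m)%N) Tsite s i j 1.
  by rewrite Tcoef_mon h //; apply: eq_bigl => s; rewrite ltn_ord.
elim: m i j => [|m IH] i' j' hm /=.
  by rewrite big_pred0 //; case: eqP.
rewrite [RHS](bigD1 (Ordinal hm)) //= addrC.
rewrite (eq_bigr (fun p : bool => (i' == p)%:R *: mon Tl m p j' 1 + (p == j')%:R *: Tsite (Ordinal hm) i' p 1)) => [|p _].
  rewrite big_split /=; congr (_ + _).
    rewrite -[RHS]/(\sum_(s < k | (s < m.+1)%N && (s != Ordinal hm)) Tsite s i' j' 1).
    rewrite (eq_bigl (fun s : 'I_k => s < m)%N) => [|s]; last first.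
      by rewrite ltnS -val_eqE /= andbC -ltn_neqAle.
    rewrite -IH ?(ltnW hm) // big_bool; case: (i') => /=; by rewrite ?scale0r ?scale1r ?addr0 ?add0r.
  by rewrite big_bool; case: (j') => /=; rewrite ?scale0r ?scale1r ?addr0 ?add0r.
rewrite /ser_mul big_ord_recl big_ord1 /= /bump /= subnn mon_Tl0 ?(ltnW hm) //.
rewrite -[m in Tl m]/(val (Ordinal hm)) /Tl on_siteE Tsite0.
by rewrite -!mulmxE mul_scalar_mx mul_mx_scalar addrC.
Qed.

End Numerators.

(** * Exchange relations *)

Section Monodromy.
Variables (k : nat) (lam : 'I_k -> CC * CC) (b : 'I_k -> CC).
Local Notation N := (Ndim k).
Implicit Types (s t : 'I_k) (x u : CC).

Definition alp s := (lam s).1 - b s.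
Definition bet s := (lam s).2 + b s.
Definition al := on_site alp 0.
Definition be := on_site bet 0.

Lemma L11E s x : ((x - b s) * (false == false)%:R)%:M +
  emb s (false (+) false) ((-1) ^+ false *: gl11_act lam s false false) =
  (x + alp s)%:M - gg s *m ff s.
Proof.
have -> : (-1) ^+ false *: gl11_act lam s false false = ((lam s).1)%:M - E11.
  apply: mx2P => o o'; rewrite expr0 scale1r !mxE -!val_eqE /= !bidx_eq1.
  rewrite /bidx !inordK //; by case: o; case: o'; rewrite /= ?mulr1n ?mulr0n ?subr0 ?sub0r ?oppr0.
rewrite embD -[- E11]scaleN1r embZ emb_scal gg_ff scaleN1r addrA; congr (_ - _).
by rewrite -raddfD /= mulr1 /alp addrAC addrA addrAC.
Qed.

Lemma L22E s x : ((x - b s) * (true == true)%:R)%:M +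
  emb s (true (+) true) ((-1) ^+ true *: gl11_act lam s true true) =
  (x - bet s)%:M - gg s *m ff s.
Proof.
have -> : (-1) ^+ true *: gl11_act lam s true true = (- (lam s).2)%:M - E11.
  apply: mx2P => o o'; rewrite expr1 scaleN1r !mxE -!val_eqE /= !bidx_eq1.
  rewrite /bidx !inordK //; by case: o; case: o'; rewrite /= ?mulr1n ?mulr0n ?subr0 ?sub0r ?oppr0 ?addr0 ?opprD.
rewrite embD -[- E11]scaleN1r embZ emb_scal gg_ff scaleN1r addrA; congr (_ - _).
by rewrite -raddfD /= mulr1 /bet opprD addrAC addrA.
Qed.

Lemma L12E s x : ((x - b s) * (false == true)%:R)%:M +
  emb s (false (+) true) ((-1) ^+ true *: gl11_act lam s true false) = - gg s.
Proof.
rewrite mulr0 raddf0 add0r expr1 embZ scaleN1r; congr (- emb _ _ _).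
by apply: mx2P => o o'; rewrite !mxE; case: ifP.
Qed.

Lemma L21E s x : ((x - b s) * (true == false)%:R)%:M +
  emb s (true (+) false) ((-1) ^+ false *: gl11_act lam s false true) =
  (alp s + bet s) *: ff s.
Proof.
rewrite mulr0 raddf0 add0r expr0 scale1r -embZ; congr (emb _ _ _).
have -> : alp s + bet s = (lam s).1 + (lam s).2 by rewrite /alp /bet addrACA addNr addr0.
by apply: mx2P => o o'; rewrite !mxE; case: ifP; rewrite ?mulr1 ?mulr0.
Qed.

Local Notation tA m x := (tm lam b m false false x).
Local Notation tB m x := (tm lam b m false true x).
Local Notation tC m x := (tm lam b m true false x).
Local Notation tD m x := (tm lam b m true true x).

Definition phm m x := \prod_(s < m) (x + al s).
Definition psm m x := \prod_(s < m) (x - be s).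

(** Coefficients of the creation operators in [phi T_12 T_11^-1], and in [eG] of the annihilation
    operators in [phi T_11^-1 T_21]; the recursions are those of the Gauss factors [E'] and [G']. *)
Fixpoint eE m u t : CC := if m is m'.+1 then
  (u + al m') * eE m' u t - psm m' u * (t == m' :> nat)%:R else 0.
Fixpoint eG m x t : CC := if m is m'.+1 then
  (x - be m') * eG m' x t + (al m' + be m') * phm m' x * (t == m' :> nat)%:R else 0.

Definition gsum (c : 'I_k -> CC) : 'M[CC]_N := \sum_t c t *: gg t.
Definition fsum (c : 'I_k -> CC) : 'M[CC]_N := \sum_t c t *: ff t.

Lemma gsum_anti c c' : gsum c *m gsum c' = - (gsum c' *m gsum c).
Proof.
rewrite /gsum !mulmx_suml -sumrN; under eq_bigr do rewrite mulmx_sumr.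
under [RHS]eq_bigr do rewrite mulmx_sumr -sumrN.
rewrite exchange_big; apply: eq_bigr => t _; apply: eq_bigr => s _.
by rewrite -!scalemxAl -!scalemxAr gg_gg_anti !scalerN !scalerA mulrC.
Qed.

Lemma fsum_anti c c' : fsum c *m fsum c' = - (fsum c' *m fsum c).
Proof.
rewrite /fsum !mulmx_suml -sumrN; under eq_bigr do rewrite mulmx_sumr.
under [RHS]eq_bigr do rewrite mulmx_sumr -sumrN.
rewrite exchange_big; apply: eq_bigr => t _; apply: eq_bigr => s _.
by rewrite -!scalemxAl -!scalemxAr ff_ff_anti !scalerN !scalerA mulrC.
Qed.

Lemma fsum_gsum c c' : fsum c *m gsum c' = (\sum_t c t * c' t)%:M - gsum c' *m fsum c.
Proof.
have e s t : (c s *: ff s) *m (c' t *: gg t) =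
    (c s * c' t * (s == t)%:R)%:M - (c' t *: gg t) *m (c s *: ff s).
  rewrite -!scalemxAl -!scalemxAr ff_gg_anti !scalerBr !scalerA scale_scalar_mx.
  by rewrite [c' t * c s]mulrC.
rewrite /fsum /gsum !mulmx_suml; under eq_bigr do rewrite mulmx_sumr.
under [X in _ = _ - X]eq_bigr do rewrite mulmx_sumr.
rewrite [X in _ = _ - X]exchange_big raddf_sum -sumrB; apply: eq_bigr => s _ /=.
rewrite (eq_bigr _ (fun t _ => e s t)) sumrB; congr (_ - _).
rewrite (bigD1 s) //= eqxx mulr1 big1 ?addr0 // => t.
by rewrite eq_sym => /negbTE ->; rewrite mulr0 raddf0.
Qed.

Lemma gsum_delta s : gg s = gsum (fun t => (t == s)%:R).
Proof.
rewrite /gsum (bigD1 s) //= eqxx scale1r big1 ?addr0 // => t /negbTE ->.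
by rewrite scale0r.
Qed.

Lemma fsum_delta s : ff s = fsum (fun t => (t == s)%:R).
Proof.
rewrite /fsum (bigD1 s) //= eqxx scale1r big1 ?addr0 // => t /negbTE ->.
by rewrite scale0r.
Qed.

Lemma gsum_lin a c a' c' : gsum (fun t => a * c t + a' * c' t) = a *: gsum c + a' *: gsum c'.
Proof.
rewrite /gsum !scaler_sumr -big_split; apply: eq_bigr => t _ /=.
by rewrite scalerDl !scalerA.
Qed.

Lemma fsum_lin a c a' c' : fsum (fun t => a * c t + a' * c' t) = a *: fsum c + a' *: fsum c'.
Proof.
rewrite /fsum !scaler_sumr -big_split; apply: eq_bigr => t _ /=.
by rewrite scalerDl !scalerA.
Qed.

Lemma eE_big m u t : (m <= t)%N -> eE m u t = 0.
Proof.
elim: m => [|m IH] h //=; rewrite IH ?(ltnW h) // mulr0 sub0r.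
by rewrite gtn_eqF // mulr0 oppr0.
Qed.

Lemma eG_big m u t : (m <= t)%N -> eG m u t = 0.
Proof.
elim: m => [|m IH] h //=; rewrite IH ?(ltnW h) // mulr0 add0r.
by rewrite gtn_eqF // mulr0.
Qed.

Definition Em m u := gsum (eE m u).
Definition Gm m x := fsum (eG m x).

Lemma EmS m (hm : (m < k)%N) u :
  Em m.+1 u = (u + al m) *: Em m u - psm m u *: gg (Ordinal hm).
Proof.
rewrite /Em (gsum_delta (Ordinal hm)) -scaleNr -gsum_lin; apply: eq_bigr => t _ /=.
by rewrite mulNr -val_eqE.
Qed.

Lemma GmS m (hm : (m < k)%N) x :
  Gm m.+1 x = (x - be m) *: Gm m x + ((al m + be m) * phm m x) *: ff (Ordinal hm).
Proof.
by rewrite /Gm (fsum_delta (Ordinal hm)) -fsum_lin; apply: eq_bigr => t _ /=; rewrite -val_eqE.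
Qed.

Lemma phmS m x : phm m.+1 x = phm m x * (x + al m).
Proof. by rewrite /phm big_ord_recr. Qed.

Lemma psmS m x : psm m.+1 x = psm m x * (x - be m).
Proof. by rewrite /psm big_ord_recr. Qed.

Lemma EG_pair (F : fieldType) (x u a c ph ps pu qu S : F) :
  (x - u) * S = ph * qu - ps * pu ->
  (x - u) * ((x - c) * (u + a) * S - (a + c) * ph * qu) =
  ph * (x + a) * (qu * (u - c)) - ps * (x - c) * (pu * (u + a)).
Proof.
move=> h; rewrite mulrBr [(x - u) * (_ * S)]mulrCA h; ring.
Qed.

(** The scalar anticommutator of [G(x)] and [E(u)], an identity of Christoffel-Darboux type proved
    site by site. *)
Lemma pairing m x u : (m <= k)%N ->
  (x - u) * (\sum_t eG m x t * eE m u t) = phm m x * psm m u - psm m x * phm m u.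
Proof.
elim: m => [|m IH] hm.
  rewrite big1 ?mulr0; last by move=> t _; rewrite mul0r.
  by rewrite /phm /psm !big_ord0 subrr.
rewrite !phmS !psmS -(EG_pair _ _ (IH (ltnW hm))); congr (_ * _).
pose s := Ordinal hm.
rewrite (bigD1 s) //= [X in _ = _ * X - _](bigD1 s) //= eE_big // eG_big // eqxx.
rewrite !mulr0 !add0r !mulr1 addrC mulr_sumr mulrN; congr (_ - _).
apply: eq_bigr => t; rewrite -val_eqE /= => /negbTE ->.
by rewrite !mulr0 subr0 addr0; ring.
Qed.

Variable x : CC.
Hypothesis xal : forall s, x + alp s != 0.

Lemma phm_neq0 m : (m <= k)%N -> phm m x != 0.
Proof.
move=> hm; apply/prodf_neq0 => s _; have hs := leq_trans (ltn_ord s) hm.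
by rewrite /al -[nat_of_ord s]/(val (Ordinal hs)) on_siteE.
Qed.

(** The Gauss decomposition, the commutation of the first entry with later sites and its exchange
    relation with [E] are proved together, since the step of each draws on others. Zeros of [phi]
    are excluded and removed afterwards by interpolation. *)
Lemma monodromy m : (m <= k)%N ->
  [/\ phm m x *: tB m x = Em m x *m tA m x,
      phm m x *: tC m x = tA m x *m Gm m x,
      phm m x *: tD m x = psm m x *: tA m x + Em m x *m tC m x,
      (forall t, (m <= t)%N -> tA m x *m gg t = gg t *m tA m x) &
      (forall u, ((x - u) * phm m x) *: (tA m x *m Em m u) =
         (((x - u - 1) * phm m x) *: Em m u + phm m u *: Em m x) *m tA m x)].
Proof.
elim: m => [|m IH] hm.
  have E0 u : Em 0 u = 0 by rewrite /Em /gsum big1 // => t _; rewrite scale0r.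
  have G0 u : Gm 0 u = 0 by rewrite /Gm /fsum big1 // => t _; rewrite scale0r.
  rewrite !tm0 /phm /psm !E0 !G0 !big_ord0 !scale1r; split=> [||| t _|u].
  - by rewrite mul0mx raddf0.
  - by rewrite mulmx0 raddf0.
  - by rewrite mul0mx addr0.
  - by rewrite mul1mx mulmx1.
  - by rewrite !E0 !scaler0 addr0 mul0mx mulmx0 scaler0.
have [hb hc hd hg hE] := IH (ltnW hm).
pose s := Ordinal hm.
have ale : al m = alp s by rewrite /al -[m]/(val s) on_siteE.
have bee : be m = bet s by rewrite /be -[m]/(val s) on_siteE.
have ph0 := phm_neq0 (ltnW hm).
have gG t : (m <= t)%N -> Gm m x *m gg t = - (gg t *m Gm m x).
  move=> mt; rewrite (gsum_delta t) fsum_gsum big1 ?raddf0 ?sub0r // => t' _.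
  by case: eqP => [->|_]; rewrite ?mulr0 // eG_big ?mul0r.
have gG' : gg s *m Gm m x = - (Gm m x *m gg s) by rewrite gG ?opprK //=.
have fG : ff s *m Gm m x = - (Gm m x *m ff s) by rewrite fsum_delta fsum_anti.
have GG : Gm m x *m Gm m x = 0.
  have /eqP := fsum_anti (eG m x) (eG m x); rewrite -addr_eq0 -mulr2n -scaler_nat scaler_eq0.
  by rewrite pnatr_eq0 => /eqP.
have gE u : gg s *m Em m u = - (Em m u *m gg s) by rewrite gsum_delta gsum_anti.
have fE u : ff s *m Em m u = - (Em m u *m ff s).
  rewrite (fsum_delta s) fsum_gsum big1 ?raddf0 ?sub0r // => t' _.
  by case: eqP => [->|_]; rewrite ?mul0r // eE_big ?mulr0.
have GE u : (x - u) *: (Gm m x *m Em m u) =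
    (phm m x * psm m u - psm m x * phm m u)%:M - (x - u) *: (Em m u *m Gm m x).
  by rewrite fsum_gsum scalerBr scale_scalar_mx pairing // ltnW.
have fg : ff s *m gg s = 1%:M - gg s *m ff s by rewrite ff_gg gg_ff.
have agx := hg s (leqnn m).
have eA : tA m.+1 x = tA m x *m ((x + alp s)%:M - gg s *m ff s) - tC m x *m gg s.
  by rewrite (tmS lam b hm) big_bool (L11E s x) (L12E s x) mulmxN; apply: addrC.
have eB : tB m.+1 x = tB m x *m ((x + alp s)%:M - gg s *m ff s) - tD m x *m gg s.
  by rewrite (tmS lam b hm) big_bool (L11E s x) (L12E s x) mulmxN; apply: addrC.
have eC : tC m.+1 x = (alp s + bet s) *: (tA m x *m ff s) + tC m x *m ((x - bet s)%:M - gg s *m ff s).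
  by rewrite (tmS lam b hm) big_bool (L21E s x) (L22E s x) -scalemxAr; apply: addrC.
have eD : tD m.+1 x = (alp s + bet s) *: (tB m x *m ff s) + tD m x *m ((x - bet s)%:M - gg s *m ff s).
  by rewrite (tmS lam b hm) big_bool (L21E s x) (L22E s x) -scalemxAr; apply: addrC.
rewrite phmS psmS !(EmS hm) (GmS hm) ale bee -/s.
split.
- by rewrite eA eB; apply: (step_b _ _ _ (gg_gg s) ph0 hb hc hd agx gG').
- by rewrite eA eC; apply: (step_c _ _ _ (ff_ff s) ph0 hc gG' fG GG).
- by rewrite eA eC eD; apply: (step_d _ _ _ _ (gg_gg s) ph0 hb hc hd agx gG').
- move=> t mt; rewrite eA.
  have st : s != t by rewrite -val_eqE /= ltn_eqF.
  apply: (step_comm _ _ ph0 hc).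
  + exact: gg_gg_anti.
  + by rewrite ff_gg_anti (negbTE st) raddf0 sub0r.
  + by apply: gG; apply: ltnW.
  + by apply: hg; apply: ltnW.
move=> u; rewrite phmS ale (EmS hm) ale -/s eA.
exact: (step_aE _ (gg_gg s) fg ph0 hc agx gG' (gE u) (fE u) (GE u) (hE u)).
Qed.

End Monodromy.

Section TransferExchange.
Variables (F : fieldType) (N : nat).
Variables (a c d E G Eu T : 'M[F]_N) (x u q1 q2 phi psi phu psu : F).
Hypothesis ph0 : phi != 0.
Hypothesis hc : phi *: c = a *m G.
Hypothesis hd : phi *: d = psi *: a + E *m c.
Hypothesis EE : E *m E = 0.
Hypothesis EuE : Eu *m E = - (E *m Eu).
Hypothesis GEu : (x - u) *: (G *m Eu) = (phi * psu - psi * phu)%:M - (x - u) *: (Eu *m G).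
Hypothesis aEu : ((x - u) * phi) *: (a *m Eu) = (((x - u - 1) * phi) *: Eu + phu *: E) *m a.
Local Notation Fx := (q1 * phi - q2 * psi).
Local Notation Fu := (q1 * phu - q2 * psu).
Hypothesis TE : T = q1 *: a - q2 *: d.

Lemma phi_T : (phi * phi) *: T = (phi * Fx) *: a - q2 *: (E *m (a *m G)).
Proof.
have e : phi *: T = Fx *: a - q2 *: (E *m c).
  rewrite TE scalerBr scalerA [phi *: (q2 *: d)]scalerA [phi * q2]mulrC -[(q2 * phi) *: d]scalerA hd.
  move: (E *m c) => W; by apply/matrixP => i j; rewrite !mxE; ring.
rewrite -scalerA e scalerBr scalerA; congr (_ - _).
by rewrite -hc -!scalemxAr !scalerA mulrC.
Qed.

(** The exchange relation of [T_11] persists for the transfer matrix with [phi] replaced by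
    [q1 phi - q2 psi]. After multiplication by [phi^3] both sides are combinations of [Eu a], [E a]
    and [E Eu a G]. *)
Lemma transfer_exchange : ((x - u) * Fx) *: (T *m Eu) =
  (((x - u - 1) * Fx) *: Eu + Fu *: E) *m T.
Proof.
have p3 : phi * phi * phi != 0 by rewrite !mulf_neq0.
apply: (scalerI p3).
pose W := E *m (a *m G).
have h1 : ((x - u) * phi) *: (E *m (a *m G) *m Eu) = (phi * (phi * psu - psi * phu)) *: (E *m a) -
    ((x - u - 1) * phi) *: (E *m Eu *m (a *m G)).
  have -> : E *m (a *m G) *m Eu = E *m a *m (G *m Eu) by rewrite !mulmxA.
  rewrite [(x - u) * phi]mulrC -[LHS]scalerA [(x - u) *: _]scalemxAr GEu mulmxBr mul_mx_scalar scalerBr scalerA; congr (_ - _).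
  rewrite -[E *m a *m (_ *: _)]scalemxAr scalerA [phi * _]mulrC.
  have -> : E *m a *m (Eu *m G) = E *m (a *m Eu) *m G by rewrite !mulmxA.
  rewrite [LHS]scalemxAl [_ *: (E *m (a *m Eu))]scalemxAr aEu [E *m (_ *m a)]mulmxA mulmxDr -!scalemxAr EE scaler0 addr0.
  by rewrite -!scalemxAl !mulmxA.
have h2 : ((x - u) * phi) *: (a *m Eu) = ((x - u - 1) * phi) *: (Eu *m a) + phu *: (E *m a).
  by rewrite aEu mulmxDl -!scalemxAl.
have -> : (phi * phi * phi) *: (((x - u) * Fx) *: (T *m Eu)) =
    (Fx * phi * Fx) *: (((x - u) * phi) *: (a *m Eu)) - (Fx * q2) *: (((x - u) * phi) *: (E *m (a *m G) *m Eu)).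
  transitivity ((phi * ((x - u) * Fx)) *: (((phi * phi) *: T) *m Eu)).
    by rewrite -scalemxAl !scalerA; congr (_ *: _); ring.
  rewrite phi_T mulmxBl -!scalemxAl.
  move: (a *m Eu) (E *m (a *m G) *m Eu) => W1 W2.
  by apply/matrixP => i j; rewrite !mxE; ring.
rewrite h1 h2.
have -> : (phi * phi * phi) *: ((((x - u - 1) * Fx) *: Eu + Fu *: E) *m T) =
   phi *: ((((x - u - 1) * Fx) *: Eu + Fu *: E) *m ((phi * phi) *: T)).
  by rewrite -scalemxAr !scalerA; congr (_ *: _); ring.
rewrite phi_T mulmxBr !mulmxDl -!scalemxAl -!scalemxAr.
have -> : E *m (E *m (a *m G)) = 0 by rewrite mulmxA EE mul0mx.
have -> : Eu *m (E *m (a *m G)) = - (E *m Eu *m (a *m G)) by rewrite mulmxA EuE mulNmx.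
rewrite mulmxA.
move: (Eu *m a) (E *m a) (E *m Eu *m (a *m G)) => W1 W2 W3.
apply/matrixP => i j; rewrite !mxE; ring.
Qed.

End TransferExchange.

(** * The twisted transfer matrix and the vacuum *)

Module TransferMatrix.

Lemma sum_bool (V : nmodType) (f : bool -> V) : \sum_o f o = f true + f false.
Proof. by rewrite big_bool. Qed.

Section BitVectors.
Variable k : nat.
Local Notation N := (Ndim k).
Implicit Types (s t : 'I_k) (y z : Idx k).

Definition ey y : 'cV[CC]_N := delta_mx (enum_rank y) 0.

Lemma fmx_ey f y : fmx f *m ey y = \sum_z f z y *: ey z.
Proof.
apply/colP => i; rewrite summxE /ey -colE !mxE enum_rankK.
rewrite (bigD1 (enum_val i)) //= big1 ?addr0 => [|z zi]; rewrite !mxE eqxx andbT.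
  by rewrite enum_valK eqxx mulr1.
by rewrite -(inj_eq enum_val_inj) enum_rankK eq_sym (negbTE zi) mulr0.
Qed.

Lemma emb_ey s p A y : emb s p A *m ey y =
  (-1) ^+ (p && odd (cnt s y)) *:
    \sum_(o : bool) A (bidx o) (bidx (y s)) *: ey (upd y s o).
Proof.
rewrite embE fmx_ey (@sum_off _ _ y s) => [|z nz]; last first.
  by rewrite /embf (negbTE nz) mulr0 scale0r.
rewrite scaler_sumr; apply: eq_bigr => o _.
by rewrite /embf upd_s (off_sym (upd y s o)) off_upd off_refl mulr1 scalerA.
Qed.

Lemma gg_ey s y : gg s *m ey y =
  if y s then 0 else (-1) ^+ odd (cnt s y) *: ey (upd y s true).
Proof.
rewrite emb_ey sum_bool !E10E scale0r addr0 /=.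
by case: (y s); rewrite ?scale0r ?scaler0 ?scale1r.
Qed.

Lemma nn_ey s y : nn s *m ey y = (y s)%:R *: ey y.
Proof.
rewrite emb_ey sum_bool !E11E /= expr0 scale1r scale0r addr0.
case ys: (y s); rewrite ?scale0r //.
by congr (_ *: ey _); apply/ffunP => t; rewrite ffunE; case: eqP => // ->.
Qed.

Lemma vac_ey : (vac k)^T = ey [ffun=> false].
Proof. by rewrite /vac trmx_delta. Qed.

Lemma ff_vac s : ff s *m (vac k)^T = 0.
Proof.
rewrite vac_ey emb_ey sum_bool !E01E ffunE !andbF !scale0r.
by rewrite addr0 scaler0.
Qed.

End BitVectors.

Section Transfer.
Variables (k : nat) (lam : 'I_k -> CC * CC) (b : 'I_k -> CC) (q1 q2 : CC).
Local Notation N := (Ndim k).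
Implicit Types (x u : CC).
Local Notation tA m x := (tm lam b m false false x).
Local Notation tC m x := (tm lam b m true false x).
Local Notation tD m x := (tm lam b m true true x).
Local Notation F := (Fpol lam b q1 q2).
Local Notation E := (Em lam b k).
Local Notation G := (Gm lam b k).

Lemma phm_pol x : phm lam b k x = (phi_pol lam b).[x].
Proof.
rewrite horner_prod; apply: eq_bigr => s _; rewrite hornerXsubC /al on_siteE /alp.
by rewrite opprB.
Qed.

Lemma psm_pol x : psm lam b k x = (psi_pol lam b).[x].
Proof.
rewrite horner_prod; apply: eq_bigr => s _; rewrite hornerXsubC /be on_siteE /bet.
by rewrite [b s + _]addrC.
Qed.

Lemma FpolE x : F.[x] = q1 * phm lam b k x - q2 * psm lam b k x.
Proof. by rewrite /Fpol hornerD hornerN !hornerZ phm_pol psm_pol. Qed.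

Definition tQ x := q1 *: tA k x - q2 *: tD k x.

Lemma E_anti u u' : E u *m E u' = - (E u' *m E u).
Proof. exact: gsum_anti. Qed.

Lemma E_sq u : E u *m E u = 0.
Proof.
have /eqP := E_anti u u; rewrite -addr_eq0 -mulr2n -scaler_nat scaler_eq0.
by rewrite pnatr_eq0 => /eqP.
Qed.

Lemma G_E x u : (x - u) *: (G x *m E u) =
  (phm lam b k x * psm lam b k u - psm lam b k x * phm lam b k u)%:M - (x - u) *: (E u *m G x).
Proof. by rewrite fsum_gsum scalerBr scale_scalar_mx pairing. Qed.

Section AtPoint.
Variable x : CC.
Hypothesis xal : forall s, x + alp lam b s != 0.

Lemma tQ_exchange u : ((x - u) * F.[x]) *: (tQ x *m E u) =
  (((x - u - 1) * F.[x]) *: E u + F.[u] *: E x) *m tQ x.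
Proof.
have [hb hc hd hg hE] := monodromy xal (leqnn k).
rewrite !FpolE; apply: (transfer_exchange (phm_neq0 xal (leqnn k)) hc hd (E_sq x) (E_anti u x) (G_E x u) (hE u)).
by [].
Qed.

Lemma G_vac m : Gm lam b m x *m (vac k)^T = 0.
Proof.
by rewrite /Gm /fsum mulmx_suml big1 // => t _; rewrite -scalemxAl ff_vac scaler0.
Qed.

Lemma tA_vac m : (m <= k)%N -> tA m x *m (vac k)^T = phm lam b m x *: (vac k)^T.
Proof.
elim: m => [|m IH] hm; first by rewrite tm0 /phm big_ord0 scale1r mul1mx.
pose s := Ordinal hm.
have [hb hc hd hg hE] := monodromy xal (ltnW hm).
have ph0 := phm_neq0 xal (ltnW hm).
have c0 : tC m x *m gg s *m (vac k)^T = 0.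
  apply: (scalerI ph0); rewrite scaler0 !scalemxAl hc -[tA m x *m _ *m gg s]mulmxA.
  have -> : Gm lam b m x *m gg s = - (gg s *m Gm lam b m x).
    rewrite (gsum_delta s) fsum_gsum big1 ?raddf0 ?sub0r // => t' _.
    by case: eqP => [->|_]; rewrite ?mulr0 // eG_big ?mul0r.
  rewrite -mulmxA mulNmx -[gg s *m _ *m _]mulmxA G_vac.
  by rewrite !mulmx0 oppr0 mulmx0.
rewrite (tmS lam b hm) sum_bool (L11E _ _ s x) (L12E _ _ s x) mulmxN mulmxDl mulNmx c0 oppr0 add0r.
rewrite -[_ *m _ *m (vac k)^T]mulmxA mulmxBl -mulmxA ff_vac mulmx0 subr0 mul_scalar_mx.
rewrite -scalemxAr IH ?(ltnW hm) // scalerA phmS mulrC.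
by rewrite /al -[m in on_site _ _ m]/(val s) on_siteE.
Qed.

Lemma tQ_vac : tQ x *m (vac k)^T = F.[x] *: (vac k)^T.
Proof.
have [hb hc hd hg hE] := monodromy xal (leqnn k).
have ph0 := phm_neq0 xal (leqnn k).
have c0 : tC k x *m (vac k)^T = 0.
  by apply: (scalerI ph0); rewrite scaler0 scalemxAl hc -mulmxA G_vac mulmx0.
have a0 := tA_vac (leqnn k).
have d0 : tD k x *m (vac k)^T = psm lam b k x *: (vac k)^T.
  apply: (scalerI ph0); rewrite scalemxAl hd mulmxDl -mulmxA c0 mulmx0 addr0 -scalemxAl a0.
  by rewrite !scalerA mulrC.
by rewrite /tQ mulmxBl -!scalemxAl a0 d0 !scalerA -scalerBl FpolE.
Qed.

End AtPoint.

End Transfer.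

End TransferMatrix.
Import TransferMatrix.

(** * The Berezinian *)

Section SerInverse.
Variable R : pzRingType.
Implicit Types (A B C S : ser R).

Lemma ser_mulBl A B C : ser_mul (fun n => A n - B n) C = fun n => ser_mul A C n - ser_mul B C n.
Proof.
by apply: serP => n; rewrite /ser_mul -sumrB; apply: eq_bigr => i _; rewrite mulrBl.
Qed.

Lemma ser_mulBr A B C : ser_mul C (fun n => A n - B n) = fun n => ser_mul C A n - ser_mul C B n.
Proof.
by apply: serP => n; rewrite /ser_mul -sumrB; apply: eq_bigr => i _; rewrite mulrBr.
Qed.

Lemma ser_mulDr A B C : ser_mul C (fun n => A n + B n) = fun n => ser_mul C A n + ser_mul C B n.
Proof.
by apply: serP => n; rewrite /ser_mul -big_split; apply: eq_bigr => i _; rewrite mulrDr.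
Qed.

Section One.
Variable S : ser R.
Hypothesis S0 : S 0%N = 1.
Let D : ser R := fun j => ser1 R j - S j.
Let pw m : ser R := iter m (ser_mul D) (ser1 R).

Let pwSr m : pw m.+1 = ser_mul (pw m) D.
Proof.
elim: m => [|m IH]; first by rewrite /pw /= ser_muls1 ser_mul1s.
by rewrite /pw iterS -/(pw m.+1) {1}IH ser_mulA.
Qed.

Let pw_small m n : (n < m)%N -> pw m n = 0.
Proof.
elim: m n => [|m IH] n //; rewrite ltnS => hn; rewrite /pw iterS -/(pw m) /ser_mul.
rewrite big_ord_recl /= {1}/D S0 subrr mul0r add0r big1 // => i _.
by rewrite IH ?mulr0 // /bump /=; have := ltn_ord i; lia.
Qed.

Let SD : S = fun n => ser1 R n - D n.
Proof. by apply: serP => n; rewrite /D subKr. Qed.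

Let inv_pw M n : (n < M)%N -> ser_inv S n = \sum_(m < M) pw m n.
Proof.
move=> nM; rewrite /ser_inv (big_ord_widen M (fun m => pw m n)) // big_mkcond /=.
by apply: eq_bigr => m _; case: ltnP => // h; rewrite pw_small.
Qed.

Let tele n : \sum_(m < n.+1) (pw m n - pw m.+1 n) = ser1 R n.
Proof.
rewrite sumrB big_ord_recl [X in _ - X]big_ord_recr.
rewrite [X in _ - (_ + X)](pw_small (ltnSn n)) addr0; exact: addrK.
Qed.

(** A telescoping geometric series: [1 - S] has no constant term, so each coefficient receives
    finitely many powers. *)
Lemma ser_mulrV : ser_mul S (ser_inv S) = ser1 R.
Proof.
apply: serP => n; rewrite -[RHS]tele.
transitivity (\sum_(m < n.+1) ser_mul S (pw m) n).
  rewrite [RHS]exchange_big; apply: eq_bigr => i _; rewrite -mulr_sumr.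
  by rewrite -inv_pw // ltnS leq_subr.
apply: eq_bigr => m _; by rewrite {1}SD ser_mulBl ser_mul1s.
Qed.

Lemma ser_mulVr : ser_mul (ser_inv S) S = ser1 R.
Proof.
apply: serP => n; rewrite -[RHS]tele.
transitivity (\sum_(m < n.+1) ser_mul (pw m) S n).
  rewrite [RHS]exchange_big; apply: eq_bigr => i _; rewrite -mulr_suml.
  by rewrite -inv_pw // ltnS.
apply: eq_bigr => m _; by rewrite {1}SD ser_mulBr ser_muls1 pwSr.
Qed.

Lemma ser_mulI A B : ser_mul S A = ser_mul S B -> A = B.
Proof. by move=> e; rewrite -[A]ser_mul1s -ser_mulVr -ser_mulA e ser_mulA ser_mulVr ser_mul1s. Qed.

End One.

End SerInverse.

Section EvalSeries.
Variable N : nat.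
Implicit Types (A B : ser 'M[CC]_N).

Lemma ev_inj e (bad : seq CC) A B : deg_le e A -> deg_le e B ->
  (forall x, x \notin bad -> ev e A x = ev e B x) -> A = B.
Proof.
move=> dA dB h; apply: serP => r; case: (ltnP e r) => hr; first by rewrite dA // dB.
suff h0 : forall i, (i < e.+1)%N -> A (e - i)%N - B (e - i)%N = 0.
  have /eqP := h0 (e - r)%N (leq_ltn_trans (leq_subr _ _) (ltnSn e)).
  by rewrite subKn // subr_eq0 => /eqP.
apply: (@coef_eq0 _ _ _ bad) => x xb; have := h x xb; rewrite /ev => /eqP.
rewrite -subr_eq0 -sumrB (reindex_inj rev_ord_inj) /= => /eqP e0; rewrite -[RHS]e0.
by apply: eq_bigr => i _; rewrite scalerBr subSS subKn ?leq_ord.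
Qed.

Lemma ev_rev e (p : {poly CC}) x : (size p <= e.+1)%N ->
  \sum_(r < e.+1) x ^+ (e - r) * rev_ser e p r = p.[x].
Proof.
move=> sp; rewrite (horner_coef_wide _ sp) [RHS](reindex_inj rev_ord_inj) /=.
apply: eq_bigr => i _; rewrite /rev_ser subSS.
by rewrite leq_ord mulrC.
Qed.

Lemma ev_sc e (p : {poly CC}) x : (size p <= e.+1)%N -> ev e (sc N (rev_ser e p)) x = p.[x]%:M.
Proof.
move=> sp; rewrite -(ev_rev x sp) raddf_sum; apply: eq_bigr => r _ /=.
by rewrite scale_scalar_mx.
Qed.

Lemma rev_deg e p : deg_le e (sc N (rev_ser e p)).
Proof. by move=> r hr; rewrite /sc /rev_ser leqNgt hr raddf0. Qed.

Lemma ev_lin e a a' A B x : ev e (fun r => a *: A r + a' *: B r) x = a *: ev e A x + a' *: ev e B x.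
Proof.
rewrite /ev !scaler_sumr -big_split; apply: eq_bigr => r _ /=.
by rewrite scalerDr !scalerA ![x ^+ _ * _]mulrC.
Qed.

End EvalSeries.

Section BerScalar.
Variables (k : nat) (lam : 'I_k -> CC * CC) (b : 'I_k -> CC).
Local Notation N := (Ndim k).
Implicit Types (x u : CC) (t : 'I_k).
Local Notation E := (Em lam b k).
Local Notation al := (al lam b).
Local Notation be := (be lam b).
Local Notation "A ** B" := (ser_mul A B) (at level 40, left associativity).

Definition psp m : {poly CC} := \prod_(s < m) ('X - (be s)%:P).

Fixpoint pE m t : {poly CC} := if m is m'.+1 then
  ('X + (al m')%:P) * pE m' t - (t == m' :> nat)%:R *: psp m' else 0.

Lemma size_psp m : size (psp m) = m.+1.
Proof. by rewrite size_prod_XsubC -[index_enum _]enumT size_enum_ord. Qed.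

Lemma size_pE m t : (size (pE m t) <= m)%N.
Proof.
elim: m => [|m IH] /=; first by rewrite size_poly0.
apply: (leq_trans (size_polyD _ _)); rewrite size_polyN geq_max; apply/andP; split.
  apply: (leq_trans (size_polyMleq _ _)).
  by rewrite -[al m]opprK polyCN size_XsubC.
by apply: (leq_trans (size_scale_leq _ _)); rewrite size_psp.
Qed.

Lemma psp_val m x : (psp m).[x] = psm lam b m x.
Proof. by rewrite horner_prod; apply: eq_bigr => s _; rewrite hornerXsubC. Qed.

Lemma pE_val m t x : (pE m t).[x] = eE lam b m x t.
Proof.
elim: m => [|m IH] /=; first by rewrite horner0.
rewrite hornerD hornerN hornerM hornerZ hornerD hornerX hornerC IH psp_val.
by rewrite mulrC [_%:R * _]mulrC mulrC.
Qed.

Definition Eser : ser 'M[CC]_N := fun r => gsum (fun t => rev_ser k (pE k t) r).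

Lemma Eser_deg : deg_le k Eser.
Proof.
move=> r hr; rewrite /Eser /gsum big1 // => t _.
by rewrite /rev_ser leqNgt hr scale0r.
Qed.

Lemma Eser_ev x : ev k Eser x = E x.
Proof.
rewrite /ev /Eser /gsum; under eq_bigr do rewrite scaler_sumr.
rewrite exchange_big /=; apply: eq_bigr => t _.
rewrite -pE_val -(@ev_rev k (pE k t)); last exact: leq_trans (size_pE k t) _.
by rewrite scaler_suml; apply: eq_bigr => r _; rewrite scalerA.
Qed.

Local Notation sphi := (sc N (rev_ser k (phi_pol lam b))).
Local Notation spsi := (sc N (rev_ser k (psi_pol lam b))).
Local Notation sP := (sc N (rev_ser k (Ppol b))).
Local Notation T := (Tcoef lam b).
Local Notation Num := (NumT lam b).
Definition bad_phi : seq CC := [seq - alp lam b s | s <- enum 'I_k].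

Lemma good_phi x : x \notin bad_phi -> forall s, x + alp lam b s != 0.
Proof.
move=> xb s; apply: contra xb; rewrite addr_eq0 => /eqP ->.
by apply: map_f; rewrite mem_enum.
Qed.

Lemma size_phi : size (phi_pol lam b) = k.+1.
Proof. by rewrite size_prod_XsubC -[index_enum _]enumT size_enum_ord. Qed.
Lemma size_psi : size (psi_pol lam b) = k.+1.
Proof. by rewrite size_prod_XsubC -[index_enum _]enumT size_enum_ord. Qed.
Lemma size_P : size (Ppol b) = k.+1.
Proof. by rewrite size_prod_XsubC -[index_enum _]enumT size_enum_ord. Qed.

Lemma Num12 : sphi ** Num false true = Eser ** Num false false.
Proof.
apply: (@ev_inj _ (k + k) bad_phi); try by apply: deg_le_mul; [apply: rev_deg || apply: Eser_deg | apply: Num_deg].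
move=> x xb; have [hb _ _ _ _] := monodromy (good_phi xb) (leqnn k).
rewrite !ev_mul; try by [apply: rev_deg | apply: Eser_deg | apply: Num_deg].
rewrite ev_sc ?size_phi // Eser_ev mul_scalar_mx -phm_pol; exact: hb.
Qed.

Lemma Num22 : sphi ** Num true true = fun n => (spsi ** Num false false) n + (Eser ** Num true false) n.
Proof.
apply: (@ev_inj _ (k + k) bad_phi).
- by apply: deg_le_mul; [apply: rev_deg | apply: Num_deg].
- move=> r hr; rewrite !(deg_le_mul _ _ hr) ?addr0 //; try by [apply: rev_deg | apply: Eser_deg | apply: Num_deg].
move=> x xb; have [_ _ hd _ _] := monodromy (good_phi xb) (leqnn k).
have := ev_lin (k + k) 1 1 (spsi ** Num false false) (Eser ** Num true false) x.
rewrite !scale1r => e.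
transitivity (ev (k + k) (spsi ** Num false false) x + ev (k + k) (Eser ** Num true false) x); last first.
  by rewrite -e /ev; apply: eq_bigr => r _; rewrite !scale1r.
rewrite !ev_mul; try by [apply: rev_deg | apply: Eser_deg | apply: Num_deg].
rewrite !ev_sc ?size_phi ?size_psi // Eser_ev !mul_scalar_mx -phm_pol -psm_pol; exact: hd.
Qed.

Lemma rev_monic0 (p : {poly CC}) : p \is monic -> size p = k.+1 -> sc N (rev_ser k p) 0 = 1.
Proof.
move=> /monicP mp sp; rewrite /sc /rev_ser /= subn0.
by have := lead_coefE p; rewrite mp sp /= => <-.
Qed.

Lemma phi_monic : phi_pol lam b \is monic. Proof. exact: monic_prod_XsubC. Qed.
Lemma psi_monic : psi_pol lam b \is monic. Proof. exact: monic_prod_XsubC. Qed.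
Lemma P_monic : Ppol b \is monic. Proof. exact: monic_prod_XsubC. Qed.

Lemma T12_E : sphi ** T false true = Eser ** T false false.
Proof.
apply: (@ser_mulI _ sP); first exact: rev_monic0 P_monic size_P.
rewrite !ser_mulA ![sP ** _]sc_comm -!ser_mulA -!NumE; exact: Num12.
Qed.

Lemma T22_E : sphi ** T true true = fun n => (spsi ** T false false) n + (Eser ** T true false) n.
Proof.
apply: (@ser_mulI _ sP); first exact: rev_monic0 P_monic size_P.
rewrite ser_mulDr !ser_mulA ![sP ** _]sc_comm -!ser_mulA -!NumE; exact: Num22.
Qed.

(** The Gauss relations give [phi (T_22 - T_12 T_11^-1 T_21) = psi T_11], so the Berezinian is
    [q1 phi / (q2 psi)]. *)
Lemma BerQ_scalar q1 q2 : exists c : nat -> CC, forall r, BerQ lam b q1 q2 r = (c r)%:M.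
Proof.
pose X : ser 'M[CC]_N := fun n => Tser lam b true true n -
  ser_mul (ser_mul (Tser lam b false true) (ser_inv (Tser lam b false false))) (Tser lam b true false) n.
have T0 i j : T i j 0%N = (i == j)%:R%:M by exact: Tcoef0.
have X0 : X 0%N = 1.
  by rewrite /X /Tser /ser_mul !big_ord1 !T0 /= raddf0 !mul0r subr0.
have T110 : T false false 0%N = 1 by rewrite T0.
have hX : sphi ** X = spsi ** T false false.
  rewrite /X ser_mulBr /Tser T22_E !ser_mulA T12_E.
  rewrite -[Eser ** _ ** ser_inv _]ser_mulA (ser_mulrV T110) ser_muls1.
  by apply: serP => n; rewrite addrK.
have psi0 := rev_monic0 psi_monic size_psi.
pose w := ser_mul (ser_inv (rev_ser k (psi_pol lam b))) (rev_ser k (phi_pol lam b)).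
exists (fun r => (q1 / q2) * w r) => r; rewrite /BerQ -/X.
suff -> : Tser lam b false false ** ser_inv X = sc N w by rewrite scale_scalar_mx.
apply: (ser_mulI psi0); rewrite ser_mulA /Tser -hX -ser_mulA (ser_mulrV X0) ser_muls1.
rewrite scM /w ser_mulA ser_mulrV ?ser_mul1s //.
rewrite /rev_ser /= subn0; have := lead_coefE (psi_pol lam b).
by rewrite (monicP psi_monic) size_psi.
Qed.

End BerScalar.

(** * Cyclicity of the vacuum *)

Module CyclicVacuum.

Section NewtonExpansion.
Variables (F : numFieldType) (r : nat -> F).
Local Notation newt := (@newt F r).

Lemma newt_monic' s : newt s \is monic.
Proof. exact: monic_prod_XsubC. Qed.

Lemma size_newt' s : size (newt s) = s.+1.
Proof. by rewrite size_prod_XsubC -[index_enum _]enumT size_enum_ord. Qed.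

Lemma newt_top i n : (i <= n)%N -> (newt i)`_n = (i == n)%:R.
Proof.
have [->|ne] := eqVneq i n => h.
  by have := lead_coefE (newt n); rewrite (monicP (newt_monic' n)) size_newt'.
by rewrite nth_default // size_newt' ltn_neqAle ne.
Qed.

Lemma newt_expand n (p : {poly F}) : (size p <= n)%N ->
  exists c : nat -> F, p = \sum_(j < n) c j *: newt j.
Proof.
elim: n p => [|n IH] p hp.
  by exists (fun=> 0); rewrite big_ord0; apply/eqP; rewrite -size_poly_eq0 -leqn0.
have [|c hc] := IH (p - p`_n *: newt n).
  apply/leq_sizeP => j; rewrite leq_eqVlt coefB coefZ => /orP[/eqP <-|hj].
    by rewrite newt_top // eqxx mulr1 subrr.
  rewrite [p`_j]nth_default ?(leq_trans hp) // [(newt n)`_j]nth_default ?size_newt' //.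
  by rewrite mulr0 subr0.
exists (fun j => if (j < n)%N then c j else p`_n).
rewrite big_ord_recr /= ltnn -[LHS](subrK (p`_n *: newt n)) hc; congr (_ + _).
by apply: eq_bigr => j _; rewrite ltn_ord.
Qed.

Variable V : lmodType F.

(** Extraction of Newton coefficients from values: the highest one is an ordinary leading
    coefficient, and subtracting its term lowers the degree. *)
Lemma newt_closed (P : V -> Prop) (n : nat) (bad : seq F) (Z : nat -> V) :
  P 0 -> (forall c u v, P u -> P v -> P (c *: u + v)) ->
  (forall x, x \notin bad -> P (\sum_(i < n) (newt i).[x] *: Z i)) ->
  forall i, (i < n)%N -> P (Z i).
Proof.
move=> P0 Pl; elim: n => [|n IH] h i //.
pose M c := \sum_(i < n.+1) (newt i)`_c *: Z i.
have PZn : P (Z n).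
  have -> : Z n = M n.
    rewrite /M big_ord_recr /= newt_top // eqxx scale1r big1 ?add0r // => j _.
    by rewrite newt_top ?(ltnW (ltn_ord j)) // ltn_eqF // scale0r.
  apply: (@coef_closed _ _ P n.+1 bad M) => // x xb.
  suff -> : \sum_(i0 < n.+1) x ^+ i0 *: M i0 = \sum_(i0 < n.+1) (newt i0).[x] *: Z i0 by exact: h.
  rewrite /M; under eq_bigr do rewrite scaler_sumr.
  rewrite exchange_big; apply: eq_bigr => j _ /=.
  rewrite (@horner_coef_wide _ n.+1) ?size_newt' ?ltn_ord // scaler_suml.
  by apply: eq_bigr => c _; rewrite scalerA mulrC.
rewrite ltnS leq_eqVlt => /orP[/eqP -> //|]; apply: IH => x xb.
have := h x xb; rewrite big_ord_recr /= => hx.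
have := Pl (- (newt n).[x]) _ _ PZn hx.
by rewrite scaleNr addrCA addNr addr0.
Qed.

End NewtonExpansion.

Section Cyclic.
Variables (k : nat) (lam : 'I_k -> CC * CC) (b : 'I_k -> CC) (r : nat -> CC).
Local Notation N := (Ndim k).
Implicit Types (x u : CC) (t s : 'I_k).
Local Notation E := (Em lam b k).
Local Notation newt := (@newt CC r).
Local Notation tA m x := (tm lam b m false false x).
Variable Ch : 'M[CC]_k.
Hypothesis hCh : forall t, pE lam b k t = \sum_(j < k) Ch j t *: newt j.

Definition Eh (j : 'I_k) : 'M[CC]_N := gsum (fun t => Ch j t).

Lemma E_newt u : E u = \sum_(j < k) (newt j).[u] *: Eh j.
Proof.
rewrite /Eh /gsum; under eq_bigr do rewrite scaler_sumr.
rewrite exchange_big; apply: eq_bigr => t _ /=.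
rewrite -pE_val hCh horner_sum scaler_suml; apply: eq_bigr => j _.
by rewrite hornerZ scalerA mulrC.
Qed.

Lemma Eh_anti i j : Eh i *m Eh j = - (Eh j *m Eh i).
Proof. exact: gsum_anti. Qed.

Lemma Eh_sq i : Eh i *m Eh i = 0.
Proof.
have /eqP := Eh_anti i i; rewrite -addr_eq0 -mulr2n -scaler_nat scaler_eq0.
by rewrite pnatr_eq0 => /eqP.
Qed.

Definition Bn : nat -> 'M[CC]_N := on_site (fun j => (Eh j)^T) 0.

Lemma BnE (j : 'I_k) : Bn j = (Eh j)^T.
Proof. by rewrite /Bn on_siteE. Qed.

(** The span of the products of distinct [Eh i] with [i < j] applied to the vacuum, as a filtration
    along which stability is proved one operator at a time. *)
Fixpoint Uj j : 'M[CC]_N := if j is j'.+1 then (Uj j' + Uj j' *m Bn j')%MS else <<vac k>>%MS.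

Lemma Uj_B (i : 'I_k) j : (i < j)%N -> (j <= k)%N -> (Uj j *m Bn i <= Uj j)%MS.
Proof.
elim: j => [|j IH] // hij hj; rewrite /= addsmxMr addsmx_sub.
pose jo := Ordinal hj; have ej : Bn j = (Eh jo)^T by rewrite -BnE.
have [hlt|hge] := ltnP i j.
  apply/andP; split.
    by apply: submx_trans (addsmxSl _ _); apply: IH => //; apply: ltnW.
  rewrite -mulmxA BnE ej -trmx_mul Eh_anti raddfN /= mulmxN eqmx_opp trmx_mul mulmxA -!BnE.
  by apply: submx_trans (addsmxSr _ _); apply: submxMr; apply: IH => //; apply: ltnW.
have eij : i = j :> nat by apply/eqP; rewrite eqn_leq hge andbT -ltnS.
rewrite eij addsmxSr /= -mulmxA ej -trmx_mul Eh_sq trmx0 mulmx0.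
exact: sub0mx.
Qed.

Local Notation U := (Uj k).
Definition stab (M : 'M[CC]_N) : Prop := (U *m M^T <= U)%MS.

Lemma stab0 : stab 0.
Proof. by rewrite /stab trmx0 mulmx0 sub0mx. Qed.

Lemma stab_lin c M M' : stab M -> stab M' -> stab (c *: M + M').
Proof.
move=> h h'; rewrite /stab linearP /= mulmxDr -scalemxAr.
by apply: addmx_sub => //; apply: scalemx_sub.
Qed.

Lemma stabD M M' : stab M -> stab M' -> stab (M + M').
Proof. by move=> h h'; rewrite -[M]scale1r; apply: stab_lin. Qed.

Lemma stabZ c M : stab M -> stab (c *: M).
Proof. by move=> h; rewrite -[_ *: _]addr0; apply: stab_lin => //; apply: stab0. Qed.

Lemma stabM M M' : stab M -> stab M' -> stab (M *m M').
Proof.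
by move=> h h'; rewrite /stab trmx_mul mulmxA; apply: submx_trans h; apply: submxMr.
Qed.

Lemma stab_sum (I : finType) (P : pred I) (f : I -> 'M[CC]_N) :
  (forall i, P i -> stab (f i)) -> stab (\sum_(i | P i) f i).
Proof. by move=> h; elim/big_ind: _ => //; [apply: stab0 | apply: stabD]. Qed.

Lemma stab_Eh i : stab (Eh i).
Proof. by rewrite /stab -BnE; apply: Uj_B. Qed.

Lemma stab_E u : stab (E u).
Proof. by rewrite E_newt; apply: stab_sum => i _; apply: stabZ; apply: stab_Eh. Qed.

Lemma stab_ind (M : 'M[CC]_N) : ((vac k) *m M^T <= U)%MS ->
  (forall (j : 'I_k), (Uj j *m M^T <= U)%MS -> (Uj j *m (M *m Eh j)^T <= U)%MS) -> stab M.
Proof.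
move=> h0 hS; suff h j : (j <= k)%N -> (Uj j *m M^T <= U)%MS by exact: h.
elim: j => [|j IH] hj /=.
  by rewrite (eqmxMr _ (genmxE _)).
have h := IH (ltnW hj); rewrite addsmxMr addsmx_sub h /=.
by have := hS (Ordinal hj) h; rewrite trmx_mul mulmxA -BnE.
Qed.

Lemma vac_Uj j : (vac k <= Uj j)%MS.
Proof.
elim: j => [|j IH] /=; first by rewrite genmxE.
exact: submx_trans IH (addsmxSl _ _).
Qed.

Lemma stab_G x : stab (Gm lam b k x).
Proof.
apply: stab_ind.
  by rewrite -[vac k]trmxK -trmx_mul G_vac trmx0 sub0mx.
move=> j h; rewrite fsum_gsum linearB /= tr_scalar_mx mulmxBr mul_mx_scalar trmx_mul mulmxA.
have hj : (Uj j <= U)%MS.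
  have le i : (Uj j <= Uj (j + i))%MS.
    elim: i => [|i IH]; first by rewrite addn0.
    by rewrite addnS; apply: submx_trans IH (addsmxSl _ _).
  by have := le (k - j)%N; rewrite subnKC // ltnW.
rewrite addmx_sub ?scalemx_sub // eqmx_opp.
by apply: submx_trans (stab_Eh j); apply: submxMr.
Qed.

(** The exchange relation moves [tA k x] past [E(u)] at the price of dividing by [x - u];
    [newt_closed] recovers each [Eh j] from the values with [u] different from [x]. *)
Lemma stab_A x : (forall s, x + alp lam b s != 0) -> stab (tA k x).
Proof.
move=> xal; have ph0 := phm_neq0 xal (leqnn k); have [_ _ _ _ hE] := monodromy xal (leqnn k).
apply: stab_ind.
  rewrite -[vac k]trmxK -trmx_mul tA_vac // linearZ /= trmxK.
  by apply: scalemx_sub; apply: vac_Uj.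
move=> j h; pose P (M : 'M[CC]_N) := (Uj j *m (tA k x *m M)^T <= U)%MS.
have P0 : P 0 by rewrite /P mulmx0 trmx0 mulmx0 sub0mx.
have Pl c M M' : P M -> P M' -> P (c *: M + M').
  move=> hM hM'; rewrite /P mulmxDr -scalemxAr linearP /= mulmxDr -scalemxAr.
  by apply: addmx_sub => //; apply: scalemx_sub.
have := @newt_closed _ r _ P k [:: x] (on_site Eh 0) P0 Pl.
move=> H; have := H _ j (ltn_ord j); rewrite on_siteE; apply=> u; rewrite inE => ux.
have -> : \sum_(i < k) (newt i).[u] *: on_site Eh 0 i = E u.
  by rewrite E_newt; apply: eq_bigr => i _; rewrite on_siteE.
have c0 : (x - u) * phm lam b k x != 0 by rewrite mulf_neq0 // subr_eq0 eq_sym.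
rewrite /P -[tA k x *m E u](scalerK c0) hE !linearZ /=.
apply: scalemx_sub; rewrite trmx_mul mulmxA.
have hst : stab (((x - u - 1) * phm lam b k x) *: E u + phm lam b k u *: E x).
  by apply: stabD; apply: stabZ; apply: stab_E.
by apply: submx_trans hst; apply: submxMr.
Qed.

Lemma stab_tm x i j : (forall s, x + alp lam b s != 0) -> stab (tm lam b k i j x).
Proof.
move=> xal; have ph0 := phm_neq0 xal (leqnn k); have [hb hc hd _ _] := monodromy xal (leqnn k).
have sA := stab_A xal.
have div M : stab (phm lam b k x *: M) -> stab M.
  by move=> h; rewrite -[M](scalerK ph0); apply: stabZ.
have sC : stab (tm lam b k true false x).
  by apply: div; rewrite hc; apply: stabM => //; apply: stab_G.
case: i; case: j => //; apply: div; rewrite ?hd ?hb.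
  by apply: stabD; [apply: stabZ | apply: stabM => //; apply: stab_E].
by apply: stabM => //; apply: stab_E.
Qed.

(** Values at good points give the coefficients of the numerators, and dividing by [Ppol] as a
    series gives those of the generators. *)
Lemma stab_T i j n : stab (Tcoef lam b i j n).
Proof.
have sN m : stab (NumT lam b i j m).
  case: (ltnP k m) => hm; first by rewrite Num_deg //; apply: stab0.
  suff h : forall c, (c < k.+1)%N -> stab (NumT lam b i j (k - c)%N).
    by have := h (k - m)%N; rewrite subKn //; apply; rewrite ltnS leq_subr.
  apply: (@coef_closed _ _ stab _ (bad_phi lam b)); [exact: stab0 | exact: stab_lin |].
  move=> x xb; have := stab_tm i j (good_phi xb); rewrite /tm /ev.
  rewrite (reindex_inj rev_ord_inj) /=; congr stab; apply: eq_bigr => c _.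
  by rewrite subSS subKn ?leq_ord.
have P0 : rev_ser k (Ppol b) 0%N = 1.
  by rewrite /rev_ser /= subn0; have := lead_coefE (Ppol b); rewrite (monicP (P_monic b)) size_P.
have -> : Tcoef lam b i j = ser_mul (sc N (ser_inv (rev_ser k (Ppol b)))) (NumT lam b i j).
  by rewrite NumE ser_mulA scM ser_mulVr // sc1 ser_mul1s.
rewrite /ser_mul; apply: stab_sum => c _; rewrite -mulmxE mul_scalar_mx.
exact: stabZ.
Qed.

Hypothesis cyc : cyclic_vac lam b.

(** A relation [chi] makes [fsum chi] anticommute with every [Eh j]. As it kills the vacuum, it
    kills the whole stable space [U], which is everything by cyclicity; pairing with [gg t] then
    gives [chi t = 0]. *)
Lemma Ch_ker (chi : 'I_k -> CC) : (forall j, \sum_t chi t * Ch j t = 0) -> forall t, chi t = 0.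
Proof.
move=> h; pose X : 'M[CC]_N := fsum chi.
have XE j : X *m Eh j = - (Eh j *m X) by rewrite fsum_gsum h raddf0 sub0r.
have UX j : (j <= k)%N -> Uj j *m X^T = 0.
  elim: j => [|j IH] hj /=.
    apply/eqP; rewrite -submx0 (eqmxMr _ (genmxE _)) -[vac k]trmxK -trmx_mul.
    rewrite /X /fsum mulmx_suml big1 ?trmx0 ?submx0 // => t _.
    by rewrite -scalemxAl ff_vac scaler0.
  apply/eqP; rewrite -submx0 addsmxMr addsmx_sub !submx0 IH ?(ltnW hj) // eqxx /=.
  rewrite -[j]/(val (Ordinal hj)) BnE -mulmxA -trmx_mul XE linearN /= mulmxN trmx_mul mulmxA.
  by rewrite (IH (ltnW hj)) mul0mx oppr0.
have Ufull : row_full U.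
  apply: cyc; first exact: vac_Uj.
  by move=> i j n _; apply: stab_T.
have X0 : X = 0.
  apply: trmx_inj; rewrite trmx0; have : (1%:M <= U)%MS by rewrite sub1mx.
  by case/submxP => D e; rewrite -[X^T]mul1mx e -mulmxA UX // mulmx0.
move=> t; have := fsum_gsum chi (fun t' => (t' == t)%:R); rewrite -/X X0 mul0mx mulmx0 subr0.
rewrite (bigD1 t) //= eqxx mulr1 big1 ?addr0 => [|t' /negbTE ->]; last by rewrite mulr0.
pose i0 : 'I_N := enum_rank [ffun=> false].
by move/matrixP/(_ i0 i0); rewrite !mxE eqxx mulr1n.
Qed.

Lemma Ch_unit : Ch \in unitmx.
Proof.
rewrite -unitmx_tr -row_free_unit; apply/row_freeP.
suff k0 : kermx Ch^T = 0.
  by apply/row_freeP; rewrite -kermx_eq0 k0.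
apply/row_matrixP => i; rewrite row0; apply/rowP => t.
have h : row i (kermx Ch^T) *m Ch^T = 0 by rewrite -row_mul mulmx_ker row0.
rewrite [RHS]mxE; apply: (@Ch_ker (fun t => row i (kermx Ch^T) 0 t)) => j.
have := congr1 (fun M : 'rV[CC]_k => M 0 j) h; rewrite mxE [RHS]mxE => e; rewrite -[RHS]e.
by apply: eq_bigr => t' _; rewrite !mxE.
Qed.

End Cyclic.

End CyclicVacuum.
Import CyclicVacuum.

(** * Spanning the weight subspace *)

Module WedgeVectors.

Section RingProducts.
Variable R : pzRingType.

Lemma prod_zero (I : finType) (f : I -> R) i : f i = 0 -> \prod_j f j = 0.
Proof.
move=> h; have hi : i \in index_enum I by rewrite mem_index_enum.
by case/splitPr: hi => p1 p2; rewrite big_cat big_cons /= h mul0r mulr0.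
Qed.

Lemma prod_swap_sign (p : seq R) (x y : R) :
  (forall z, z \in p -> exists e : bool, x * z = (-1) ^+ e * (z * x) /\ y * z = (-1) ^+ e * (z * y)) ->
  exists e : bool, x * \prod_(z <- p) z = (-1) ^+ e * (\prod_(z <- p) z * x) /\
                   y * \prod_(z <- p) z = (-1) ^+ e * (\prod_(z <- p) z * y).
Proof.
have comm (e : bool) (z : R) : z * (-1) ^+ e = (-1) ^+ e * z.
  by case: e; rewrite ?expr0 ?mulr1 ?mul1r // expr1 mulrN1 mulN1r.
elim: p => [|z p IH] h.
  by exists false; rewrite big_nil expr0 !mul1r !mulr1.
have [e1 [a1 b1]] := h z (mem_head _ _).
have [|e2 [a2 b2]] := IH; first by move=> w hw; apply: h; rewrite inE hw orbT.
exists (e1 (+) e2); rewrite big_cons signr_addb; split.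
  by rewrite mulrA a1 -!mulrA a2 !mulrA -[(-1) ^+ e1 * z * _]mulrA comm !mulrA.
by rewrite mulrA b1 -!mulrA b2 !mulrA -[(-1) ^+ e1 * z * _]mulrA comm !mulrA.
Qed.

(** Both factors pass each factor between them with the same sign, so those signs cancel and only
    the one of the exchange itself remains. *)
Lemma prod_tperm k (f : 'I_k -> R) (i j : 'I_k) : i != j ->
  (forall z, exists e : bool, f i * f z = (-1) ^+ e * (f z * f i) /\ f j * f z = (-1) ^+ e * (f z * f j)) ->
  f i * f j = - (f j * f i) ->
  \prod_z f (tperm i j z) = - \prod_z f z.
Proof.
move=> ij h a; have us : uniq (index_enum 'I_k) := index_enum_uniq _.
have hi : i \in index_enum 'I_k by rewrite mem_index_enum.
have hj : j \in index_enum 'I_k by rewrite mem_index_enum.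
wlog lij : i j ij h a hi hj / (index i (index_enum 'I_k) < index j (index_enum 'I_k))%N.
  move=> W; case: (ltngtP (index i (index_enum 'I_k)) (index j (index_enum 'I_k))) => [|lt|e].
  - exact: W.
  - rewrite tpermC; apply: W => //; first by rewrite eq_sym.
      by move=> z; have [e [h1 h2]] := h z; exists e.
    by rewrite a opprK.
  - by rewrite -(nth_index i hi) e nth_index // eqxx in ij.
move: us hj lij; case/splitPr: hi => p1 p2.
rewrite mem_cat inE eq_sym (negbTE ij) /= => us hj lij.
have jp1 : j \notin p1.
  apply: contraTN lij => jp1; rewrite -leqNgt !index_cat jp1.
  have -> : (i \in p1) = false.
    by apply/negbTE; move: us; rewrite cat_uniq /= negb_or => /and3P[_ /andP[]].
  by rewrite /= eqxx addn0 ltnW // index_mem.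
rewrite (negbTE jp1) /= in hj.
move: us {lij}; case/splitPr: hj => p3 p4 us.
have fixp (p : seq 'I_k) : i \notin p -> j \notin p -> \prod_(z <- p) f (tperm i j z) = \prod_(z <- p) f z.
  move=> ip jp; rewrite !big_seq; apply: eq_bigr => z zp.
  by rewrite tpermD //; [apply: contraNneq ip => -> | apply: contraNneq jp => ->].
have ip1 : i \notin p1 by move: us; rewrite cat_uniq /= negb_or => /and3P[_ /andP[]].
have [ip3 ip4] : i \notin p3 /\ i \notin p4.
  move: us; rewrite cat_uniq /= mem_cat inE !negb_or => /and3P[_ _ /andP[/and3P[h1 _ h2] _]].
  by [].
have [jp3 jp4] : j \notin p3 /\ j \notin p4.
  move: us; rewrite cat_uniq => /and3P[_ _ /= /andP[_]].
  by rewrite cat_uniq /= negb_or => /and3P[_ /andP[h1 _] /andP[h2 _]].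
rewrite !big_cat !big_cons !big_cat !big_cons /= tpermL tpermR !fixp //.
have [|e [h1 h2]] := @prod_swap_sign [seq f z | z <- p3] (f i) (f j).
  by move=> _ /mapP[z _ ->].
rewrite big_map in h1 h2.
rewrite -mulrN; congr (_ * _).
set P3 := \prod_(z <- p3) f z in h1 h2 *; set P4 := \prod_(z <- p4) f z.
rewrite [LHS]mulrA h2 [X in _ = - X]mulrA h1 -!mulrA [f j * (f i * _)]mulrA [f i * (f j * _)]mulrA a.
by rewrite mulNr !mulrN opprK.
Qed.

End RingProducts.

Section YVectors.
Variables (k l : nat) (Ch : 'M[CC]_k).
Hypothesis lk : (l <= k)%N.
Local Notation N := (Ndim k).
Local Notation side := (@side k l).
Local Notation rk := (@rk k l).
Local Notation FF := {ffun 'I_k -> 'I_k}.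
Local Notation Eh := (Eh Ch).

(* Only the [l] indices [J i] with [side i] matter; freezing the others at [rk i] makes [Y J]
   an alternating vector indexed like the [k x k] determinants [Theta (Jmx J)]. *)
Definition Mfac (i j : 'I_k) : 'M[CC]_N := if side i then (Eh j)^T else (j == rk i :> nat)%:R%:M.
Definition Y (J : FF) : 'rV[CC]_N := vac k *m (\prod_i Mfac i (J i) : 'M[CC]_N).

Lemma Yrk (J : FF) i : side i = false -> J i != rk i :> nat -> Y J = 0.
Proof.
move=> si ne; rewrite /Y (prod_zero (i := i)) ?mulmx0 //.
by rewrite /Mfac si (negbTE ne) raddf0.
Qed.

Lemma Eh_anti' i j : (Eh i)^T *m (Eh j)^T = - ((Eh j)^T *m (Eh i)^T).
Proof. by rewrite -!trmx_mul Eh_anti raddfN. Qed.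

Lemma Y_tperm (J : FF) i j : side i -> side j -> i != j -> Y [ffun z => J (tperm i j z)] = - Y J.
Proof.
move=> si sj ij; rewrite /Y -mulmxN; congr (_ *m _).
have hM z : Mfac z (J (tperm i j z)) = Mfac (tperm i j z) (J (tperm i j z)).
  rewrite /Mfac; case: tpermP => [->|->|] //; first by rewrite si sj.
  by rewrite si sj.
rewrite (eq_bigr (fun z => (fun z => Mfac z (J z)) (tperm i j z))); last first.
  by move=> z _; rewrite ffunE hM.
rewrite (@prod_tperm _ k (fun z => Mfac z (J z))) //; last first.
  by rewrite /Mfac si sj -!mulmxE Eh_anti'.
have Mt y : side y -> Mfac y (J y) = (Eh (J y))^T by move=> sy; rewrite /Mfac sy.
move=> z; rewrite /= (Mt i si) (Mt j sj); case sz: (side z).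
  by exists true; rewrite (Mt z sz) expr1 !mulN1r -!mulmxE; split; exact: Eh_anti'.
exists false; rewrite expr0 !mul1r -!mulmxE /Mfac sz; split; exact: scalar_mxC.
Qed.

(** Induction on the number of moved points: splitting off the transposition of [i] and [s i] leaves
    a permutation that fixes [i] and moves nothing new. *)
Lemma Yalt (J : FF) (s : 'S_k) : (forall i, side i = false -> s i = i) ->
  Y [ffun i => J (s i)] = (-1) ^+ s *: Y J.
Proof.
have [n] := ubnP #|[set i | s i != i]|; elim: n s J => // n IH s J; rewrite ltnS => hn hs.
have [->|] := eqVneq s 1%g.
  rewrite odd_perm1 expr0 scale1r; congr Y; apply/ffunP => i.
  by rewrite ffunE perm1.
move=> s1; have [i hi] : exists i, s i != i.
  apply/existsP; apply: contraNT s1; rewrite negb_exists => /forallP h.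
  by apply/eqP/permP => i; rewrite perm1; have := h i; rewrite negbK => /eqP.
have si : side i by apply: contraNT hi => /negbTE /hs ->.
have ssi : side (s i).
  by apply: contraNT hi => /negbTE /hs /perm_inj ->.
pose s' := (s * tperm i (s i))%g.
have es : s = (s' * tperm i (s i))%g by rewrite /s' -mulgA tperm2 mulg1.
have s'i : s' i = i by rewrite /s' permM tpermR.
have s'fix x : s x = x -> s' x = x.
  move=> sx; rewrite /s' permM sx tpermD //; first by apply: contraNneq hi => ->; rewrite sx.
  apply: contraNneq hi => e; rewrite -e in sx; have := sx => /perm_inj e'.
  by rewrite e'.
have -> : [ffun x => J (s x)] = [ffun x => [ffun z => J (tperm i (s i) z)] (s' x)] :> FF.
  by apply/ffunP => x; rewrite !ffunE {1}es permM.
rewrite IH //; last first.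
- by move=> x /hs; apply: s'fix.
- apply: leq_trans hn; apply: proper_card; apply/properP; split.
    by apply/subsetP => x; rewrite !inE; apply: contra => /eqP /s'fix ->.
  by exists i; rewrite !inE ?s'i ?eqxx.
rewrite Y_tperm 1?eq_sym // scalerN -scaleNr; congr (_ *: _).
by rewrite es odd_permM odd_tperm eq_sym hi signr_addb expr1 mulrN1.
Qed.

Lemma Yninj (J : FF) i j : side i -> side j -> i != j -> J i = J j -> Y J = 0.
Proof.
move=> si sj ij e; have := Y_tperm J si sj ij.
have -> : [ffun z => J (tperm i j z)] = J.
  by apply/ffunP => z; rewrite ffunE; case: tpermP => // ->.
move=> /eqP; rewrite -addr_eq0 -mulr2n -scaler_nat scaler_eq0.
by rewrite pnatr_eq0 => /eqP.
Qed.

End YVectors.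

End WedgeVectors.
Import WedgeVectors.

(** * The weight subspace as an eigenspace of the number operator *)

Module WeightSubspace.

Section WeightSpace.
Variables (k l : nat) (lam : 'I_k -> CC * CC) (b : 'I_k -> CC).
Hypothesis lk : (l <= k)%N.
Local Notation N := (Ndim k).
Local Notation Idx := (Idx k).
Implicit Types (y : Idx) (s t : 'I_k).

Definition wt y : nat := \sum_s (y s : nat).
Definition Nop : 'M[CC]_N := \sum_s nn s.

Lemma Nop_ey y : Nop *m ey y = (wt y)%:R *: ey y.
Proof.
rewrite /Nop mulmx_suml /wt natr_sum scaler_suml; apply: eq_bigr => s _.
exact: nn_ey.
Qed.

Lemma row_ey (v : 'rV[CC]_N) : v = \sum_y v 0 (enum_rank y) *: (ey y)^T.
Proof.
rewrite [LHS]row_sum_delta (reindex (@enum_rank Idx)) /=; last first.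
  by exists (@enum_val _ _) => z _; rewrite (enum_rankK, enum_valK).
by apply: eq_bigr => y _; rewrite /ey trmx_delta.
Qed.

Lemma Nop_row (v : 'rV[CC]_N) y : (v *m Nop^T) 0 (enum_rank y) = (wt y)%:R * v 0 (enum_rank y).
Proof.
rewrite [v in LHS]row_ey mulmx_suml summxE (bigD1 y) //= big1 ?addr0 => [|z zy].
  rewrite -scalemxAl -trmx_mul Nop_ey linearZ /= !mxE !eqxx mulr1 mulrC; by [].
rewrite -scalemxAl -trmx_mul Nop_ey linearZ /= !mxE (inj_eq enum_rank_inj) eq_sym (negbTE zy).
by rewrite !mulr0.
Qed.

Lemma T1_11 : Tcoef lam b false false 1 = (\sum_s (lam s).1)%:M - Nop.
Proof.
rewrite Tcoef1 raddf_sum -sumrB; apply: eq_bigr => s _ /=.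
rewrite expr0 mul1r expr0 scale1r.
have -> : gl11_act lam s false false = ((lam s).1)%:M - E11.
  apply: mx2P => o o'; rewrite !mxE -!val_eqE /= !bidx_eq1.
  by rewrite /bidx !inordK //; case: o; case: o'; rewrite /= ?mulr1n ?mulr0n ?subr0 ?sub0r ?oppr0.
by rewrite embD -[- E11]scaleN1r embZ emb_scal scaleN1r.
Qed.

Lemma T1_22 : - Tcoef lam b true true 1 = (\sum_s (lam s).2)%:M + Nop.
Proof.
rewrite Tcoef1 -sumrN [X in _ = X + _]raddf_sum -big_split; apply: eq_bigr => s _ /=.
rewrite expr1 expr0 mulr1 embZ scaleN1r opprK.
have -> : gl11_act lam s true true = ((lam s).2)%:M + E11.
  apply: mx2P => o o'; rewrite !mxE -!val_eqE /= !bidx_eq1.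
  by rewrite /bidx !inordK //; case: o; case: o'; rewrite /= ?mulr1n ?mulr0n ?addr0 ?add0r.
by rewrite embD emb_scal.
Qed.

(** Both weight conditions reduce to the same equation: the number operator takes the value [l]. *)
Lemma Wsp_sub m (v : 'M[CC]_(m, N)) : (v <= Wsp lam b l)%MS = (v *m Nop^T == l%:R *: v).
Proof.
have addl (c : CC) : v *m c%:M = c *: v by rewrite mul_mx_scalar.
have e1 (c : CC) : (c%:M - Nop)^T - (c - l%:R)%:M = l%:R%:M - Nop^T.
  rewrite [(_ - Nop)^T]linearB /= tr_scalar_mx (raddfB (@scalar_mx CC N)) /= opprB addrC addrA.
  by rewrite subrK.
have e2 (c : CC) : (c%:M + Nop)^T - (c + l%:R)%:M = Nop^T - l%:R%:M.
  rewrite [(_ + Nop)^T]linearD /= tr_scalar_mx (raddfD (@scalar_mx CC N)) /= opprD addrACA.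
  by rewrite subrr add0r.
rewrite /Wsp /wt_space sub_capmx T1_22 T1_11 e1 e2; apply/andP/eqP => [[/sub_kermxP h _]|h].
  by move: h; rewrite mulmxBr addl => /eqP; rewrite subr_eq0 => /eqP ->.
by split; apply/sub_kermxP; rewrite mulmxBr addl h subrr.
Qed.

Definition lbits : {set Idx} := [set y | wt y == l].

Lemma card_lbits : #|lbits| = 'C(k, l).
Proof.
rewrite -[k in RHS]card_ord -card_draws -[RHS](card_imset _ (f := fun A : {set 'I_k} => [ffun t => t \in A] : Idx)).
  apply: eq_card => y; rewrite inE; apply/eqP/imsetP => [h|[A]].
    exists [set t | y t]; last by apply/ffunP => t; rewrite ffunE inE.
    by rewrite inE -h /wt -sum1dep_card big_mkcond; apply/eqP/eq_bigr => s _; case: (y s).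
  rewrite inE => /eqP <- ->; rewrite /wt -sum1_card [RHS]big_mkcond.
  by apply: eq_bigr => s _; rewrite ffunE; case: (s \in A).
move=> A B /ffunP e; apply/setP => t; have := e t; by rewrite !ffunE.
Qed.

Definition Wbits : 'M[CC]_(#|lbits|, N) := \matrix_i (ey (enum_val i))^T.

Lemma row_Wbits i : row i Wbits = (ey (enum_val i))^T.
Proof. exact: rowK. Qed.

Lemma Wbits_free : row_free Wbits.
Proof.
apply/row_freeP; exists (\matrix_(x, i) ((enum_val x : Idx) == enum_val i)%:R).
apply/matrixP => i j; rewrite mxE (bigD1 (enum_rank (enum_val i))) //= big1 ?addr0 => [|x xi].
  by rewrite !mxE enum_rankK !eqxx mul1r (inj_eq enum_val_inj).
by rewrite !mxE (negbTE xi) mul0r.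
Qed.

Lemma Wbits_eq : (Wbits :=: Wsp lam b l)%MS.
Proof.
apply/eqmxP/andP; split.
  apply/row_subP => i; rewrite row_Wbits Wsp_sub -trmx_mul Nop_ey linearZ /=.
  by have := enum_valP i; rewrite inE => /eqP ->.
apply/rV_subP => v; rewrite Wsp_sub => /eqP h.
rewrite [v]row_ey; apply: summx_sub => y _; have [yl|ny] := boolP (y \in lbits).
  by rewrite scalemx_sub // -(enum_rankK_in yl yl) -row_Wbits row_sub.
have := congr1 (fun w : 'rV[CC]_N => w 0 (enum_rank y)) h.
rewrite Nop_row mxE => /eqP; rewrite -subr_eq0 -mulrBl mulf_eq0 subr_eq0 eqr_nat.
rewrite inE in ny; rewrite (negbTE ny) /= => /eqP ->; rewrite scale0r; exact: sub0mx.
Qed.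

Lemma dW_bin : dW lam b l = 'C(k, l).
Proof. by rewrite /dW -Wbits_eq (eqP Wbits_free) card_lbits. Qed.

End WeightSpace.

End WeightSubspace.
Import WeightSubspace.

Section YSpan.
Variables (k l : nat) (lam : 'I_k -> CC * CC) (b : 'I_k -> CC) (Ch : 'M[CC]_k).
Hypothesis lk : (l <= k)%N.
Hypothesis Chu : Ch \in unitmx.
Local Notation N := (Ndim k).
Local Notation side := (@side k l).
Local Notation rk := (@rk k l).
Local Notation FF := {ffun 'I_k -> 'I_k}.
Local Notation Eh := (Eh Ch).
Local Notation Mfac := (Mfac l Ch).
Local Notation Y := (Y l Ch).
Local Notation Nop := (Nop k).

Lemma Nop_gg t : Nop *m gg t = gg t *m Nop + gg t.
Proof.
have e s : nn s *m gg t = gg t *m nn s + (s == t)%:R *: gg s.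
  rewrite -!gg_ff -[LHS]mulmxA ff_gg_anti mulmxBr mul_mx_scalar [gg s *m (gg t *m _)]mulmxA.
  by rewrite (gg_gg_anti s t) mulNmx opprK mulmxA addrC.
rewrite /WeightSubspace.Nop mulmx_suml mulmx_sumr (eq_bigr _ (fun s _ => e s)) big_split /=; congr (_ + _).
by rewrite (bigD1 t) //= eqxx scale1r big1 ?addr0 // => s /negbTE ->; rewrite scale0r.
Qed.

Lemma Nop_Eh j : Nop *m Eh j = Eh j *m Nop + Eh j.
Proof.
rewrite /CyclicVacuum.Eh /gsum mulmx_sumr mulmx_suml -big_split; apply: eq_bigr => t _ /=.
by rewrite -scalemxAr Nop_gg scalerDr scalemxAl.
Qed.

Lemma count_side : count side (index_enum 'I_k) = l.
Proof.
rewrite -sum1_count -[RHS]/(nb k l true).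
have -> : nb k l true = (\sum_(i < nb k l true) 1)%N by rewrite sum1_card card_ord.
rewrite -(@sum_side k l lk nat true (fun=> 1%N)).
by apply: eq_bigl => i; rewrite eqb_id.
Qed.

Lemma prod_rcons_mx (I : Type) (p : seq I) i (M : I -> 'M[CC]_N) :
  \prod_(j <- rcons p i) M j = (\prod_(j <- p) M j) *m M i.
Proof. by rewrite -cats1 big_cat big_seq1. Qed.

(** Each [Eh j] raises the number operator by one, and exactly [l] of the factors of [Y J] are of
    this kind, the others being scalars. *)
Lemma Y_sub J : (Y J <= Wsp lam b l)%MS.
Proof.
rewrite Wsp_sub -{2}count_side; apply/eqP; rewrite /WedgeVectors.Y.
elim/last_ind: (index_enum _) => [|p i IH].
  rewrite big_nil mulmx1 scale0r -[vac k]trmxK -trmx_mul vac_ey Nop_ey linearZ /= /wt.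
  by rewrite big1 ?scale0r // => s _; rewrite ffunE.
rewrite prod_rcons_mx -[in count _ _]cats1 count_cat /= addn0 !mulmxA.
set w := vac k *m _ in IH *; rewrite /WedgeVectors.Mfac; case si: (side i).
  rewrite -mulmxA -trmx_mul Nop_Eh linearD /= trmx_mul mulmxDr mulmxA IH -scalemxAl.
  by rewrite natrD scalerDl scale1r.
by rewrite addn0 mul_mx_scalar -scalemxAl IH !scalerA mulrC.
Qed.

Lemma prod_scale (I : Type) (s : seq I) (c : I -> CC) (M : I -> 'M[CC]_N) :
  \prod_(i <- s) (c i *: M i) = (\prod_(i <- s) c i) *: \prod_(i <- s) M i.
Proof.
elim: s => [|i s IH]; first by rewrite !big_nil scale1r.
by rewrite !big_cons IH -!mulmxE -scalemxAl -scalemxAr scalerA.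
Qed.

Lemma gg_Eh t : gg t = \sum_j invmx Ch t j *: Eh j.
Proof.
rewrite /CyclicVacuum.Eh /gsum; under eq_bigr do rewrite scaler_sumr.
rewrite exchange_big /= (eq_bigr (fun s => (t == s)%:R *: gg s)).
  by rewrite (bigD1 t) //= eqxx scale1r big1 ?addr0 // => s; rewrite eq_sym => /negbTE ->; rewrite scale0r.
move=> s _; under eq_bigr do rewrite scalerA.
rewrite -scaler_suml; congr (_ *: _).
by have := mulVmx Chu => /matrixP/(_ t s); rewrite !mxE.
Qed.

(** Invertibility of [Ch] expresses the creation operators through the [Eh j]; the positions off the
    first side are filled by the scalar factor that equals one. *)
Lemma gprod_Y (K : 'I_k -> 'I_k) : exists c : FF -> CC,
  vac k *m (\prod_(i < k | side i) (gg (K i))^T : 'M[CC]_N) = \sum_J c J *: Y J.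
Proof.
pose c i j : CC := if side i then invmx Ch (K i) j else 1.
exists (fun J : FF => \prod_i c i (J i)).
rewrite big_mkcond (eq_bigr (fun i => \sum_j c i j *: Mfac i j)) => [|i _].
  rewrite bigA_distr_bigA mulmx_sumr; apply: eq_bigr => J _.
  by rewrite /WedgeVectors.Y prod_scale -scalemxAr.
rewrite /c /WedgeVectors.Mfac; case si: (side i).
  by rewrite {1}gg_Eh linear_sum /=; apply: eq_bigr => j _; rewrite linearZ.
rewrite (bigD1 (insubd i (rk i))) //= val_insubd rk_ltk // eqxx scale1r big1 ?addr0 // => j.
rewrite -val_eqE /= val_insubd rk_ltk // => /negbTE ->.
by rewrite raddf0 scaler0.
Qed.

Lemma glist_ey (ts : seq 'I_k) : uniq ts -> exists c : CC, c != 0 /\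
  vac k *m (\prod_(t <- ts) (gg t)^T : 'M[CC]_N) = c *: (ey [ffun t => t \in ts])^T.
Proof.
elim/last_ind: ts => [|ts t IH].
  move=> _; exists 1; rewrite oner_neq0 big_nil mulmx1 scale1r; split=> //.
  by rewrite -[vac k]trmxK vac_ey; congr (ey _)^T; apply/ffunP => t; rewrite !ffunE.
rewrite rcons_uniq => /andP[tt /IH[c [c0 e]]].
rewrite prod_rcons_mx mulmxA e.
exists (c * (-1) ^+ odd (cnt t [ffun t => t \in ts])); split.
  by rewrite mulf_neq0 // signr_eq0.
rewrite -scalemxAl -trmx_mul gg_ey ffunE (negbTE tt) linearZ /= scalerA; congr (_ *: (ey _)^T).
by apply/ffunP => s; rewrite !ffunE mem_rcons inE; case: eqP.
Qed.

Lemma ey_Y y : y \in lbits k l -> exists c : FF -> CC, (ey y)^T = \sum_J c J *: Y J.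
Proof.
move=> yl; pose ts := enum [pred t | y t].
have sz : size ts = l.
  move: yl; rewrite inE => /eqP <-; rewrite -cardE -sum1_card big_mkcond /wt.
  by apply: eq_bigr => s _; rewrite inE; case: (y s).
have [c [c0 e]] := glist_ey (enum_uniq [pred t | y t]).
have ey' : [ffun t => t \in ts] = y by apply/ffunP => t; rewrite ffunE mem_enum.
rewrite ey' in e.
pose K (i : 'I_k) := nth i ts i.
have [c' e'] := gprod_Y K.
exists (fun J => c^-1 * c' J).
rewrite -[LHS](scalerK c0) -e.
have -> : \prod_(t <- ts) (gg t)^T = \prod_(i < k | side i) (gg (K i))^T :> 'M[CC]_N.
  case: (ts) sz @K {e e'} => [|t0 ts'] sz K.
    rewrite big_nil big_pred0 // => i; rewrite /SchurBasis.side -sz ltn0; by [].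
  rewrite (big_nth t0) big_mkord sz (big_ord_widen k (fun i => (gg (nth t0 (t0 :: ts') i))^T) lk).
  by apply: eq_bigr => i il; rewrite /K (set_nth_default t0) // sz.
by rewrite e' scaler_sumr; apply: eq_bigr => J _; rewrite scalerA.
Qed.

Local Notation Wb := (Wbase lam b l).

Lemma YW J : (Y J <= Wb)%MS.
Proof. by rewrite eq_row_base Y_sub. Qed.

Lemma WY i : exists c : FF -> CC, row i Wb = \sum_J c J *: Y J.
Proof.
have : (row i Wb <= Wbits k l)%MS.
  by rewrite (Wbits_eq l lam b) (submx_trans (row_sub _ _)) // eq_row_base.
case/submxP => D ->; rewrite mulmx_sum_row.
have h j : exists c : FF -> CC, row j (Wbits k l) = \sum_J c J *: Y J.
  by rewrite row_Wbits; apply: ey_Y; apply: enum_valP.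
apply: (big_ind (fun v : 'rV[CC]_N => exists c : FF -> CC, v = \sum_J c J *: Y J)).
- by exists (fun=> 0); rewrite big1 // => J _; rewrite scale0r.
- move=> _ _ [c ->] [c' ->]; exists (fun J => c J + c' J).
  by rewrite -big_split; apply: eq_bigr => J _; rewrite scalerDl.
move=> j _; have [c ->] := h j; exists (fun J => D 0 j * c J).
by rewrite scaler_sumr; apply: eq_bigr => J _; rewrite scalerA.
Qed.

End YSpan.

(** * Action of the transfer matrix *)

Module TransferAction.

Section Action.
Variables (k l : nat) (lam : 'I_k -> CC * CC) (b : 'I_k -> CC) (q1 q2 : CC) (r : nat -> CC).
Variable Ch : 'M[CC]_k.
Hypothesis lk : (l <= k)%N.
Local Notation N := (Ndim k).
Local Notation side := (@side k l).
Local Notation FF := {ffun 'I_k -> 'I_k}.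
Local Notation Eh := (Eh Ch).
Local Notation Mfac := (Mfac l Ch).
Local Notation Y := (Y l Ch).
Local Notation Em := (Em lam b k).
Local Notation newt := (@newt CC r).
Local Notation T := (Tmx k r).
Local Notation Theta := (Theta r).
Local Notation Jmx := (@Jmx CC k).
Local Notation F := (Fpol lam b q1 q2).
Local Notation tQ := (tQ lam b q1 q2).
Local Notation rho := (@rho CC k r N Y).
Hypothesis hCh : forall t, pE lam b k t = \sum_(j < k) Ch j t *: newt j.
Hypothesis hF : F = (q1 - q2) *: newt k.

(** Multiplication by [u] before reduction: the last row of [T] misses the term [newt k], which is
    restored here. *)
Lemma newt_mulX (u : CC) (j : 'I_k) :
  u * (newt j).[u] = \sum_(i < k) T j i * (newt i).[u] + (j.+1 == k)%:R * (newt k).[u].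
Proof.
have eS : (newt j.+1).[u] = (newt j).[u] * (u - r j).
  by rewrite newtS hornerM hornerXsubC.
have -> : \sum_(i < k) T j i * (newt i).[u] = r j * (newt j).[u] + (j.+1 != k)%:R * (newt j.+1).[u].
  rewrite (eq_bigr (fun i : 'I_k => (i == j)%:R * (r j * (newt j).[u]) + (i == j.+1 :> nat)%:R * (newt j.+1).[u])); last first.
    move=> i _; rewrite mxE mulrDl [j == i]eq_sym; congr (_ + _).
      by case: eqP => [->|_]; rewrite ?mul1r ?mul0r.
    by case: eqP => [->|_]; rewrite ?mul1r ?mul0r.
  rewrite big_split /=; congr (_ + _).
    by rewrite (bigD1 j) //= eqxx mul1r big1 ?addr0 // => i /negbTE ->; rewrite mul0r.
  rewrite -mulr_suml; congr (_ * _); have [h|h] := eqVneq j.+1 k.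
    by rewrite big1 // => i _; rewrite h ltn_eqF.
  have hj : (j.+1 < k)%N by rewrite ltn_neqAle h ltn_ord.
  rewrite (bigD1 (Ordinal hj)) //= eqxx big1 ?addr0 // => i.
  by rewrite -val_eqE /= => /negbTE ->.
have -> : (j.+1 == k)%:R * (newt k).[u] = (j.+1 == k)%:R * (newt j.+1).[u].
  by case: eqP => [->|_] //; rewrite !mul0r.
rewrite eS; case: (j.+1 == k) => /=; ring.
Qed.

Section AtPoint.
Variable x : CC.
Hypothesis xal : forall s, x + alp lam b s != 0.
Hypothesis xF : F.[x] != 0.

Lemma det_sub_F : (q1 - q2) * \det (x%:M - T) = F.[x].
Proof. by rewrite det_sub_T hF hornerZ horner_prod; under [in RHS]eq_bigr do rewrite hornerXsubC. Qed.

Lemma sub_unit : x%:M - T \in unitmx.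
Proof.
rewrite unitmxE unitfE; apply: contraNneq xF => e.
by rewrite -det_sub_F e mulr0.
Qed.

(** The ratio [(x - u - 1) / (x - u)] of the exchange relation with [u] replaced by [T]. *)
Definition Kx : 'M[CC]_k := ((x - 1)%:M - T) *m invmx (x%:M - T).

Lemma Kx_mul : Kx *m (x%:M - T) = (x - 1)%:M - T.
Proof. by rewrite /Kx mulmxKV // sub_unit. Qed.

Let S j := tQ x *m Eh j.
Let R j := Eh j *m tQ x.

(** This is the coefficient of [newt i] with [i < k] in the exchange relation, after [u * newt j] is
    expanded by [newt_mulX]. The term with [F(u)] does not contribute, since [F] is a multiple of
    [newt k]. *)
Lemma exch_sum (i : 'I_k) :
  \sum_j (x%:M - T) j i *: S j = \sum_j ((x - 1)%:M - T) j i *: R j.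
Proof.
pose Z (i : 'I_k) := F.[x] *: (\sum_j (x%:M - T) j i *: S j - \sum_j ((x - 1)%:M - T) j i *: R j).
(* The coefficient at [newt k] gathers the overflow of [newt_mulX] and the term [F(u) E(x)]. *)
pose Zk := - (F.[x] *: (\sum_(j < k) (j.+1 == k)%:R *: (S j - R j)) + (q1 - q2) *: \sum_(j < k) (newt j).[x] *: R j).
pose Zn (n : nat) := if insub n is Some i then Z i else Zk.
have h : Zn i = 0.
  apply: (@newt_closed _ r _ (eq^~ 0) k.+1 [::] Zn); last exact: leq_trans (ltn_ord i) _.
  - by [].
  - by move=> c u v -> ->; rewrite scaler0 addr0.
  move=> u _; rewrite big_ord_recr /= {2}/Zn insubF ?ltnn //.
  rewrite (eq_bigr (fun i : 'I_k => (newt i).[u] *: Z i)) => [|j _]; last by rewrite /Zn valK.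
  have e := tQ_exchange q1 q2 xal u.
  have conv (c : CC) (V : 'I_k -> 'M[CC]_N) :
      \sum_(i < k) (newt i).[u] *: (\sum_j (c%:M - T) j i *: V j) =
      (c - u) *: (\sum_(j < k) (newt j).[u] *: V j) + (newt k).[u] *: (\sum_(j < k) (j.+1 == k)%:R *: V j).
    under eq_bigr do rewrite scaler_sumr.
    rewrite exchange_big !scaler_sumr -big_split; apply: eq_bigr => j _ /=.
    under eq_bigr do rewrite scalerA.
    rewrite -scaler_suml !scalerA -scalerDl; congr (_ *: _).
    rewrite (eq_bigr (fun i : 'I_k => c * ((j == i)%:R * (newt i).[u]) - T j i * (newt i).[u])); last first.
      move=> i' _; rewrite [(c%:M - T) j i']mxE [X in X + _]mxE [X in _ * (_ + X)]mxE -[c *+ _]mulr_natr.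
      by rewrite mulrC mulrBl mulrA.
    rewrite sumrB -mulr_sumr (bigD1 j) //= eqxx mul1r big1 ?addr0; last first.
      by move=> i'; rewrite eq_sym => /negbTE ->; rewrite mul0r.
    have := newt_mulX u j; move: (\sum_(i < k) T j i * _) => s eu.
    by rewrite mulrBl eu; ring.
  have eS : tQ x *m Em u = \sum_(j < k) (newt j).[u] *: S j.
    by rewrite (E_newt hCh) mulmx_sumr; apply: eq_bigr => j _; rewrite scalemxAr.
  have eR v : Em v *m tQ x = \sum_(j < k) (newt j).[v] *: R j.
    by rewrite (E_newt hCh) mulmx_suml; apply: eq_bigr => j _; rewrite scalemxAl.
  move: e; rewrite eS [X in _ = X]mulmxDl -!scalemxAl !eR hF !hornerZ => e.
  rewrite /Z (eq_bigr (fun i : 'I_k => F.[x] *: ((newt i).[u] *: (\sum_j (x%:M - T) j i *: S j)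
     - (newt i).[u] *: (\sum_j ((x - 1)%:M - T) j i *: R j)))); last first.
    by move=> i' _; rewrite scalerA mulrC -scalerA scalerBr.
  rewrite -scaler_sumr sumrB !conv /Zk.
  have -> : \sum_(j < k) (j.+1 == k)%:R *: (S j - R j) =
      \sum_(j < k) (j.+1 == k)%:R *: S j - \sum_(j < k) (j.+1 == k)%:R *: R j.
    by rewrite -sumrB; apply: eq_bigr => j _; rewrite scalerBr.
  move: e; rewrite hF !hornerZ.
  move: (\sum_(i < k) (newt i).[u] *: S i) (\sum_(i < k) (newt i).[u] *: R i) (\sum_(i < k) (newt i).[x] *: R i).
  move: (\sum_(i < k) (i.+1 == k)%:R *: S i) (\sum_(i < k) (i.+1 == k)%:R *: R i).
  move: (newt k).[u] (newt k).[x] => nu nx D1 D2 X1 Y1 Y2 e.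
  apply/matrixP => i1 i2; move/matrixP/(_ i1 i2): e; rewrite !mxE => /eqP.
  rewrite -subr_eq0 => /eqP e; rewrite -[RHS]e.
  by move: (X1 i1 i2) (Y1 i1 i2) (Y2 i1 i2) (D1 i1 i2) (D2 i1 i2) => a1 a2 a3 a4 a5; ring.
move: h; rewrite /Zn valK /Z => /eqP; rewrite scaler_eq0 (negbTE xF) /= subr_eq0.
by move/eqP.
Qed.

Lemma exch_Eh m : tQ x *m Eh m = \sum_j Kx j m *: (Eh j *m tQ x).
Proof.
transitivity (\sum_i invmx (x%:M - T) i m *: \sum_j (x%:M - T) j i *: S j).
  under eq_bigr do rewrite scaler_sumr.
  rewrite exchange_big /= (bigD1 m) //= [X in _ + X]big1 ?addr0 => [|j jm].
    under eq_bigr do rewrite scalerA mulrC.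
    rewrite -scaler_suml; have := mulmxV sub_unit => /matrixP/(_ m m).
    by rewrite mxE => ->; rewrite mxE eqxx scale1r.
  under eq_bigr do rewrite scalerA mulrC.
  rewrite -scaler_suml; have := mulmxV sub_unit => /matrixP/(_ j m).
  by rewrite mxE => ->; rewrite mxE (negbTE jm) scale0r.
under eq_bigr do rewrite exch_sum scaler_sumr.
rewrite exchange_big; apply: eq_bigr => j _ /=.
rewrite /Kx mxE scaler_suml; apply: eq_bigr => i _.
by rewrite scalerA mulrC.
Qed.

Local Notation tx := (tQ x)^T.
Definition Kf (i m j : 'I_k) : CC := if side i then Kx j m else (j == m)%:R.

Lemma Mfac_tx i m : Mfac i m *m tx = tx *m \sum_j Kf i m j *: Mfac i j.
Proof.
rewrite /WedgeVectors.Mfac /Kf; case si: (side i).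
  rewrite -trmx_mul exch_Eh linear_sum mulmx_sumr; apply: eq_bigr => j _ /=.
  by rewrite linearZ /= trmx_mul scalemxAr.
rewrite (bigD1 m) //= eqxx scale1r big1 ?addr0 => [|j /negbTE ->]; last by rewrite scale0r.
by rewrite scalar_mxC.
Qed.

Lemma prod_tx (p : seq 'I_k) (J : FF) :
  (\prod_(i <- p) Mfac i (J i) : 'M[CC]_N) *m tx =
  tx *m \prod_(i <- p) (\sum_j Kf i (J i) j *: Mfac i j).
Proof.
elim: p => [|i p IH]; first by rewrite !big_nil mul1mx mulmx1.
rewrite !big_cons -!mulmxE -mulmxA IH !mulmxA Mfac_tx.
by [].
Qed.

Lemma Y_tx (J : FF) : Y J *m tx = F.[x] *: \sum_(J' : FF) (\prod_i Kf i (J i) (J' i)) *: Y J'.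
Proof.
rewrite /WedgeVectors.Y -mulmxA prod_tx mulmxA -[vac k]trmxK -trmx_mul tQ_vac // linearZ /= trmxK.
rewrite -scalemxAl bigA_distr_bigA mulmx_sumr; congr (_ *: _); apply: eq_bigr => J' _.
by rewrite prod_scale -scalemxAr.
Qed.

(** [Theta_mulr] absorbs [F(x) = (q1 - q2) det (x - T)] as a right factor [x - T] of every row; on
    the first side it cancels the inverse contained in [Kx]. *)
Lemma rho_tx p : rho p *m tx =
  (q1 - q2) *: rho (\prod_i ((x - (side i : nat)%:R)%:MP + (-1) *: 'X_i) * p).
Proof.
rewrite /ThetaRows.rho mulmx_suml scaler_sumr.
have e1 (c : CC) (J : FF) : (c *: Y J) *m tx =
    \sum_(J' : FF) (c * F.[x] * \prod_i Kf i (J i) (J' i)) *: Y J'.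
  rewrite -scalemxAl Y_tx scalerA scaler_sumr; apply: eq_bigr => J' _.
  by rewrite scalerA.
rewrite (eq_bigr _ (fun J _ => e1 _ J)).
rewrite exchange_big /=; apply: eq_bigr => J' _.
rewrite -scaler_suml scalerA; congr (_ *: _).
rewrite Theta_affine_prod.
pose A : 'M[CC]_k := \matrix_(i, m) Kf i m (J' i).
have -> : \matrix_i (row i (Jmx (fun i => J' i)) *m ((x - (side i : nat)%:R)%:M + -1 *: T)) = A *m (x%:M - T).
  apply/row_matrixP => i; rewrite rowK row_mul.
  have eA (M : 'M[CC]_k) : row i (Jmx (fun i => J' i)) *m M = row (J' i) M.
    by rewrite [RHS]rowE; congr (_ *m _); apply/rowP => j; rewrite !mxE eqxx.
  rewrite eA scaleN1r; case si: (side i).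
    rewrite -Kx_mul row_mul; congr (_ *m _); apply/rowP => m.
    by rewrite !mxE /Kf si mxE.
  rewrite subr0 -[x%:M - T in LHS]mul1mx row_mul; congr (_ *m _); apply/rowP => m.
  by rewrite !mxE /Kf si.
rewrite Theta_mulr ?comm_sub_T // mulrA det_sub_F Theta_expand mulr_sumr; apply: eq_bigr => J _.
rewrite [Theta _ p * _]mulrC -mulrA [Theta _ p * _]mulrC; congr (_ * (_ * _)).
by apply: eq_bigr => i _; rewrite mxE.
Qed.

End AtPoint.

Definition NumQ n : 'M[CC]_N := q1 *: NumT lam b false false n - q2 *: NumT lam b true true n.

Lemma tQ_NumQ x : tQ x = \sum_(m < k.+1) x ^+ m *: NumQ (k - m)%N.
Proof.
rewrite /TransferMatrix.tQ /tm /ev !scaler_sumr -sumrB (reindex_inj rev_ord_inj) /=; apply: eq_bigr => i _.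
rewrite subSS subKn ?leq_ord // /NumQ scalerBr !scalerA.
by rewrite ![_ * x ^+ i]mulrC.
Qed.

Lemma Phi_val (x : CC) : (Phi CC k l).[x%:MP] =
  \prod_i ((x - (side i : nat)%:R)%:MP + (-1) *: 'X_i) :> {mpoly CC[k]}.
Proof.
rewrite /Phi horner_prod; apply: eq_bigr => i _; rewrite hornerXsubC mpolyCB scaleN1r.
rewrite opprD addrA addrAC; congr (_ - _ - _).
by rewrite raddfMn /= mpolyC1.
Qed.

Lemma size_Phi : size (Phi CC k l) = k.+1.
Proof. by rewrite size_prod_XsubC -[index_enum _]enumT size_enum_ord. Qed.

Lemma Phi_coefs (x : CC) : (Phi CC k l).[x%:MP] = \sum_(i < k.+1) x ^+ i *: (Phi CC k l)`_i.
Proof.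
have sP : (size (Phi CC k l) <= k.+1)%N by rewrite size_Phi.
rewrite (horner_coef_wide _ sP); apply: eq_bigr => i _.
by rewrite -rmorphXn mulrC mul_mpolyC.
Qed.

Hypothesis q12 : q1 != q2.

Lemma F_neq0 (x : CC) : x \notin [seq r i | i <- iota 0 k] -> F.[x] != 0.
Proof.
move=> xr; rewrite hF hornerZ mulf_neq0 ?subr_eq0 // horner_prod; apply/prodf_neq0 => i _.
rewrite hornerXsubC subr_eq0; apply: contraNneq xr => ->.
by apply: map_f; rewrite mem_iota /= add0n.
Qed.

Lemma rho_NumQ p m : (m <= k)%N ->
  rho p *m (NumQ (k - m)%N)^T = (q1 - q2) *: rho ((Phi CC k l)`_m * p).
Proof.
move=> hm.
pose M (m : nat) := rho p *m (NumQ (k - m)%N)^T - (q1 - q2) *: rho ((Phi CC k l)`_m * p).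
suff h : M m = 0 by apply/eqP; rewrite -subr_eq0; apply/eqP.
(* The excluded points are the zeros of [phi] and the roots of [F]. *)
pose bad := bad_phi lam b ++ [seq r i | i <- iota 0 k].
apply: (@coef_eq0 _ _ k.+1 bad M) => // x; rewrite mem_cat negb_or => /andP[xb xr].
have := rho_tx (good_phi xb) (F_neq0 xr) p; rewrite -Phi_val Phi_coefs tQ_NumQ.
rewrite [(\sum_(_ < _) _)^T]linear_sum mulmx_sumr mulr_suml [X in _ = _ *: X]linear_sum scaler_sumr /= => /eqP.
rewrite -subr_eq0 -sumrB => /eqP e; rewrite -[RHS]e; apply: eq_bigr => i _.
rewrite /M scalerBr [(x ^+ i *: NumQ _)^T]linearZ /= -scalemxAr -scalerAl [rho (x ^+ i *: _)]linearZ /=.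
by rewrite !scalerA [x ^+ i * _]mulrC.
Qed.

End Action.

End TransferAction.
Import TransferAction.

(** * Commutative algebras acting regularly *)

Section Fitting.
Variables (F : fieldType) (d : nat).

(** Bezout between [(X - c)^d] and the cofactor of the characteristic polynomial prime to [X - c];
    the exponent [d] dominates the multiplicity of [c]. As a polynomial in [A], the projector
    commutes with whatever commutes with [A]. *)
Lemma fitting_projector (A : 'M[F]_d) (c : F) : exists P : 'M[F]_d,
  [/\ forall w : 'rV_d, w *m (A - c%:M) ^+ d = 0 -> w *m P = w,
      P *m (A - c%:M) ^+ d = 0 &
      forall X, A *m X = X *m A -> P *m X = X *m P].
Proof.
case: d A => [|n] A.
  by exists 0; split=> [w _||X _]; apply/matrixP; (try by move=> i []); case.
have ch0 : char_poly A != 0 by rewrite monic_neq0 // char_poly_monic.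
have [m [q qc eq]] := multiplicity_XsubC (char_poly A) c.
have cop : coprimep (('X - c%:P) ^+ n.+1) q.
  by apply: coprimep_expl; rewrite coprimep_sym coprimep_XsubC (implyP qc).
have [[u v] /= uv1] := Bezout_eq1_coprimepP _ _ cop.
have eX : horner_mx A (('X - c%:P) ^+ n.+1) = (A - c%:M) ^+ n.+1.
  by rewrite rmorphXn rmorphB /= horner_mx_X horner_mx_C.
exists (horner_mx A (v * q)); split.
- move=> w h.
  have := congr1 (fun p => w *m horner_mx A p) uv1.
  rewrite rmorphD rmorph1 /= mulmxDr mulmx1 rmorphM /= eX.
  have -> : horner_mx A u * (A - c%:M) ^+ n.+1 = (A - c%:M) ^+ n.+1 *m horner_mx A u.
    by rewrite -eX mulmxE -!rmorphM /= mulrC.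
  by rewrite mulmxA h mul0mx add0r => ->.
- rewrite -eX mulmxE -rmorphM /=.
  have : char_poly A %| v * q * ('X - c%:P) ^+ n.+1.
    rewrite eq -mulrA; apply: dvdp_mull; rewrite dvdp_mul2l; last first.
      by apply: contraTneq qc => ->; rewrite ch0 root0.
    apply: dvdp_exp2l.
    have := size_char_poly A; rewrite eq size_Mmonic ?monic_exp ?monicXsubC //; last first.
      by apply: contraTneq qc => ->; rewrite ch0 root0.
    rewrite size_exp_XsubC addnS /= => e.
    have : (0 < size q)%N by rewrite size_poly_gt0; apply: contraTneq qc => ->; rewrite ch0 root0.
    by move=> s0; rewrite -ltnS -[n.+2]e -[m.+1]add1n leq_add2r.
  by case/dvdpP => w ->; rewrite rmorphM /= Cayley_Hamilton mulr0.
- move=> X cX; apply/esym; apply: comm_mx_horner; exact/esym.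
Qed.

End Fitting.

Section IdempotentTrace.
Variables (F : fieldType) (d : nat).

Lemma idempotent_trace (P : 'M[F]_d) : P *m P = P -> \tr P = (\rank P)%:R.
Proof.
move=> h; have e := mulmx_base P.
have e1 : row_base P *m col_base P = 1%:M.
  apply: (row_free_inj (row_base_free P)); rewrite mul1mx.
  apply: (row_full_inj (col_base_full P)).
  by rewrite -[_ *m _ *m row_base P]mulmxA e mulmxA e.
by rewrite -[in LHS]e mxtrace_mulC e1 mxtrace1.
Qed.

End IdempotentTrace.

(* [S] acts on row vectors through its image under [rhoW], the image of [p] in the
   endomorphisms being [fW p], and [Th] is a Frobenius form. *)
Record regular_action (F : fieldType) (R : comAlgType F) (S : R -> Prop) (d : nat)
    (rhoW : {linear R -> 'rV[F]_d}) (fW : {linear R -> 'M[F]_d})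
    (Th : R -> F) (pb : 'I_d -> R) : Prop := RegularAction {
  ra_1 : S 1;
  ra_M : forall p q, S p -> S q -> S (p * q);
  ra_lin : forall c p q, S p -> S q -> S (c *: p + q);
  ra_Th : forall c p q, Th (c *: p + q) = c * Th p + Th q;
  ra_pb : forall i, S (pb i);
  ra_delta : forall i, rhoW (pb i) = delta_mx 0 i;
  ra_act : forall p q, S q -> rhoW q *m (fW p)^T = rhoW (p * q);
  ra_ext : forall (M : 'M[F]_d) p, (forall q, S q -> rhoW q *m M^T = rhoW (p * q)) -> M = fW p;
  ra_ker : forall p, S p -> rhoW p = 0 -> fW p = 0;
  ra_Th0 : forall p, S p -> rhoW p = 0 -> Th p = 0;
  ra_nondeg : forall p, S p -> (forall q, S q -> Th (p * q) = 0) -> rhoW p = 0 }.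

Section RegularAlgebra.
Variables (F : fieldType) (R : comAlgType F) (S : R -> Prop) (d : nat).
Variables (rhoW : {linear R -> 'rV[F]_d}) (fW : {linear R -> 'M[F]_d}).
Variables (Th : R -> F) (pb : 'I_d -> R).
Hypothesis ra : regular_action S rhoW fW Th pb.
Let S1 := ra_1 ra.
Let SM := ra_M ra.
Let Slin := ra_lin ra.
Let Thlin := ra_Th ra.
Let pbS := ra_pb ra.
Let pb_delta := ra_delta ra.
Let act := ra_act ra.
Let fext := ra_ext ra.
Let ker := ra_ker ra.
Let Th0 := ra_Th0 ra.
Let Thnd := ra_nondeg ra.
Implicit Types (p q : R) (v w : 'rV[F]_d) (a e : 'M[F]_d).

Lemma S0 : S 0.
Proof. by have := Slin (-1) S1 S1; rewrite scaleN1r addNr. Qed.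

Lemma SB p q : S p -> S q -> S (p - q).
Proof. by move=> hp hq; rewrite addrC -scaleN1r; apply: Slin. Qed.

Definition sec v : R := \sum_i v 0 i *: pb i.

Lemma secS v : S (sec v).
Proof.
by rewrite /sec; elim/big_rec: _ => [|i x _ hx]; [apply: S0 | apply: Slin].
Qed.

Lemma rho_sec v : rhoW (sec v) = v.
Proof.
rewrite /sec linear_sum [RHS]row_sum_delta; apply: eq_bigr => i _ /=.
by rewrite linearZ /= pb_delta.
Qed.

Lemma fW_inj p q : S p -> S q -> rhoW p = rhoW q -> fW p = fW q.
Proof.
move=> hp hq e; apply/eqP; rewrite -subr_eq0 -linearB /= ker //; first exact: SB.
by rewrite linearB /= e subrr.
Qed.

Lemma fW_sec p : S p -> fW p = fW (sec (rhoW p)).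
Proof. by move=> hp; apply: fW_inj => //; [apply: secS | rewrite rho_sec]. Qed.

Lemma fW_one : fW 1 = 1%:M.
Proof. by apply/esym/fext => q _; rewrite trmx1 mulmx1 mul1r. Qed.

Lemma fW_mul p q : S q -> fW (p * q) = fW p *m fW q.
Proof.
move=> hq; apply/esym/fext => q' hq'.
by rewrite trmx_mul mulmxA act // act ?mulrA //; apply: SM.
Qed.

Lemma rho1_act p : S p -> rhoW 1 *m (fW p)^T = rhoW p.
Proof. by move=> hp; rewrite act // mulr1. Qed.

Definition Balg : 'A[F]_d := <<\matrix_i mxvec (fW (pb i))>>%MS.

Lemma memBalg_f p : S p -> (fW p \in Balg)%MS.
Proof.
move=> hp; rewrite fW_sec // /sec linear_sum linear_sum /= genmxE; apply: summx_sub => i _.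
rewrite linearZ /= linearZ /= scalemx_sub //.
by rewrite (eq_row_sub i) // rowK.
Qed.

Lemma memBalgP a : reflect (exists2 v, True & fW (sec v) = a) (a \in Balg)%MS.
Proof.
apply: (iffP idP) => [|[v _ <-]]; last by apply: memBalg_f; apply: secS.
rewrite genmxE => /submxP[v e]; exists v => //.
apply: (can_inj mxvecK); rewrite e mulmx_sum_row /sec linear_sum linear_sum; apply: eq_bigr => i _.
by rewrite rowK /= !linearZ.
Qed.

Lemma memBalg a : (a \in Balg)%MS -> exists2 p, S p & fW p = a.
Proof. by move/memBalgP => [v _ <-]; exists (sec v) => //; apply: secS. Qed.

Lemma rank_Balg : \rank Balg = d.
Proof.
rewrite genmxE; apply/eqP; apply/row_freeP.
suff: row_free (\matrix_i mxvec (fW (pb i))) by move/row_freeP.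
rewrite -kermx_eq0; apply/eqP/row_matrixP => i; rewrite row0.
set u := row i _.
have h : u *m (\matrix_i mxvec (fW (pb i))) = 0 by rewrite /u -row_mul mulmx_ker row0.
have e : fW (sec u) = 0.
  apply: (can_inj mxvecK); rewrite linear0 -h mulmx_sum_row /sec linear_sum linear_sum.
  by apply: eq_bigr => j _; rewrite rowK /= !linearZ.
by rewrite -(rho_sec u) -rho1_act ?e ?trmx0 ?mulmx0 //; apply: secS.
Qed.

Lemma Balg1 : (1%:M \in Balg)%MS.
Proof. by rewrite -fW_one memBalg_f. Qed.

Lemma BalgM a e : (a \in Balg)%MS -> (e \in Balg)%MS -> (a *m e \in Balg)%MS.
Proof.
by move=> /memBalg[p hp <-] /memBalg[q hq <-]; rewrite -fW_mul // memBalg_f //; apply: SM.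
Qed.

Lemma Balg_comm a e : (a \in Balg)%MS -> (e \in Balg)%MS -> a *m e = e *m a.
Proof.
by move=> /memBalg[p hp <-] /memBalg[q hq <-]; rewrite -!fW_mul // mulrC.
Qed.

(** An operator commuting with the algebra is determined by the image of the cyclic vector [rhoW 1],
    and some multiplication operator has the same image. *)
Lemma Balg_max a : (forall e, (e \in Balg)%MS -> a *m e = e *m a) -> (a \in Balg)%MS.
Proof.
move=> h; have -> : a = fW (sec (rhoW 1 *m a^T)); last by apply: memBalg_f; apply: secS.
apply: fext => q hq; rewrite -(rho1_act hq) -mulmxA -trmx_mul h ?memBalg_f // trmx_mul mulmxA.
move: (rhoW 1 *m a^T) => u; rewrite -{1}[u]rho_sec act; last exact: secS.
by congr (rhoW _); apply: mulrC.
Qed.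

Lemma regular_inj a e : (a \in Balg)%MS -> (e \in Balg)%MS ->
  rhoW 1 *m a^T = rhoW 1 *m e^T -> a = e.
Proof.
move=> /memBalg[p hp <-] /memBalg[q hq <-].
by rewrite !rho1_act // => h; apply: fW_inj.
Qed.

Lemma regular_surj v : exists2 a, (a \in Balg)%MS & rhoW 1 *m a^T = v.
Proof.
exists (fW (sec v)); first by apply: memBalg_f; apply: secS.
by rewrite rho1_act ?rho_sec //; apply: secS.
Qed.

Lemma ThB p q : Th (p - q) = Th p - Th q.
Proof. by rewrite addrC -scaleN1r Thlin mulN1r addrC. Qed.

Lemma Th_sum (I : finType) (c : I -> F) (f : I -> R) : Th (\sum_i c i *: f i) = \sum_i c i * Th (f i).
Proof.
elim/big_rec2: _ => [|i y x _ <-]; last exact: Thlin.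
by rewrite -(subrr (1 : R)) ThB subrr.
Qed.

Definition xi1 : 'cV[F]_d := \col_i Th (pb i).

Lemma Th_xi p : S p -> rhoW p *m xi1 = (Th p)%:M.
Proof.
move=> hp; have -> : Th p = Th (sec (rhoW p)).
  apply/eqP; rewrite -subr_eq0 -ThB; apply/eqP/Th0; first by apply: SB => //; apply: secS.
  by rewrite linearB /= rho_sec subrr.
apply/matrixP => i j; rewrite !ord1 !mxE eqxx mulr1n /sec Th_sum; apply: eq_bigr => c _.
by rewrite mxE.
Qed.

Definition bform a e : F := (rhoW 1 *m (a *m e)^T *m xi1) 0 0.

Lemma bformE p q : S p -> S q -> bform (fW p) (fW q) = Th (p * q).
Proof.
move=> hp hq; rewrite /bform -fW_mul // rho1_act; last exact: SM.
by rewrite Th_xi ?mxE ?eqxx ?mulr1n //; apply: SM.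
Qed.

Lemma bform_linl c a a' e : bform (c *: a + a') e = c * bform a e + bform a' e.
Proof.
by rewrite /bform mulmxDl linearD -scalemxAl linearZ /= mulmxDr mulmxDl -scalemxAr -scalemxAl !mxE.
Qed.

Lemma bform_linr c a a' e : bform e (c *: a + a') = c * bform e a + bform e a'.
Proof.
by rewrite /bform mulmxDr linearD -scalemxAr linearZ /= mulmxDr mulmxDl -scalemxAr -scalemxAl !mxE.
Qed.

Lemma bform_nondeg a : (a \in Balg)%MS -> (forall e, (e \in Balg)%MS -> bform a e = 0) -> a = 0.
Proof.
move=> /memBalg[p hp <-] h; apply: ker => //; apply: Thnd => // q hq.
by rewrite -bformE // h // memBalg_f.
Qed.

Section Character.
Variable E : 'M[F]_d -> F.
Hypothesis E1 : E 1%:M = 1.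
Hypothesis Elin : forall c a a', (a \in Balg)%MS -> (a' \in Balg)%MS -> E (c *: a + a') = c * E a + E a'.
Hypothesis EM : forall a a', (a \in Balg)%MS -> (a' \in Balg)%MS -> E (a *m a') = E a * E a'.

Definition eigvec v := forall a, (a \in Balg)%MS -> v *m a^T = E a *: v.

Lemma Esum (I : finType) (c : I -> F) (f : I -> 'M[F]_d) : (forall i, (f i \in Balg)%MS) ->
  E (\sum_i c i *: f i) = \sum_i c i * E (f i).
Proof.
move=> h; have h0 : (0 \in Balg)%MS by rewrite linear0 sub0mx.
have E0 : E 0 = 0.
  by have := Elin (-1) Balg1 Balg1; rewrite scaleN1r addNr mulN1r addNr.
pose Q x y := (x \in Balg)%MS /\ E x = y.
suff [] : Q (\sum_i c i *: f i) (\sum_i c i * E (f i)) by [].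
elim/big_rec2: _ => [|i y x _ [hx <-]]; first by split.
split; last exact: Elin.
by rewrite linearD linearZ /= addmx_sub // scalemx_sub.
Qed.

(* [E] is represented by the form: [E a = bform a (fW p)]; then [rhoW p] is a
   common eigenvector. *)
Lemma eigvec_exists : exists2 v, v != 0 & eigvec v.
Proof.
pose G : 'M[F]_d := \matrix_(i, j) Th (pb i * pb j).
have ThG u j : (u *m G) 0 j = Th (sec u * pb j).
  rewrite mxE /sec mulr_suml.
  rewrite (eq_bigr (fun i => u 0 i *: (pb i * pb j))) => [|i _]; last by rewrite -scalerAl.
  by rewrite Th_sum; apply: eq_bigr => i _; rewrite mxE.
have ThV p q : S p -> S q -> Th (p * q) = \sum_j rhoW q 0 j * Th (p * pb j).
  move=> hp hq; rewrite -Th_sum.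
  apply/eqP; rewrite -subr_eq0 -ThB; apply/eqP/Th0.
    apply: SB; first exact: SM.
    elim/big_rec: _ => [|j x _ hx]; first exact: S0.
    by apply: Slin => //; apply: SM.
  have -> : \sum_i rhoW q 0 i *: (p * pb i) = p * sec (rhoW q).
    by rewrite /sec mulr_sumr; apply: eq_bigr => j _; rewrite scalerAr.
  by rewrite linearB /= -act // -act ?rho_sec ?subrr //; apply: secS.
have Gu : G \in unitmx.
  rewrite -row_free_unit -kermx_eq0; apply/eqP/row_matrixP => i; rewrite row0.
  set u := row i _; have h : u *m G = 0 by rewrite /u -row_mul mulmx_ker row0.
  rewrite -(rho_sec u); apply: Thnd; first exact: secS.
  move=> q hq; rewrite ThV //; last exact: secS.
  by rewrite big1 // => j _; rewrite -ThG h mxE mulr0.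
pose u := (\row_j E (fW (pb j))) *m invmx G.
pose p := sec u; have hp : S p by apply: secS.
have ThE q : S q -> Th (p * q) = E (fW q).
  move=> hq; rewrite ThV // [in RHS]fW_sec // /sec linear_sum /=.
  rewrite (eq_bigr (fun i => rhoW q 0 i *: fW (pb i))) => [|i _]; last by rewrite linearZ.
  rewrite Esum => [|i]; last exact: memBalg_f.
  by apply: eq_bigr => j _; rewrite -ThG /u mulmxKV // mxE.
exists (rhoW p).
  apply/eqP => p0; have := ThE 1 S1; rewrite mulr1 Th0 // fW_one E1.
  by move/eqP; rewrite eq_sym oner_eq0.
move=> a /memBalg[q hq <-]; rewrite act //.
have -> : rhoW (q * p) = rhoW (q * p - E (fW q) *: p) + E (fW q) *: rhoW p.
  by rewrite linearB linearZ /= subrK.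
rewrite [X in X + _]Thnd ?add0r //.
  by apply: SB; [apply: SM | rewrite -[_ *: p]addr0; apply: Slin => //; apply: S0].
move=> q' hq'; rewrite mulrBl ThB -scalerAl -[_ *: (p * q')]addr0 Thlin.
rewrite [q * p]mulrC -mulrA !ThE //; last exact: SM.
by rewrite fW_mul // EM ?memBalg_f // -(subrr (1 : R)) ThB !subrr addr0 subrr.
Qed.

(** On an eigenvector the vanishing of the functional [Th] spreads to all multiples, so
    nondegeneracy makes the vector zero. Hence [Th] is injective on the eigenspace, which is
    therefore at most a line. *)
Lemma eigvec_line v w : eigvec v -> eigvec w -> v != 0 -> exists c, w = c *: v.
Proof.
move=> hv hw v0.
have inj u : eigvec u -> (u *m xi1) 0 0 = 0 -> u = 0.
  move=> hu; have hx : u *m xi1 = (Th (sec u))%:M by rewrite -{1}[u]rho_sec Th_xi //; apply: secS.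
  rewrite hx [LHS]mxE eqxx mulr1n => h.
  rewrite -[u]rho_sec; apply: Thnd; first exact: secS.
  move=> q hq; rewrite [_ * q]mulrC.
  have := hu _ (memBalg_f hq); rewrite -{1}[u]rho_sec act; last exact: secS.
  move=> e; have := Th_xi (SM hq (secS u)); rewrite e -scalemxAl hx h raddf0 scaler0.
  by move/matrixP/(_ 0 0); rewrite [LHS]mxE [RHS]mxE eqxx mulr1n.
have v1 : (v *m xi1) 0 0 != 0 by apply: contra_neq v0; apply: inj.
pose c := (w *m xi1) 0 0 / (v *m xi1) 0 0.
exists c; apply/eqP; rewrite -subr_eq0; apply/eqP/inj.
  by move=> a ha; rewrite mulmxBl hw // -scalemxAl hv // scalerBr !scalerA mulrC.
rewrite mulmxBl -scalemxAl; move: (w *m xi1) (v *m xi1) @c v1 => x y c y1.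
by rewrite !mxE /c divfK // subrr.
Qed.

Section GenEig.
Variables (n : nat) (bs : 'I_n -> 'M[F]_d).
Hypothesis bsB : forall i, (bs i \in Balg)%MS.
Hypothesis bspan : forall a, (a \in Balg)%MS -> exists c : 'I_n -> F, a = \sum_i c i *: bs i.

Definition geneig : 'M[F]_d :=
  (\bigcap_(i < n) kermx (((bs i)^T - (E (bs i))%:M) ^+ d))%MS.

(** The product of the Fitting projectors of the basis elements. Each of them commutes with the
    algebra, which is its own commutant, and so belongs to it. *)
Lemma geneig_proj : exists2 e, (e \in Balg)%MS &
  (forall m (w : 'M_(m, d)), (w <= geneig)%MS -> w *m e^T = w) /\ (e^T <= geneig)%MS.
Proof.
pose Z i := ((bs i)^T - (E (bs i))%:M) ^+ d.
have [P hP] := fin_all_exists (fun i => fitting_projector (bs i)^T (E (bs i))).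
have PB i : ((P i)^T \in Balg)%MS.
  apply: Balg_max => a ha; have [_ _ h] := hP i; apply: trmx_inj.
  by rewrite !trmx_mul trmxK h // -!trmx_mul (Balg_comm (bsB i) ha).
have ZB i : ((Z i)^T \in Balg)%MS.
  have h : ((bs i)^T - (E (bs i))%:M)^T = bs i - (E (bs i))%:M by rewrite linearB /= trmxK tr_scalar_mx.
  have hb : (bs i - (E (bs i))%:M \in Balg)%MS.
    rewrite linearB /= addmx_sub // eqmx_opp -scalemx1 linearZ /= scalemx_sub //; exact: Balg1.
  suff hm m : ((((bs i)^T - (E (bs i))%:M) ^+ m)^T \in Balg)%MS by apply: hm.
  elim: m => [|m IH]; first by rewrite expr0 trmx1 Balg1.
  by rewrite exprS -mulmxE trmx_mul h; apply: BalgM.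
have prodB (s : seq 'I_n) : ((\prod_(i <- s) P i)^T \in Balg)%MS.
  elim/big_ind: _ => // [|x y hx hy]; first by rewrite trmx1 Balg1.
  by rewrite -mulmxE trmx_mul; apply: BalgM.
exists (\prod_i P i)^T => //; rewrite trmxK; split.
  move=> m w wU; apply/row_matrixP => j; rewrite row_mul.
  elim/big_ind: _ => [|x y hx hy|i _]; first by rewrite mulmx1.
    by rewrite -mulmxE mulmxA hx hy.
  have [h _ _] := hP i; apply: h; apply/sub_kermxP.
  by apply: submx_trans (row_sub _ _) _; apply: submx_trans wU _; apply: bigcapmx_inf (submx_refl _).
apply/sub_bigcapmxP => i _; apply/sub_kermxP; rewrite -/(Z i).
have hi : i \in index_enum 'I_n by rewrite mem_index_enum.
case/splitPr: hi => s1 s2; rewrite big_cat big_cons /= -!mulmxE -!mulmxA.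
have c : \prod_(j <- s2) P j *m Z i = Z i *m \prod_(j <- s2) P j.
  by apply: trmx_inj; rewrite !trmx_mul; apply: Balg_comm.
have [_ PZ _] := hP i.
by rewrite c [P i *m (Z i *m _)]mulmxA PZ mul0mx mulmx0.
Qed.

Definition eig : 'M[F]_d := (\bigcap_(i < n) kermx ((bs i)^T - (E (bs i))%:M))%MS.

Lemma eigP v : (v <= eig)%MS <-> eigvec v.
Proof.
split=> [/sub_bigcapmxP h a /bspan[c ->]|hv]; last first.
  apply/sub_bigcapmxP => i _; apply/sub_kermxP.
  by rewrite mulmxBr mul_mx_scalar hv // subrr.
rewrite Esum // linear_sum mulmx_sumr scaler_suml; apply: eq_bigr => i _ /=.
have /sub_kermxP := h i isT; rewrite mulmxBr mul_mx_scalar => /eqP; rewrite subr_eq0 => /eqP e.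
by rewrite linearZ /= -scalemxAr e scalerA.
Qed.

Lemma rank_eig : \rank eig = 1%N.
Proof.
have [v v0 hv] := eigvec_exists; have vE := (eigP v).2 hv.
apply/eqP; rewrite eqn_leq; apply/andP; split; last by have := mxrankS vE; rewrite rank_rV v0.
have : (eig <= v)%MS.
  apply/rV_subP => w /eigP hw; have [c ->] := eigvec_line hv hw v0.
  exact: scalemx_sub.
by move/mxrankS; rewrite rank_rV v0.
Qed.

Lemma eigvec_geneig v : eigvec v -> (v <= geneig)%MS.
Proof.
move=> hv; have h i : v *m ((bs i)^T - (E (bs i))%:M) = 0.
  by rewrite mulmxBr mul_mx_scalar hv // subrr.
apply/sub_bigcapmxP => i _; apply/sub_kermxP.
have hm m : (0 < m)%N -> v *m ((bs i)^T - (E (bs i))%:M) ^+ m = 0.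
  by case: m => // m _; rewrite exprS -mulmxE mulmxA h mul0mx.
have [d0|d0] := posnP d; last exact: hm.
by apply/rowP => -[j jd]; exfalso; move: jd; rewrite d0.
Qed.

(** The generator is the projection of the cyclic vector [rhoW 1] of the whole space. *)
Lemma geneig_cyclic : exists v, [/\ (v <= geneig)%MS,
  forall a, (a \in Balg)%MS -> (v *m a^T <= geneig)%MS &
  forall w, (w <= geneig)%MS -> exists2 a, (a \in Balg)%MS & w = v *m a^T].
Proof.
have [e eB [h1 h2]] := geneig_proj.
have st a : (a \in Balg)%MS -> (rhoW 1 *m e^T *m a^T <= geneig)%MS.
  move=> aB; rewrite -mulmxA -trmx_mul (Balg_comm aB eB) trmx_mul mulmxA.
  by apply: submx_trans h2; apply: submxMl.
exists (rhoW 1 *m e^T); split=> //.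
  by apply: submx_trans h2; apply: submxMl.
move=> w wU; exists (fW (sec w)); first by apply: memBalg_f; apply: secS.
rewrite -mulmxA -trmx_mul (Balg_comm (memBalg_f (secS w)) eB) trmx_mul mulmxA.
by rewrite rho1_act ?rho_sec ?h1 //; apply: secS.
Qed.

Lemma geneig_trace e : (e \in Balg)%MS ->
  (forall m (w : 'M_(m, d)), (w <= geneig)%MS -> w *m e^T = w) -> (e^T <= geneig)%MS ->
  \tr e = (\rank geneig)%:R.
Proof.
move=> eB h1 h2; rewrite -mxtrace_tr idempotent_trace ?h1 //; congr (_%:R).
apply/eqP; rewrite eqn_leq !mxrankS //.
by rewrite -(h1 _ _ (submx_refl _)) submxMl.
Qed.

Lemma proj_eigval e v : (e \in Balg)%MS ->
  (forall m (w : 'M_(m, d)), (w <= geneig)%MS -> w *m e^T = w) ->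
  eigvec v -> v != 0 -> E e = 1.
Proof.
move=> eB h1 hv v0; have := hv e eB; rewrite h1; last exact: eigvec_geneig.
rewrite -[v in v = _]scale1r => /eqP; rewrite -subr_eq0 -scalerBl scaler_eq0 (negbTE v0) orbF subr_eq0.
by move/eqP.
Qed.

(** If [E'] does not kill the projector, its eigenvector lies in the generalized eigenspace of [E],
    where each [bs i - E (bs i)] is nilpotent; so the two characters agree on the basis. *)
Lemma proj_eigval_other (E' : 'M[F]_d -> F) e v : (e \in Balg)%MS -> (e^T <= geneig)%MS ->
  (forall a, (a \in Balg)%MS -> v *m a^T = E' a *: v) -> v != 0 -> E' e != 0 ->
  forall i, E' (bs i) = E (bs i).
Proof.
move=> eB h2 hv v0 e0 i.
have vU : (v <= geneig)%MS.
  rewrite -[v](scalerK e0) -hv // scalemx_sub //; apply: submx_trans h2; exact: submxMl.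
have : v *m ((bs i)^T - (E (bs i))%:M) ^+ d = 0.
  by apply/sub_kermxP; apply: submx_trans vU _; apply: bigcapmx_inf (submx_refl _).
have -> m : v *m ((bs i)^T - (E (bs i))%:M) ^+ m = (E' (bs i) - E (bs i)) ^+ m *: v.
  elim: m => [|m IH]; first by rewrite !expr0 mulmx1 scale1r.
  rewrite exprSr -mulmxE mulmxA IH -scalemxAl mulmxBr mul_mx_scalar hv // -scalerBl scalerA.
  by rewrite exprSr.
move/eqP; rewrite scaler_eq0 (negbTE v0) orbF expf_eq0 => /andP[_].
by rewrite subr_eq0 => /eqP.
Qed.

End GenEig.

End Character.

End RegularAlgebra.

(** * Divisors and characters *)

Section ShiftRatio.
Variable F : numFieldType.
Local Notation rp zs := (\prod_(z <- zs) ('X - z%:P)).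

Lemma comp_shift_roots (zs : seq F) : rp zs \Po ('X - 1) = rp [seq z + 1 | z <- zs].
Proof.
rewrite big_map rmorph_prod; apply: eq_bigr => z _ /=; rewrite comp_polyB comp_polyX comp_polyC polyCD polyC1.
by rewrite opprD addrA addrAC.
Qed.

(** The difference of the root multiplicities is invariant under the shift by one. A nonzero value
    would spread along an infinite progression, whereas there are finitely many roots. *)
Lemma shift_ratio_inj (zs zs' : seq F) :
  rp zs' * (rp zs \Po ('X - 1)) = rp zs * (rp zs' \Po ('X - 1)) -> rp zs = rp zs'.
Proof.
rewrite !comp_shift_roots -!big_cat => /prod_XsubC_eq /seq.permP h.
suff c : perm_eq zs zs' by apply: perm_big.
apply/allP => z0 _ /=; apply/eqP.
have cm (s : seq F) z : count_mem z [seq z + 1 | z <- s] = count_mem (z - 1) s.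
  rewrite count_map; apply: eq_count => x /=.
  by rewrite -[RHS](inj_eq (addIr 1)) subrK.
have step z : (count_mem z zs' + count_mem (z - 1)%R zs = count_mem z zs + count_mem (z - 1)%R zs')%N.
  by have := h (pred1 z); rewrite !count_cat !cm.
have all_n n : (count_mem (z0 - n%:R)%R zs + count_mem z0 zs' = count_mem (z0 - n%:R)%R zs' + count_mem z0 zs)%N.
  elim: n => [|n IH]; first by rewrite subr0 addnC.
  have -> : z0 - n.+1%:R = z0 - n%:R - 1 by rewrite -natr1 opprD addrA.
  move: IH (step (z0 - n%:R)).
  move: (count_mem _ zs) (count_mem _ zs') (count_mem z0 zs) (count_mem z0 zs').
  move: (count_mem (z0 - n%:R - 1) zs) (count_mem (z0 - n%:R - 1) zs') => *; lia.
apply/eqP; apply: contraT => ne.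
pose L := [seq z0 - i%:R | i <- iota 0 (size (zs ++ zs')).+1].
have uL : uniq L.
  by rewrite map_inj_uniq ?iota_uniq // => i j /addrI /oppr_inj /eqP; rewrite eqr_nat => /eqP.
have sL : {subset L <= zs ++ zs'}.
  move=> _ /mapP[n _ ->]; rewrite mem_cat -!has_pred1 !has_count.
  move: (all_n n) ne; move: (count_mem z0 zs) (count_mem z0 zs').
  by move: (count_mem (z0 - n%:R) zs) (count_mem (z0 - n%:R) zs') => c1 c2 c3 c4; lia.
by have := uniq_leq_size uL sL; rewrite size_map size_iota ltnn.
Qed.

End ShiftRatio.

Section SubsetCount.
Variables (I : finType) (C : eqType) (r : I -> C) (m : C -> nat).
Implicit Types (A B : {set I}) (rs : seq C).

Definition fib a : {set I} := [set i | r i == a].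
Definition fibsets rs : {set {set I}} := [set A : {set I} |
  [forall i in A, r i \in rs] && all (fun a => #|A :&: fib a| == m a) rs].

(** Induction on the listed values: a set splits uniquely into its part over [a] and its part over
    the remaining values. *)
Lemma card_fibsets rs : uniq rs -> #|fibsets rs| = (\prod_(a <- rs) 'C(#|fib a|, m a))%N.
Proof.
elim: rs => [|a rs IH] => [_|/= /andP[ars urs]].
  rewrite big_nil; apply/eqP/cards1P; exists set0; apply/setP => A; rewrite !inE andbT.
  apply/forall_inP/eqP => [h|-> i]; last by rewrite inE.
  by apply/setP => i; rewrite inE; apply/negP => /h.
pose D := [set B : {set I} | B \subset fib a & #|B| == m a].
have -> : fibsets (a :: rs) = [set p.1 :|: p.2 | p in setX D (fibsets rs)].
  apply/setP => A; apply/idP/imsetP.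
    rewrite inE => /andP[/forall_inP h1 /= /andP[ha hrs]].
    exists (A :&: fib a, A :\: fib a); last by rewrite /= setID.
    rewrite !inE /= subsetIr ha /=; apply/andP; split.
      apply/forall_inP => i; rewrite !inE => /andP[ne /h1].
      by rewrite inE (negbTE ne).
    apply/allP => c crs; have := allP hrs c crs; congr (_ == _); apply: eq_card => i.
    rewrite !inE; case: (r i =P c) => [->|_]; rewrite ?andbF // !andbT.
    by rewrite (_ : (c == a) = false) //; apply: contraNF ars => /eqP <-.
  move=> [[B A'] /setXP[/=]]; rewrite !inE => /andP[Ba mB] /andP[/forall_inP h1 hrs] ->.
  have A'a i : i \in A' -> r i == a = false.
    by move/h1 => hi; apply: contraNF ars => /eqP <-.
  apply/andP; split.
    apply/forall_inP => i; rewrite !inE => /orP[/(subsetP Ba)|/h1 ->]; last by rewrite orbT.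
    by rewrite inE => ->.
  apply/andP; split.
    rewrite -(eqP mB); apply/eqP; congr #|pred_of_set _|; apply/setP => i; rewrite !inE.
    case iB: (i \in B) => /=; first by have := subsetP Ba i iB; rewrite inE.
    by case iA: (i \in A') => //=; apply: A'a.
  apply/allP => c crs; have := allP hrs c crs; congr (_ == _); apply: eq_card => i; rewrite !inE.
  case: (r i =P c) => [e|_]; rewrite ?andbF // !andbT.
  case iB: (i \in B) => //=; have := subsetP Ba i iB; rewrite inE e => /eqP ca.
  by rewrite -ca crs in ars.
rewrite card_in_imset.
  by rewrite cardsX cards_draws IH // big_cons.
move=> [B A] [B' A'] /setXP[/=]; rewrite !inE => /andP[Ba _] /andP[/forall_inP h1 _].
move=> /= /andP[/andP[Ba' _] /andP[/forall_inP h1' _]] e.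
have key (B0 A0 : {set I}) : B0 \subset fib a -> (forall x, x \in A0 -> r x \in rs) ->
    (B0 = (B0 :|: A0) :&: fib a) /\ (A0 = (B0 :|: A0) :\: fib a).
  move=> b0 h0; have A0a i : i \in A0 -> r i == a = false.
    by move/h0 => hi; apply: contraNF ars => /eqP <-.
  split; apply/setP => i; rewrite !inE.
    case iB: (i \in B0) => /=; first by have := subsetP b0 i iB; rewrite inE => ->.
    by case iA: (i \in A0) => //=; rewrite A0a.
  case iB: (i \in B0) => /=.
    have := subsetP b0 i iB; rewrite inE => ri; rewrite ri /=.
    by apply/negP => /A0a; rewrite ri.
  by case iA: (i \in A0); rewrite ?andbF // A0a.
have [e1 e2] := key B A Ba h1; have [e3 e4] := key B' A' Ba' h1'.
by congr (_, _); [rewrite e1 e -e3 | rewrite e2 e -e4].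
Qed.

End SubsetCount.

Module NewtonDivisors.

Section Divisors.
Variables (F : numClosedFieldType) (k l : nat) (r : nat -> F).
Hypothesis lk : (l <= k)%N.
Local Notation side := (@side k l).
Local Notation newtk := (newt r k).
Implicit Types (t s u : 'S_k) (y : {poly F}) (A : {set 'I_k}).

Definition yset A : {poly F} := \prod_(i in A) ('X - (r i)%:P).
Definition yt t : {poly F} := \prod_(i < k | side i) ('X - (r (t i))%:P).
Definition Sd : {set 'I_k} := [set i | side i].

Lemma yt_set t : yt t = yset (t @: Sd).
Proof.
rewrite /yset big_imset /=; last by move=> i j _ _ /perm_inj.
by apply: eq_bigl => i; rewrite inE.
Qed.

Lemma card_Sd : #|Sd| = l.
Proof.
have -> : l = (\sum_(i < nb k l true) 1)%N by rewrite sum1_card card_ord.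
rewrite -(@sum_side k l lk nat true (fun=> 1%N)) -sum1_card.
by apply: eq_bigl => i; rewrite inE eqb_id.
Qed.

Lemma yset_seq A : yset A = \prod_(z <- [seq r (nat_of_ord i) | i <- enum A]) ('X - z%:P).
Proof. by rewrite big_map big_enum. Qed.

Lemma yset_monic A : yset A \is monic. Proof. exact: monic_prod_XsubC. Qed.

Lemma size_yset A : size (yset A) = #|A|.+1.
Proof. by rewrite yset_seq size_prod_XsubC size_map cardE. Qed.

Lemma newtk_set : newtk = yset setT.
Proof. by rewrite /yset /newt; apply: eq_bigl => i; rewrite inE. Qed.

Lemma yset_mul A : yset A * yset (~: A) = newtk.
Proof.
rewrite newtk_set /yset [RHS](bigID (mem A)) /=; congr (_ * _); apply: eq_bigl => i; by rewrite !inE.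
Qed.

Lemma mup_yset a A : mup a (yset A) = #|A :&: fib (fun i : 'I_k => r i) a|.
Proof.
rewrite yset_seq mu_prod_XsubC count_map cardE -size_filter; congr (size _).
by rewrite /enum_mem -filter_predI; apply: eq_filter => i; rewrite /= !inE andbC.
Qed.

Lemma mup_newtk a : mup a newtk = #|fib (fun i : 'I_k => r i) a|.
Proof. by rewrite newtk_set mup_yset setTI. Qed.

Lemma monic_split y : y \is monic -> exists zs : seq F, y = \prod_(z <- zs) ('X - z%:P).
Proof.
move=> /monicP my; have [zs e] := closed_field_poly_normal y.
by exists zs; rewrite {1}e my scale1r.
Qed.

(** The roots of [y] followed by those of the cofactor rearrange [r], and the rearranging
    permutation serves as [t]. *)
Lemma divisor_perm y : y \is monic -> size y = l.+1 -> y %| newtk -> exists t, y = yt t.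
Proof.
move=> my sy /dvdpP[w ew].
have mw : w \is monic by rewrite -(monicMr _ my) -ew monic_prod_XsubC.
have [zs ez] := monic_split my; have [ws ewz] := monic_split mw.
have szs : size zs = l by move: sy; rewrite ez size_prod_XsubC => -[].
have pe : perm_eq (zs ++ ws) [tuple r (nat_of_ord i) | i < k].
  apply: prod_XsubC_eq; rewrite big_cat /= -ez -ewz mulrC -ew /newt.
  by rewrite big_map big_enum.
have [t et] := tuple_permP pe.
exists t; rewrite /yt ez.
have nthE (i : 'I_k) : nth 0 (zs ++ ws) i = r (t i).
  by rewrite et -(tnth_nth 0 [tuple _ | _ < k]) !tnth_mktuple.
rewrite (big_nth 0) big_mkord szs (big_ord_widen k (fun i => 'X - (nth 0 zs i)%:P) lk).
by apply: eq_bigr => i il; rewrite -nthE nth_cat szs il.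
Qed.

Lemma yt_divisor t : [/\ yt t \is monic, size (yt t) = l.+1 & yt t %| newtk].
Proof.
rewrite yt_set; split; first exact: yset_monic.
  by rewrite size_yset card_imset ?card_Sd //; apply: perm_inj.
by rewrite -(yset_mul (t @: Sd)) dvdp_mulr.
Qed.

(** Permutations act transitively on sets of size [l], so all fibres of [t |-> t @: Sd] have the
    same size; the full predicate determines that size. *)
Lemma card_perm_sets (P : pred {set 'I_k}) :
  (#|[set t : 'S_k | P (t @: Sd)]| * 'C(k, l) = k`! * #|[set A : {set 'I_k} | (#|A| == l) && P A]|)%N.
Proof.
pose f := #|[set t : 'S_k | t @: Sd == Sd]|.
have fibE A : #|A| = l -> #|[set t : 'S_k | t @: Sd == A]| = f.
  move=> cA; have [u hu] : exists u : 'S_k, u @: Sd = A.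
    have cSA : #|Sd| = #|A| by rewrite cA card_Sd.
    pose g (i : 'I_k) : 'I_k := nth i (enum A) (index i (enum Sd)).
    have gin i : i \in Sd -> g i \in A.
      move=> hi; rewrite -mem_enum; apply: mem_nth.
      by rewrite -cardE -cSA cardE index_mem mem_enum.
    have [|u hu] := @perm_extend _ Sd g.
      move=> i j hi hj; rewrite /g => e.
      have si : (index i (enum Sd) < size (enum A))%N by rewrite -cardE -cSA cardE index_mem mem_enum.
      have sj : (index j (enum Sd) < size (enum A))%N by rewrite -cardE -cSA cardE index_mem mem_enum.
      rewrite (set_nth_default j) // in e.
      move/eqP: e; rewrite nth_uniq ?enum_uniq // => /eqP e.
      by rewrite -(nth_index i (s := enum Sd) (x := i)) ?mem_enum // e nth_index ?mem_enum.
    exists u; apply/eqP; rewrite eqEcard card_imset ?cSA ?leqnn ?andbT; last exact: perm_inj.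
    by apply/subsetP => _ /imsetP[i hi ->]; rewrite hu // gin.
  rewrite /f -[RHS](card_imset _ (mulIg u)); apply: eq_card => t; rewrite inE.
  apply/eqP/imsetP => [h|[s]].
    exists (t * u^-1)%g; last by rewrite mulgKV.
    rewrite inE -(inj_eq (imset_inj (@perm_inj _ u))) hu -imset_comp -h; apply/eqP.
    by apply: eq_imset => i /=; rewrite -permM mulgKV.
  rewrite inE => /eqP hs ->; rewrite -hu -{2}hs -imset_comp.
  by apply: eq_imset => i /=; rewrite permM.
have main Q : #|[set t : 'S_k | Q (t @: Sd)]| = (#|[set A : {set 'I_k} | (#|A| == l) && Q A]| * f)%N.
  rewrite -!sum1_card (partition_big (fun t : 'S_k => t @: Sd) (fun A => (#|A| == l) && Q A)) /=; last first.
    by move=> t; rewrite inE card_imset ?card_Sd ?eqxx //; apply: perm_inj.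
  rewrite big_distrl /=; under [RHS]eq_bigl do rewrite inE.
  apply: eq_bigr => A /andP[/eqP cA QA]; rewrite mul1n -(fibE A cA) -sum1_card.
  by apply: eq_bigl => t; rewrite !inE; case: eqP => [->|]; rewrite ?QA ?andbF.
have tot : k`! = ('C(k, l) * f)%N.
  have -> : k`! = #|[set t : 'S_k | xpredT (t @: Sd)]|.
    by rewrite -card_Sn -cardsT; apply: eq_card => t; rewrite !inE.
  rewrite (main xpredT); congr (_ * _)%N.
  rewrite -[k in RHS]card_ord -card_draws; apply: eq_card => A; by rewrite !inE andbT.
rewrite main tot; lia.
Qed.

(** A monic polynomial is fixed by its root multiplicities, so the sets of indices producing [y] are
    chosen independently over each root. *)
Lemma card_yt y rs : y \is monic -> size y = l.+1 -> y %| newtk ->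
  uniq rs -> (forall i : 'I_k, r i \in rs) ->
  (#|[set t : 'S_k | yt t == y]| * 'C(k, l) =
   k`! * \prod_(a <- rs) 'C(mup a newtk, mup a y))%N.
Proof.
move=> my sy dy urs hrs.
have -> : [set t : 'S_k | yt t == y] = [set t : 'S_k | yset (t @: Sd) == y].
  by apply/setP => t; rewrite !inE yt_set.
rewrite (card_perm_sets (fun A => yset A == y)); congr (_ * _)%N.
under [RHS]eq_bigr do rewrite mup_newtk.
rewrite -card_fibsets //; apply: eq_card => A; rewrite !inE.
have -> : [forall i in A, r i \in rs] by apply/forall_inP => i _; apply: hrs.
apply/andP/allP => [[_ /eqP <-] a _|h]; first by rewrite mup_yset.
suff e : yset A = y by split; [have := size_yset A; rewrite e sy => -[->] | rewrite e].
have [zs ez] := monic_split my.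
rewrite ez yset_seq; apply: perm_big; apply/seq.permP => P.
suff: perm_eq [seq r (nat_of_ord i) | i <- enum A] zs by move/seq.permP.
apply/allP => a ha /=; rewrite -!mu_prod_XsubC -ez -yset_seq mup_yset.
case ars: (a \in rs); first by rewrite (eqP (h a ars)).
have az : a \notin zs.
  apply: contraFN ars => az; move/dvdpP: dy => [w ew].
  have : root newtk a by rewrite ew rootM ez root_prod_XsubC az orbT.
  rewrite newtk_set yset_seq root_prod_XsubC => /mapP[i _ ->]; exact: hrs.
have aA : a \notin [seq r (nat_of_ord i) | i <- enum A].
  by apply: contraFN ars => /mapP[i _ ->].
rewrite ez mu_prod_XsubC -mup_yset yset_seq mu_prod_XsubC.
by rewrite !(count_memPn _).
Qed.

End Divisors.

End NewtonDivisors.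
Import NewtonDivisors.

(** * Characters as evaluations at permuted roots *)

Section CharacterPoints.
Variables (F : numFieldType) (k l : nat) (r : nat -> F).
Hypothesis lk : (l <= k)%N.
Local Notation R := {mpoly F[k]}.
Local Notation side := (@side k l).
Local Notation rk := (@rk k l).
Local Notation ysym := (@ysym F k l).
Local Notation inI := (@inI F k r).
Local Notation Theta := (Theta r).
Local Notation Jmx := (@Jmx F k).
Local Notation FF := {ffun 'I_k -> 'I_k}.
Local Notation Phi := (Phi F k l).
Local Notation LR := (Lcard k l * Rcard k l)%N.
Implicit Types (p q : R) (t s : 'S_k).

Definition chi t p : F := p.@[fun i => r (t i)].

Lemma mesym_chi t j : chi t (mesym k F j) = (mesym k F j).@[rpt r].
Proof.
rewrite /chi /mesym !raddf_sum /= [RHS](reindex_inj (imset_inj (@perm_inj _ t))) /=.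
apply: eq_big => [h|h _]; first by rewrite card_imset //; apply: perm_inj.
rewrite !rmorph_prod big_imset /=; last by move=> a b _ _ /perm_inj.
by apply: eq_bigr => i _; rewrite !mevalXU.
Qed.

Lemma chi_inI t p : inI p -> chi t p = 0.
Proof.
move=> [a ->]; rewrite /chi raddf_sum big1 // => i _ /=.
rewrite mevalM mevalB mevalC.
by have := mesym_chi t i.+1; rewrite /chi => ->; rewrite subrr mulr0.
Qed.

Lemma ysym_lin_closed : lin_closed ysym.
Proof.
split; first by move=> s _; rewrite raddf0.
by move=> c u v; apply: ysym_lin.
Qed.

Lemma ysym_prod_val (c : bool -> F) : ysym (\prod_i ((c (side i))%:MP - 'X_i)).
Proof.
move=> s /gstP gs; rewrite rmorph_prod [RHS](reindex_inj (@perm_inj _ s)) /=; apply: eq_bigr => i _.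
by rewrite rmorphB /= msymC msymXi gs.
Qed.

Lemma ysym_Phi m : ysym Phi`_m.
Proof.
apply: (coef_val ysym_lin_closed) => x.
have -> : Phi.[x%:MP] = \prod_i ((x - (side i : nat)%:R)%:MP - 'X_i).
  rewrite /GeneratorPhi.Phi horner_prod; apply: eq_bigr => i _; rewrite hornerXsubC mpolyCB.
  rewrite opprD addrA addrAC; congr (_ - _ - _).
  by rewrite raddfMn /= mpolyC1.
exact: (ysym_prod_val (fun b => x - (b : nat)%:R)).
Qed.

Lemma ysym_EpM m : ysym (Ep F k l true * Ep F k l false)`_m.
Proof.
apply: (coef_val ysym_lin_closed) => x.
rewrite Ep_mul_val -prod_sub_mesym; exact: (ysym_prod_val (fun=> x)).
Qed.

(** [gen_Ep] also requires the coefficients of [Ep true * Ep false]; modulo the ideal these are the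
    scalars of [newt k], so [Phi] alone suffices. *)
Lemma ysym_generated (P : R -> Prop) : alg_closed P ->
  (forall p, ysym p -> inI p -> P p) -> (forall m, P Phi`_m) -> forall p, ysym p -> P p.
Proof.
move=> Pa PI PPhi; have P1 : P 1 by case: Pa.
have PEp b j : P (Ep F k l b)`_j.
  apply: (gen_Ep lk Pa) => {b}j; first exact: PPhi.
  pose c := (newt r k)`_j.
  have en : (newtk k r)`_j = c *: 1 by rewrite /newtk coef_map /= -alg_mpolyC.
  have hc : P (c *: 1) by case: (alg_lin Pa) => P0 Pl; rewrite -[_ *: _]addr0; apply: Pl.
  have -> : (Ep F k l true * Ep F k l false)`_j =
      1 *: ((Ep F k l true * Ep F k l false)`_j - c *: 1) + c *: 1 by rewrite scale1r subrK.
  case: (alg_lin Pa) => _ Pl; apply: Pl => //; apply: PI.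
    have [y0 yl] := ysym_lin_closed.
    rewrite addrC -scaleN1r; apply: ysym_lin; last exact: ysym_EpM.
    by rewrite -[_ *: _]addr0; apply: yl => //; apply: ysym1.
  by have := @inI_newtk F k l r j; rewrite coefB en.
by move=> p hp; apply: (ysym_closed r lk Pa PEp hp).
Qed.

Lemma newt_mesym i : (i <= k)%N -> (newt r k)`_(k - i) = (-1) ^+ i * (mesym k F i).@[rpt r].
Proof.
move=> hi; pose M (c : nat) : F^o := (newt r k)`_c - (-1) ^+ (k - c) * (mesym k F (k - c)).@[rpt r].
suff : M (k - i)%N = 0 by move/eqP; rewrite /M subKn // subr_eq0 => /eqP.
apply: (@coef_eq0 F F^o k.+1 [::] M) => [x _|]; last by rewrite ltnS leq_subr.
have h : (newt r k).[x] = \prod_(i < k) (x - r i).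
  by rewrite horner_prod; apply: eq_bigr => j _; rewrite hornerXsubC.
have sz : (size (newt r k) <= k.+1)%N by rewrite size_prod_XsubC -[index_enum _]enumT size_enum_ord.
move: h; rewrite mesym_rpt (horner_coef_wide _ sz) => /eqP; rewrite -subr_eq0 => /eqP h.
rewrite -[RHS]h [X in _ = _ - X](reindex_inj rev_ord_inj) -sumrB; apply: eq_bigr => c _ /=.
rewrite subSS subKn ?leq_ord // /M -[_ *: _]/(_ * _) mulrBr mulrC; congr (_ - _).
by rewrite mulrA [x ^+ c * _]mulrC.
Qed.

(* Averaging over the Young subgroup makes the coefficients symmetric. *)
Lemma inI_ysym p : ysym p -> inI p -> exists a : 'I_k -> R, (forall i, ysym (a i)) /\
  p = \sum_(i < k) a i * (mesym k F i.+1 - ((mesym k F i.+1).@[rpt r])%:MP).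
Proof.
move=> hp [a ea].
pose n0 : F := #|[pred s : 'S_k | gst l s]|%:R.
have n0n : n0 != 0 by apply: Nst_neq0.
exists (fun i => n0^-1 *: \sum_(s : 'S_k | gst l s) msym s (a i)); split.
  move=> i s gs; apply: etrans (msymZ _ _ _) _; congr (_ *: _).
  rewrite (raddf_sum (msym s)) /=.
  rewrite [RHS](reindex_inj (mulIg s)) /=; apply: eq_big => [t|t _]; last by rewrite msymMm.
  have gM u v : gst l u -> gst l v -> gst l (u * v)%g.
    by move=> /gstP gu /gstP gv; apply/gstP => j; rewrite permM gv gu.
  apply/idP/idP => [gt|gts]; first exact: gM.
  by rewrite -[t](mulgK s) gM // gstV.
have e s : gst l s -> p = \sum_(i < k) msym s (a i) * (mesym k F i.+1 - ((mesym k F i.+1).@[rpt r])%:MP).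
  move=> gs; rewrite -{1}(hp s gs) ea raddf_sum; apply: eq_bigr => i _ /=.
  rewrite msymM; congr (_ * _); rewrite raddfB /= msymC; congr (_ - _).
  by have /issymP := mesym_sym k F i.+1; apply.
have e2 : n0 *: p = \sum_(s : 'S_k | gst l s) p by rewrite sumr_const scaler_nat.
rewrite -[LHS](scalerK n0n) e2 (eq_bigr _ e) exchange_big scaler_sumr; apply: eq_bigr => i _ /=.
by rewrite -mulr_suml -scalerAl.
Qed.

Lemma chi1 t : chi t 1 = 1. Proof. exact: meval1. Qed.
Lemma chiM t p q : chi t (p * q) = chi t p * chi t q. Proof. exact: mevalM. Qed.
Lemma chi_lin t c p q : chi t (c *: p + q) = c * chi t p + chi t q.
Proof. by rewrite /chi mevalD mevalZ. Qed.

Variables (N : nat) (Y : FF -> 'rV[F]_N).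
Hypothesis Yrk : forall (J : FF) i, side i = false -> J i != rk i :> nat -> Y J = 0.
Hypothesis Yalt : forall (J : FF) s, (forall i, side i = false -> s i = i) ->
  Y [ffun i => J (s i)] = (-1) ^+ s *: Y J.
Hypothesis Yninj : forall (J : FF) i j, side i -> side j -> i != j -> J i = J j -> Y J = 0.
Variables (d : nat) (Wb : 'M[F]_(d, N)).
Hypothesis Wfree : row_free Wb.
Hypothesis YW : forall J, (Y J <= Wb)%MS.
Hypothesis WY : forall i, exists c : FF -> F, row i Wb = \sum_(J : FF) c J *: Y J.
Hypothesis dC : d = 'C(k, l).
Variable pb : 'I_d -> R.
Hypothesis pbS : forall i, ysym (pb i).
Local Notation rhoW := (rhoW r Y Wb).
Local Notation fW := (fW r Y Wb pb).
Hypothesis pb_delta : forall i, rhoW (pb i) = delta_mx 0 i.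

Definition Thk p : F := Theta (Jmx rk) p.

Lemma fW_regular : @regular_action F R ysym d rhoW fW Thk pb.
Proof.
split.
- exact: ysym1.
- exact: ysymM.
- exact: ysym_lin.
- by move=> c p q; apply: linearP.
- exact: pbS.
- exact: pb_delta.
- by move=> p q hq; apply: (fW_act lk Yrk Yalt Yninj Wfree YW WY dC pbS pb_delta).
- by move=> M p h; apply: (fW_ext lk Yrk Yalt Yninj Wfree YW WY dC pbS pb_delta).
- move=> p hp h; apply/(fW0 lk Yrk Yalt Yninj Wfree YW WY dC pbS pb_delta hp).
  exact: (rhoW_ker lk Yrk Yalt Yninj Wfree YW WY dC hp h).
- move=> p hp h; apply: Theta_inI; exact: (rhoW_ker lk Yrk Yalt Yninj Wfree YW WY dC hp h).
(* Pairing [p] with the Schur polynomials [tS (hN J)] produces every functional occurring in [rho],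
   by [Theta_tS]. *)
move=> p hp h; have r0 : rho r Y p = 0.
  rewrite /ThetaRows.rho big1 // => J _.
  rewrite -(@Theta_tS F k l r lk (fun i => J i)) // mulrC.
  have := h (tS l (@hN F k r (fun i => J i))); rewrite /Thk => -> //; first by rewrite scale0r.
  exact: tS_sym.
by apply: etrans (_ : rho r Y p *m pinvmx Wb = 0) => //; rewrite r0 mul0mx.
Qed.

Let ra := fW_regular.
Local Notation Bal := (@Balg F R d fW pb).
Local Notation sec := (@sec F R d pb).

Definition Echi t (a : 'M[F]_d) : F := chi t (sec (rhoW 1 *m a^T)).

Lemma Echi_fW t p : ysym p -> Echi t (fW p) = chi t p.
Proof.
move=> hp; rewrite /Echi (rho1_act ra hp).
have := chi_inI t (pb_dec lk Yrk Yalt Yninj Wfree YW WY dC pbS pb_delta hp).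
have -> : p - \sum_i rhoW p 0 i *: pb i = (-1) *: sec (rhoW p) + p by rewrite scaleN1r addrC.
by rewrite chi_lin mulN1r => /eqP; rewrite addrC subr_eq0 => /eqP.
Qed.

Lemma Echi1 t : Echi t 1%:M = 1.
Proof. by rewrite -(fW_one ra) Echi_fW ?chi1 //; apply: ysym1. Qed.

Lemma Echi_lin t c a a' : (a \in Bal)%MS -> (a' \in Bal)%MS ->
  Echi t (c *: a + a') = c * Echi t a + Echi t a'.
Proof.
move=> /(memBalg ra)[p hp <-] /(memBalg ra)[q hq <-]; rewrite -linearP !Echi_fW ?chi_lin //.
exact: ysym_lin.
Qed.

Lemma EchiM t a a' : (a \in Bal)%MS -> (a' \in Bal)%MS -> Echi t (a *m a') = Echi t a * Echi t a'.
Proof.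
move=> /(memBalg ra)[p hp <-] /(memBalg ra)[q hq <-].
by rewrite -[_ *m _](fW_mul ra) // !Echi_fW ?chiM //; apply: ysymM.
Qed.

Section OneCharacter.
Variable E : 'M[F]_d -> F.
Hypothesis E1 : E 1%:M = 1.
Hypothesis Elin : forall c a a', (a \in Bal)%MS -> (a' \in Bal)%MS -> E (c *: a + a') = c * E a + E a'.
Hypothesis EM : forall a a', (a \in Bal)%MS -> (a' \in Bal)%MS -> E (a *m a') = E a * E a'.

Lemma char_ext t : (forall m, E (fW Phi`_m) = chi t Phi`_m) ->
  forall p, ysym p -> E (fW p) = chi t p.
Proof.
move=> hPhi; pose P p := ysym p /\ E (fW p) = chi t p.
have Pa : alg_closed P.
  split; first by split; [apply: ysym1 | rewrite (fW_one ra) E1 chi1].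
    move=> c u v [hu eu] [hv ev]; split; first exact: ysym_lin.
    by rewrite linearP Elin ?eu ?ev ?chi_lin //; apply: (memBalg_f ra).
  move=> u v [hu eu] [hv ev]; split; first exact: ysymM.
  by rewrite (fW_mul ra _ hv) EM ?eu ?ev ?chiM //; apply: (memBalg_f ra).
have PI p : ysym p -> inI p -> P p.
  move=> hp hI; split=> //; rewrite chi_inI //.
  have -> : fW p = 0 by apply/(fW0 lk Yrk Yalt Yninj Wfree YW WY dC pbS pb_delta hp).
  have := Elin (-1) (Balg1 ra) (Balg1 ra); rewrite scaleN1r addNr => ->.
  by rewrite mulN1r addNr.
have PPhi m : P Phi`_m by split; [apply: ysym_Phi | apply: hPhi].
by move=> p hp; have [] := ysym_generated Pa PI PPhi hp.
Qed.

Variables (n : nat) (bs : 'I_n -> 'M[F]_d).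
Hypothesis bsB : forall i, (bs i \in Bal)%MS.
Hypothesis bspan : forall a, (a \in Bal)%MS -> exists c : 'I_n -> F, a = \sum_i c i *: bs i.

(** The projector is [fW q], and [chi t q] is 1 when the point of [t] induces [E] and 0 otherwise.
    The trace of the projector therefore counts these permutations. *)
Lemma geneig_points : exists P : pred 'S_k,
  (forall t, P t <-> (forall p, ysym p -> E (fW p) = chi t p)) /\
  (LR * \rank (geneig E bs))%N = #|[set t | P t]|.
Proof.
have [e eB [h1 h2]] := geneig_proj ra E bsB.
have [v v0 hv] := eigvec_exists ra E1 Elin EM.
have Ee : E e = 1 by apply: (proj_eigval bsB eB h1 hv v0).
have [q hq eq] := memBalg ra eB.
pose P t := chi t q != 0.
have P_other t : P t -> forall p, ysym p -> E (fW p) = chi t p.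
  move=> Pt p hp; rewrite -Echi_fW //.
  have [w w0 hw] := eigvec_exists ra (Echi1 t) (@Echi_lin t) (@EchiM t).
  have Ete : Echi t e != 0 by rewrite -eq Echi_fW.
  have hb := proj_eigval_other bsB eB h2 hw w0 Ete.
  have [c ->] := bspan (memBalg_f ra hp).
  rewrite (Esum ra Elin c bsB) (Esum ra (@Echi_lin t) c bsB).
  by apply: eq_bigr => i _; rewrite hb.
have P1 t : (forall p, ysym p -> E (fW p) = chi t p) -> chi t q = 1.
  by move=> h; rewrite -h // eq.
exists P; split=> [t|].
  by split; [apply: P_other | move/P1; rewrite /P => ->; apply: oner_neq0].
apply/eqP; rewrite -(eqr_nat F) natrM -(geneig_trace eB h1 h2) -eq.
rewrite (trace_fW lk Yrk Yalt Yninj Wfree YW WY dC pbS pb_delta hq).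
apply/eqP; rewrite -sum1_card natr_sum [RHS]big_mkcond /=; apply: eq_bigr => t _.
rewrite inE -/(chi t q); case: ifP => [/P_other /P1 -> //|]; by move/negbT; rewrite negbK => /eqP.
Qed.

(** The generalized eigenspace contains an eigenvector, so the count of [geneig_points] is
    positive. *)
Lemma char_point : exists t, forall p, ysym p -> E (fW p) = chi t p.
Proof.
have [P [hP hr]] := geneig_points.
have [v v0 hv] := eigvec_exists ra E1 Elin EM.
have vU := eigvec_geneig bsB hv.
have : (0 < #|[set t | P t]|)%N.
  rewrite -hr !muln_gt0 !lt0n -!(pnatr_eq0 F) Lcard_neq0 Rcard_neq0 /=.
  rewrite pnatr_eq0 mxrank_eq0; apply: contraNneq v0 => U0; by rewrite -submx0 -U0.
by case/card_gt0P => t; rewrite inE => /hP ht; exists t.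
Qed.

End OneCharacter.

Lemma fW_generated (S : 'A[F]_d) : (1%:M \in S)%MS ->
  (forall a a', (a \in S)%MS -> (a' \in S)%MS -> (a *m a' \in S)%MS) ->
  (forall m, (fW Phi`_m \in S)%MS) -> forall p, ysym p -> (fW p \in S)%MS.
Proof.
move=> S1 SM hPhi.
have Slin c (a a' : 'M[F]_d) : (a \in S)%MS -> (a' \in S)%MS -> (c *: a + a' \in S)%MS.
  by move=> h h'; rewrite linearP addmx_sub // scalemx_sub.
pose P p := ysym p /\ (fW p \in S)%MS.
have Pa : alg_closed P.
  split; first by split; [apply: ysym1 | rewrite (fW_one ra)].
    move=> c u v [hu eu] [hv ev]; split; first exact: ysym_lin.
    by rewrite linearP Slin.
  move=> u v [hu eu] [hv ev]; split; first exact: ysymM.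
  by rewrite (fW_mul ra _ hv) SM.
have PI p : ysym p -> inI p -> P p.
  move=> hp hI; split=> //.
  have -> : fW p = 0 by apply/(fW0 lk Yrk Yalt Yninj Wfree YW WY dC pbS pb_delta hp).
  by rewrite linear0 sub0mx.
have PPhi m : P Phi`_m by split; [apply: ysym_Phi | apply: hPhi].
by move=> p hp; have [] := ysym_generated Pa PI PPhi hp.
Qed.

Lemma LR_bin : (LR * 'C(k, l) = k`!)%N.
Proof.
apply/eqP; rewrite -(eqr_nat F) natrM.
have := trace_fW lk Yrk Yalt Yninj Wfree YW WY dC pbS pb_delta (@ysym1 F k l).
rewrite (fW_one ra) mxtrace1 {1}dC => ->.
rewrite (eq_bigr (fun=> 1)) => [|t _]; last exact: meval1.
by rewrite sumr_const card_Sn.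
Qed.

End CharacterPoints.

(** * Eigenvalue series *)

Section EigenvalueSeries.

Lemma ser_mulC (R : comPzRingType) (A B : ser R) : ser_mul A B = ser_mul B A.
Proof.
apply: serP => n; rewrite /ser_mul (reindex_inj rev_ord_inj) /=; apply: eq_bigr => i _.
by rewrite subSS subKn ?leq_ord // mulrC.
Qed.

Lemma rev_ser_inj e (p q : {poly CC}) : (size p <= e.+1)%N -> (size q <= e.+1)%N ->
  rev_ser e p = rev_ser e q -> p = q.
Proof.
move=> sp sq h; apply/polyP => i; have [hi|hi] := ltnP i e.+1.
  have := congr1 (fun S : ser CC => S (e - i)%N) h.
  by rewrite /rev_ser /= leq_subr subKn.
by rewrite !nth_default //; [apply: leq_trans hi | apply: leq_trans hi].
Qed.

Lemma rev_ser_scale e c (p : {poly CC}) : rev_ser e (c *: p) = fun n => c * rev_ser e p n.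
Proof. by apply: serP => n; rewrite /rev_ser coefZ; case: ifP; rewrite ?mulr0. Qed.

Lemma rev_ser_monic e (p : {poly CC}) : p \is monic -> size p = e.+1 -> rev_ser e p 0%N = 1.
Proof.
by move=> /monicP mp sp; rewrite /rev_ser /= subn0; have := lead_coefE p; rewrite mp sp.
Qed.

Variables (k l : nat) (lam : 'I_k -> CC * CC) (b : 'I_k -> CC) (q1 q2 : CC) (r : nat -> CC).
Local Notation F := (Fpol lam b q1 q2).
Local Notation P := (Ppol b).
Hypothesis q12 : q1 != q2.
Hypothesis hF : F = (q1 - q2) *: newt r k.
Implicit Types y : {poly CC}.

Lemma size_F : size F = k.+1.
Proof. by rewrite hF size_scale ?subr_eq0 // size_newt'. Qed.

Lemma F_neq0' : F != 0.
Proof. by rewrite -size_poly_eq0 size_F. Qed.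

Lemma size_shift y : size (y \Po ('X - 1)) = size y.
Proof. by rewrite -polyC1 size_comp_poly2 // size_XsubC. Qed.

Section Divisor.
Variable y : {poly CC}.
Hypotheses (my : y \is monic) (sy : size y = l.+1).

Lemma size_yP : size (y * P) = (l + k).+1.
Proof. by rewrite size_Mmonic ?monic_neq0 ?P_monic // sy size_P addnS. Qed.

Lemma yP_monic : y * P \is monic. Proof. by rewrite monicMl ?P_monic. Qed.

Lemma size_yF : (size ((y \Po ('X - 1)) * F)%R <= (l + k).+1)%N.
Proof.
by apply: leq_trans (size_polyMleq _ _) _; rewrite size_shift sy size_F addnS.
Qed.

Lemma eigval_char (S : ser CC) :
  S = eigval lam b q1 q2 y <->
  ser_mul (rev_ser (l + k) (y * P)) S = rev_ser (l + k) ((y \Po ('X - 1)) * F).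
Proof.
have D0 := rev_ser_monic yP_monic size_yP.
rewrite /eigval /ratser size_yP /=; split=> [->|<-].
  by rewrite [ser_mul (rev_ser _ (_ * F)) _]ser_mulC ser_mulA ser_mulrV ?ser_mul1s.
by rewrite ser_mulC ser_mulA ser_mulVr ?ser_mul1s.
Qed.

End Divisor.

(** Clearing denominators and cancelling [Ppol] and [F] leaves the situation of
    [shift_ratio_inj]. *)
Lemma eigval_inj y y' : y \is monic -> size y = l.+1 -> y' \is monic -> size y' = l.+1 ->
  eigval lam b q1 q2 y = eigval lam b q1 q2 y' -> y = y'.
Proof.
move=> my sy my' sy' e.
have h : ser_mul (rev_ser (l + k) (y * P)) (eigval lam b q1 q2 y) =
         rev_ser (l + k) ((y \Po ('X - 1)) * F) by apply/eigval_char.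
have h' : ser_mul (rev_ser (l + k) (y' * P)) (eigval lam b q1 q2 y) =
         rev_ser (l + k) ((y' \Po ('X - 1)) * F) by apply/eigval_char.
have h2 : ser_mul (rev_ser (l + k) (y' * P)) (rev_ser (l + k) ((y \Po ('X - 1)) * F)) =
          ser_mul (rev_ser (l + k) (y * P)) (rev_ser (l + k) ((y' \Po ('X - 1)) * F)).
  by rewrite -h -h' !ser_mulA [ser_mul (rev_ser _ (y' * P)) _]ser_mulC.
rewrite !rev_serM ?size_yP ?size_yF // in h2.
have sz (u v : {poly CC}) : (size u <= (l + k).+1)%N -> (size v <= (l + k).+1)%N ->
    (size (u * v)%R <= (l + k + (l + k)).+1)%N.
  move=> su sv; apply: leq_trans (size_polyMleq _ _) _.
  by have := leq_add su sv; rewrite addnS addSn; case: (size u + size v)%N.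
have {h2} := rev_ser_inj _ _ h2 => h2.
have h3 : y' * P * ((y \Po ('X - 1)) * F) = y * P * ((y' \Po ('X - 1)) * F).
  by apply: h2; apply: sz; rewrite ?size_yP ?size_yF.
have h4 : y' * (y \Po ('X - 1)) = y * (y' \Po ('X - 1)).
  have PF0 : P * F != 0 by rewrite mulf_neq0 ?F_neq0' ?monic_neq0 ?P_monic.
  by apply: (mulIf PF0); rewrite mulrACA [RHS]mulrACA.
have [zs ez] := monic_split my; have [zs' ez'] := monic_split my'.
by rewrite ez ez'; apply: shift_ratio_inj; rewrite -ez -ez'.
Qed.

Local Notation yt := (@yt CC k l r).

Definition PhiT (t : 'S_k) : {poly CC} := \prod_(i < k) ('X - (r (t i) + ((i < l)%N : nat)%:R)%:P).

Lemma size_PhiT t : size (PhiT t) = k.+1.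
Proof. by rewrite size_prod_XsubC -[index_enum _]enumT size_enum_ord. Qed.

Lemma PhiT_F t : (q1 - q2) *: (yt t * PhiT t) = (yt t \Po ('X - 1)) * F.
Proof.
have e1 : yt t \Po ('X - 1) = \prod_(i < k | side l i) ('X - (r (t i) + ((i < l)%N : nat)%:R)%:P).
  rewrite /NewtonDivisors.yt (@comp_prod_shift CC 'I_k (side l) (fun i => r (t i))).
  by apply: eq_bigr => i il; rewrite -/(side l i) il.
have e2 : PhiT t = (yt t \Po ('X - 1)) * \prod_(i < k | ~~ side l i) ('X - (r (t i))%:P).
  rewrite e1 /PhiT (bigID (side l)) /=; congr (_ * _); apply: eq_bigr => i il.
  by rewrite -/(side l i) (negbTE il) addr0.
have e3 : newt r k = yt t * \prod_(i < k | ~~ side l i) ('X - (r (t i))%:P).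
  by rewrite /newt (reindex_inj (@perm_inj _ t)) /= (bigID (side l)).
by rewrite hF -scalerAr e2 mulrCA e3.
Qed.

Lemma PhiT_eigval (lk : (l <= k)%N) t (S : ser CC) :
  ser_mul (rev_ser k P) S = (fun n => (q1 - q2) * rev_ser k (PhiT t) n) <->
  S = eigval lam b q1 q2 (yt t).
Proof.
have [my sy _] := yt_divisor r lk t.
have y0 := rev_ser_monic my sy.
rewrite (eigval_char my sy) -PhiT_F rev_ser_scale -!rev_serM ?sy ?size_PhiT ?size_P //.
rewrite -ser_mulA; split=> [->|h].
  by apply: serP => n; rewrite /ser_mul mulr_sumr; apply: eq_bigr => i _; rewrite mulrCA.
apply: (ser_mulI y0); rewrite h; apply: serP => n; rewrite /ser_mul mulr_sumr.
by apply: eq_bigr => i _; rewrite mulrCA.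
Qed.

End EigenvalueSeries.

(** * The Bethe algebra *)

Section ReverseConvolution.
Variables (V : lmodType CC) (f : nat -> V) (k : nat) (p : {poly CC}).
Hypothesis sp : (size p <= k.+1)%N.

Lemma rev_conv m : (m <= k)%N ->
  \sum_(i < (k - m).+1) rev_ser k p i *: f (k - m - i)%N = \sum_(i < k.+1) p`_(m + i) *: f i.
Proof.
move=> hm; rewrite (reindex_inj rev_ord_inj) /=.
rewrite (big_ord_widen k.+1 (fun i => rev_ser k p (k - m - i)%N *: f (k - m - (k - m - i))%N)); last first.
  by rewrite ltnS leq_subr.
rewrite big_mkcond; apply: eq_bigr => i _; case: ltnP => hi.
  have -> : (k - m - (k - m - i) = i)%N by rewrite subKn // -ltnS.
  rewrite /rev_ser; have -> : (k - m - i <= k)%N by lia.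
  by congr (_`_ _ *: _); lia.
rewrite nth_default ?scale0r //; apply: leq_trans sp _; lia.
Qed.

Lemma rev_conv_neg m :
  \sum_(i < (k + m).+1) rev_ser k p i *: f (k + m - i)%N = \sum_(i < k.+1) p`_i *: f (i + m)%N.
Proof.
rewrite (bigID (fun i : 'I_(k + m).+1 => i < k.+1)%N) /= [X in _ + X]big1 ?addr0; last first.
  by move=> i; rewrite -leqNgt => hi; rewrite /rev_ser leqNgt hi scale0r.
rewrite -(big_ord_widen (k + m).+1 (fun i => rev_ser k p i *: f (k + m - i)%N)); last first.
  by rewrite ltnS leq_addr.
rewrite (reindex_inj rev_ord_inj) /=; apply: eq_bigr => i _.
have hi := leq_ord i.
rewrite subSS /rev_ser leq_subr subKn //; congr (_ *: f _); lia.
Qed.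

End ReverseConvolution.

Section Link.
Variables (k l : nat) (lam : 'I_k -> CC * CC) (b : 'I_k -> CC) (q1 q2 : CC) (r : nat -> CC).
Variable Ch : 'M[CC]_k.
Hypothesis lk : (l <= k)%N.
Hypothesis q12 : q1 != q2.
Hypothesis hF : Fpol lam b q1 q2 = (q1 - q2) *: newt r k.
Hypothesis hCh : forall t, pE lam b k t = \sum_(j < k) Ch j t *: newt r j.
Hypothesis Chu : Ch \in unitmx.
Local Notation N := (Ndim k).
Local Notation R := {mpoly CC[k]}.
Local Notation d := (dW lam b l).
Local Notation Wb := (Wbase lam b l).
Local Notation Y := (Y l Ch).
Local Notation rhoW := (rhoW r Y Wb).
Local Notation ysym := (@ysym CC k l).
Local Notation Phi := (Phi CC k l).
Local Notation NumQ := (NumQ lam b q1 q2).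
Local Notation TQ := (TQ lam b q1 q2).
Local Notation restrW := (@Defs.restrW k lam b l).
Let A1 := @Yrk k l Ch.
Let A2 := @Yalt k l Ch.
Let A3 := @Yninj k l Ch.
Let A4 : row_free Wb := row_base_free _.
Let A5 := YW lam b Ch lk.
Let A6 := @WY k l lam b Ch lk Chu.
Let A7 : d = 'C(k, l) := dW_bin l lam b.
Variable pb : 'I_d -> R.
Hypothesis pbS : forall i, ysym (pb i).
Hypothesis pb_delta : forall i, rhoW (pb i) = delta_mx 0 i.
Local Notation fW := (fW r Y Wb pb).
Let ra := fW_regular lk A1 A2 A3 A4 A5 A6 A7 pbS pb_delta.

Lemma restrW_lin c (A B : 'M[CC]_N) : restrW (c *: A + B) = c *: restrW A + restrW B.
Proof.
rewrite /Defs.restrW linearP mulmxDr -scalemxAr mulmxDl -scalemxAl.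
by rewrite [LHS]linearP.
Qed.

Lemma restrW0 : restrW 0 = 0.
Proof. by have := restrW_lin (-1) 0 0; rewrite scaler0 addr0 scaleN1r addNr. Qed.

Lemma restrW_sum (I : finType) (c : I -> CC) (f : I -> 'M[CC]_N) :
  restrW (\sum_i c i *: f i) = \sum_i c i *: restrW (f i).
Proof. by elim/big_rec2: _ => [|i y x _ <-]; rewrite ?restrW0 ?restrW_lin. Qed.

Lemma restrW_scalar (c : CC) : restrW c%:M = c%:M.
Proof.
rewrite /Defs.restrW tr_scalar_mx mul_mx_scalar -scalemxAl mulmxVp ?A4 //.
by rewrite scalemx1 tr_scalar_mx.
Qed.

Lemma restrW_Num m : (m <= k)%N -> restrW (NumQ (k - m)) = (q1 - q2) *: fW Phi`_m.
Proof.
move=> hm.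
have -> : (q1 - q2) *: fW Phi`_m = fW ((q1 - q2) *: Phi`_m) by rewrite linearZ.
apply: (ra_ext ra) => q hq.
have e := @rho_NumQ k l lam b q1 q2 r Ch hCh hF q12 q m hm.
have -> : rhoW q *m (restrW (NumQ (k - m)))^T = rho r Y q *m (NumQ (k - m))^T *m pinvmx Wb.
  have key n1 n2 (v : 'rV[CC]_n1) (W : 'M_(n1, n2)) (B : 'M_n2) (Q : 'M_(n2, n1)) :
      v *m (W *m B *m Q) = v *m W *m B *m Q by rewrite !mulmxA.
  rewrite /Defs.restrW trmxK key; congr (_ *m _ *m _).
  exact: (rhoWK r A5 q).
rewrite e -scalemxAl -scalerAl; symmetry; apply: (linearZ_LR (YoungAction.rhoW r Y Wb)).
Qed.

Lemma restrW_Num0 n : (k < n)%N -> restrW (NumQ n) = 0.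
Proof.
by move=> hn; rewrite /TransferAction.NumQ !Num_deg // !scaler0 subr0 restrW0.
Qed.

Lemma NumQ_TQ : NumQ = ser_mul (sc N (rev_ser k (Ppol b))) TQ.
Proof.
apply: serP => n; rewrite /TransferAction.NumQ !NumE /ser_mul !scaler_sumr -sumrB; apply: eq_bigr => i _.
by rewrite /Defs.TQ /sc mulrBr -!mulmxE !mul_scalar_mx !scalerA ![_ * rev_ser _ _ _]mulrC.
Qed.

Lemma NumQ_sum n : NumQ n = \sum_(i < n.+1) rev_ser k (Ppol b) i *: TQ (n - i)%N.
Proof.
by rewrite NumQ_TQ; apply: eq_bigr => i _; rewrite /sc -mulmxE mul_scalar_mx.
Qed.

Lemma TQ_sum n : exists c : nat -> CC, TQ n = \sum_(i < n.+1) c i *: NumQ (n - i)%N.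
Proof.
have P0 : rev_ser k (Ppol b) 0%N = 1 by apply: rev_ser_monic; [apply: P_monic | apply: size_P].
exists (ser_inv (rev_ser k (Ppol b))).
have -> : TQ = ser_mul (sc N (ser_inv (rev_ser k (Ppol b)))) NumQ.
  by rewrite NumQ_TQ ser_mulA scM ser_mulVr // sc1 ser_mul1s.
by apply: eq_bigr => i _; rewrite /sc -mulmxE mul_scalar_mx.
Qed.

Lemma Ppol_big m : (k < m)%N -> (Ppol b)`_m = 0.
Proof. by move=> h; rewrite nth_default // size_P. Qed.

Lemma PhiW_fW m : PhiW lam b q1 q2 l m = (q1 - q2) *: fW Phi`_m.
Proof.
rewrite /PhiW; have [hm|hm] := leqP m k; last first.
  rewrite big1 ?restrW0 => [|i _]; last by rewrite Ppol_big ?scale0r // ltn_addr.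
  by rewrite nth_default ?size_Phi // linear0 scaler0.
rewrite -restrW_Num //; congr restrW; rewrite NumQ_sum; apply/esym/rev_conv => //.
by rewrite size_P.
Qed.

Lemma PhiW_neg0 m : (0 < m)%N -> PhiW_neg lam b q1 q2 l m = 0.
Proof.
move=> m0; rewrite -(restrW_Num0 (n := (k + m)%N)); last by rewrite -ltn_subLR ?subnn.
congr restrW; rewrite NumQ_sum; apply/esym/rev_conv_neg; by rewrite size_P.
Qed.

Local Notation Bal := (@Balg CC R d fW pb).

Lemma Num_mem n : (restrW (NumQ n) \in Bal)%MS.
Proof.
have [hn|hn] := leqP n k; last by rewrite restrW_Num0 // linear0 sub0mx.
rewrite -(subKn hn) restrW_Num ?leq_subr // linearZ /= scalemx_sub //.
by apply: (memBalg_f ra); apply: ysym_Phi.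
Qed.

Lemma tW_mem n : (tW lam b q1 q2 l n \in Bal)%MS.
Proof.
rewrite /tW; have [c ->] := TQ_sum n; rewrite restrW_sum linear_sum summx_sub // => i _.
by rewrite linearZ /= scalemx_sub // Num_mem.
Qed.

Lemma subalg_Bal : subalg Bal.
Proof.
split; first exact: (Balg1 ra).
by apply/mulsmx_subP => a e ha he; apply: (BalgM ra).
Qed.

(** The coefficients of [Phi] come from those of [T_Q] and generate; conversely [T_Q] is recovered
    from its numerators by dividing by [Ppol], and the Berezinian acts by scalars. *)
Lemma BetheW_Bal : is_BetheW q1 q2 Bal.
Proof.
move=> A; split=> [/(memBalg ra)[p hp <-] S [S1 /mulsmx_subP SM] Sg|]; last first.
  apply; first exact: subalg_Bal.
  move=> n [|]; rewrite /Bgen; last exact: tW_mem.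
  have [c ->] := BerQ_scalar lam b q1 q2; rewrite restrW_scalar -scalemx1 linearZ /= scalemx_sub //.
  exact: (Balg1 ra).
apply: (fW_generated lk A1 A2 A3 A4 A5 A6 A7 pbS pb_delta S1 SM) => // m.
have q0 : q1 - q2 != 0 by rewrite subr_eq0.
rewrite -[YoungAction.fW _ _ _ _ _](scalerK q0) -PhiW_fW /PhiW restrW_sum.
rewrite linearZ scalemx_sub // linear_sum summx_sub // => i _.
by rewrite linearZ scalemx_sub //; apply: (Sg i false).
Qed.

End Link.

Lemma basis_mem (F : fieldType) n (B : 'A[F]_n) i : (vec_mx (row i (row_base B)) \in B)%MS.
Proof. by rewrite vec_mxK; apply: submx_trans (row_sub _ _) _; rewrite eq_row_base. Qed.

Lemma basis_span (F : fieldType) n (B : 'A[F]_n) a : (a \in B)%MS ->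
  exists c : 'I_(\rank B) -> F, a = \sum_i c i *: vec_mx (row i (row_base B)).
Proof.
move=> aB; have : (mxvec a <= row_base B)%MS by rewrite eq_row_base.
case/submxP => D e; exists (fun i => D 0 i).
rewrite -[a]mxvecK e mulmx_sum_row linear_sum; apply: eq_bigr => i _.
by rewrite linearZ.
Qed.

Lemma PhiT_chi (k l : nat) (r : nat -> CC) (t : 'S_k) m : chi r t (Phi CC k l)`_m = (PhiT l r t)`_m.
Proof.
pose v := fun i : 'I_k => r (t i).
have e : map_poly (meval v) (Phi CC k l) = PhiT l r t.
  rewrite /Phi rmorph_prod; apply: eq_bigr => i _ /=.
  rewrite map_polyXsubC; congr ('X - _%:P).
  by rewrite rmorphD rmorph_nat /= mevalXU.
by rewrite -e coef_map.
Qed.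

(** * The seven assertions for the Bethe algebra *)

Section Main.
Variables (k l : nat) (lam : 'I_k -> CC * CC) (b : 'I_k -> CC) (q1 q2 : CC) (r : nat -> CC).
Variable Ch : 'M[CC]_k.
Hypothesis lk : (l <= k)%N.
Hypothesis q12 : q1 != q2.
Hypothesis hF : Fpol lam b q1 q2 = (q1 - q2) *: newt r k.
Hypothesis hCh : forall t, pE lam b k t = \sum_(j < k) Ch j t *: newt r j.
Hypothesis Chu : Ch \in unitmx.
Local Notation R := {mpoly CC[k]}.
Local Notation d := (dW lam b l).
Local Notation Wb := (Wbase lam b l).
Local Notation Y := (Y l Ch).
Local Notation rhoW := (rhoW r Y Wb).
Local Notation ysym := (@ysym CC k l).
Local Notation inI := (@inI CC k r).
Local Notation Phi := (Phi CC k l).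
Local Notation F := (Fpol lam b q1 q2).
Local Notation yt := (@yt CC k l r).
Local Notation restrW := (@Defs.restrW k lam b l).
Let A1 := @Yrk k l Ch.
Let A2 := @Yalt k l Ch.
Let A3 := @Yninj k l Ch.
Let A4 : row_free Wb := row_base_free _.
Let A5 := YW lam b Ch lk.
Let A6 := @WY k l lam b Ch lk Chu.
Let A7 : d = 'C(k, l) := dW_bin l lam b.
Variable pb : 'I_d -> R.
Hypothesis pbS : forall i, ysym (pb i).
Hypothesis pb_delta : forall i, rhoW (pb i) = delta_mx 0 i.
Local Notation fW := (fW r Y Wb pb).
Local Notation Bal := (@Balg CC R d fW pb).
Local Notation tW := (tW lam b q1 q2 l).
Let ra := fW_regular lk A1 A2 A3 A4 A5 A6 A7 pbS pb_delta.

Lemma sym_ysym p : sym_l l p <-> ysym p.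
Proof.
split=> h s hs; apply: h; first by move/gstP: hs.
by apply/gstP.
Qed.

Lemma eps_mesym i : (i <= k)%N -> eps lam b q1 q2 i = (mesym k CC i).@[rpt r].
Proof.
move=> hi; have q0 : q1 - q2 != 0 by rewrite subr_eq0.
rewrite /eps hF coefZ newt_mesym //.
have key (K : fieldType) (c x : K) : c != 0 -> (-1) ^+ i * (c * ((-1) ^+ i * x)) / c = x.
  by move=> c0; rewrite mulrCA [X in c * X]mulrA -expr2 sqrr_sign mul1r mulrC mulKf.
exact: key.
Qed.

Lemma in_eps_inI p : ysym p -> (in_eps_ideal lam b q1 q2 l p <-> inI p).
Proof.
move=> hp; have e (a : 'I_k -> R) :
    \sum_(i < k) a i * (mesym k CC i.+1 - (eps lam b q1 q2 i.+1)%:MP) =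
    \sum_(i < k) a i * (mesym k CC i.+1 - ((mesym k CC i.+1).@[rpt r])%:MP).
  by apply: eq_bigr => i _; rewrite eps_mesym.
split=> [[a [_ ->]]|/(inI_ysym hp)[a [sa ->]]]; exists a; first exact: e.
by split=> [i|]; [apply/sym_ysym | rewrite e].
Qed.

Lemma part_i : exists f : R -> 'M[CC]_d,
  f 1 = 1%:M /\
  (forall c p p', sym_l l p -> sym_l l p' -> f (c *: p + p') = c *: f p + f p') /\
  (forall p p', sym_l l p -> sym_l l p' -> f (p * p') = f p *m f p') /\
  (forall p, sym_l l p -> (f p \in Bal)%MS) /\
  (forall a, (a \in Bal)%MS -> exists2 p, sym_l l p & f p = a) /\
  (forall p, sym_l l p -> (f p = 0 <-> in_eps_ideal lam b q1 q2 l p)) /\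
  (forall m, f (RHS_pol k q1 q2 l)`_m = PhiW lam b q1 q2 l m) /\
  (forall m, (0 < m)%N -> PhiW_neg lam b q1 q2 l m = 0).
Proof.
exists fW; split; first exact: (fW_one ra).
split; first by move=> c p p' _ _; apply: (linearP (YoungAction.fW r Y Wb pb)).
split; first by move=> p p' _ /sym_ysym hp'; apply: (fW_mul ra).
split; first by move=> p /sym_ysym hp; apply: (memBalg_f ra).
split; first by move=> a /(memBalg ra)[p hp e]; exists p => //; apply/sym_ysym.
split.
  move=> p /sym_ysym hp; have h0 := fW0 lk A1 A2 A3 A4 A5 A6 A7 pbS pb_delta hp.
  by split=> [/h0/(in_eps_inI hp)|/(in_eps_inI hp)/h0].
split; last by move=> m m0; apply: PhiW_neg0.
move=> m; rewrite (PhiW_fW lk q12 hF hCh Chu pbS pb_delta) /RHS_pol coefCM mul_mpolyC.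
exact: (linearZ_LR (YoungAction.fW r Y Wb pb)).
Qed.

Let bs i : 'M[CC]_d := vec_mx (row i (row_base Bal)).
Let bsB i : (bs i \in Bal)%MS := basis_mem i.
Let bspan a (h : (a \in Bal)%MS) := basis_span h.

Lemma frobenius_Bal : frobenius Bal.
Proof.
split; first by move=> a e; apply: (Balg_comm ra).
exists (bform rhoW (@Thk CC k l r) pb); split.
  by move=> c a a' e _ _ _; split; [apply: bform_linl | apply: bform_linr].
split; first by move=> a e ha he; rewrite /bform (Balg_comm ra ha he).
split; first by move=> a e f _ _ _; rewrite /bform mulmxA.
by move=> a ha; apply: (bform_nondeg ra).
Qed.

Lemma regular_Bal : regular_iso Bal.
Proof.
exists (fun a => rhoW 1 *m a^T); split.
  by move=> c a a' _ _; rewrite linearP /= mulmxDr -scalemxAr.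
split; first by move=> a e _ _; rewrite trmx_mul mulmxA.
split; first by move=> a e; apply: (regular_inj ra).
exact: (regular_surj ra).
Qed.

Lemma max_comm_Bal : max_comm Bal.
Proof.
split; first exact: (subalg_Bal lk Chu pbS pb_delta).
split; first by move=> a e; apply: (Balg_comm ra).
move=> S _ cS /memmx_subP BS; apply/memmx_subP => a aS.
by apply: (Balg_max ra) => e /BS eS; apply: cS.
Qed.

Lemma rank_Bal : \rank Bal = 'C(k, l).
Proof. by rewrite (rank_Balg ra) A7. Qed.

Section OneCharacter.
Variable E : 'M[CC]_d -> CC.
Hypothesis hE : character Bal E.
Let E1 := hE.1.
Let Elin := hE.2.1.
Let EM := hE.2.2.

Lemma rank_eigsp : \rank (eigsp Bal E) = 1%N.
Proof. exact: (rank_eig ra E1 Elin EM bsB bspan). Qed.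

Lemma cyclic_geneigsp : cyclic_module Bal (geneigsp Bal E).
Proof. by have [v [h1 h2 h3]] := geneig_cyclic ra E bsB; exists v. Qed.

Lemma char_ser n : ser_mul (rev_ser k (Ppol b)) (fun j => E (tW j)) n =
  if (n <= k)%N then (q1 - q2) * E (fW Phi`_(k - n)) else 0.
Proof.
have e : restrW (NumQ lam b q1 q2 n) = \sum_(i < n.+1) rev_ser k (Ppol b) i *: tW (n - i)%N.
  by rewrite NumQ_sum restrW_sum.
transitivity (E (restrW (NumQ lam b q1 q2 n))).
  rewrite e (Esum ra Elin) // => i.
  exact: (tW_mem lk q12 hF hCh Chu pbS pb_delta).
case: leqP => hn; last first.
  rewrite restrW_Num0 //; have h0 (i : 'I_0) : (0 \in Bal)%MS by rewrite linear0 sub0mx.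
  by have := Esum ra Elin (fun=> 0) h0; rewrite !big_ord0.
have := restrW_Num lk q12 hF hCh Chu pbS pb_delta (leq_subr n k).
rewrite subKn // => ->.
have h1 (i : 'I_1) : (fW Phi`_(k - n) \in Bal)%MS by apply: (memBalg_f ra); apply: ysym_Phi.
by have := Esum ra Elin (fun=> q1 - q2) h1; rewrite !big_ord1.
Qed.

Lemma char_eigval t : (forall p, ysym p -> E (fW p) = chi r t p) <->
  (forall n, E (tW n) = eigval lam b q1 q2 (yt t) n).
Proof.
have q0 : q1 - q2 != 0 by rewrite subr_eq0.
have E0 : E 0 = 0.
  have h0 (i : 'I_0) : (0 \in Bal)%MS by rewrite linear0 sub0mx.
  by have := Esum ra Elin (fun=> 0) h0; rewrite !big_ord0.
have key : (forall m, E (fW Phi`_m) = chi r t Phi`_m) <->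
    (fun n => E (tW n)) = eigval lam b q1 q2 (yt t).
  split=> [h|/(PhiT_eigval hF lk t) h m].
    apply/(PhiT_eigval hF lk t); apply: serP => n; rewrite char_ser /rev_ser.
    by case: ifP => _; rewrite ?mulr0 // h PhiT_chi.
  have [hm|hm] := leqP m k; last first.
    by rewrite nth_default ?size_Phi // linear0 E0 /chi meval0.
  have := congr1 (fun S : ser CC => S (k - m)%N) h.
  rewrite char_ser /rev_ser leq_subr subKn // => /(mulfI q0) ->; by rewrite PhiT_chi.
split=> [h n|h].
  have /key e m : E (fW Phi`_m) = chi r t Phi`_m by apply: h; apply: ysym_Phi.
  by have := congr1 (fun S : ser CC => S n) e.
apply: (char_ext lk A1 A2 A3 A4 A5 A6 A7 pbS pb_delta E1 Elin EM).
by apply/key; apply: serP.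
Qed.

Lemma divisor_newt y : divisor_l lam b q1 q2 l y <->
  [/\ y \is monic, size y = l.+1 & y %| newt r k].
Proof.
have q0 : q1 - q2 != 0 by rewrite subr_eq0.
by rewrite /divisor_l hF dvdpZr //; split=> [[h1 [h2 h3]]|[h1 h2 h3]].
Qed.

Lemma character_divisor : exists! y, divisor_l lam b q1 q2 l y /\
  forall n, E (tW n) = eigval lam b q1 q2 y n.
Proof.
have [t /char_eigval ht] :=
  char_point lk A1 A2 A3 A4 A5 A6 A7 pbS pb_delta E1 Elin EM bsB bspan.
have dt := yt_divisor r lk t; have [m1 s1 _] := dt.
exists (yt t); split; first by split=> //; apply/divisor_newt.
move=> y [/divisor_newt[my sy _] hy].
by apply: (eigval_inj q12 hF m1 s1 my sy); apply: serP => n; rewrite -ht hy.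
Qed.

(** The permutations [t] with [yt t = y] are counted twice, through the trace and through the roots
    of [y]; [LR_bin] makes the two counts comparable. *)
Lemma rank_geneigsp y rs : divisor_l lam b q1 q2 l y ->
  (forall n, E (tW n) = eigval lam b q1 q2 y n) -> uniq rs ->
  (forall a, root F a -> a \in rs) ->
  \rank (geneigsp Bal E) = (\prod_(a <- rs) 'C(mup a F, mup a y))%N.
Proof.
have q0 : q1 - q2 != 0 by rewrite subr_eq0.
move=> /divisor_newt[my sy dy] hy urs hrs.
have [P [hP hr]] := geneig_points lk A1 A2 A3 A4 A5 A6 A7 pbS pb_delta E1 Elin EM bsB bspan.
have rootr (i : 'I_k) : r i \in rs.
  by apply: hrs; rewrite hF rootZ // /newt (bigD1 i) //= rootM root_XsubC eqxx.
have := card_yt lk my sy dy urs rootr.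
have -> : [set t : 'S_k | yt t == y] = [set t | P t].
  apply/setP => t; rewrite !inE; have [m1 s1 _] := yt_divisor r lk t.
  apply/eqP/idP => [e|/hP /char_eigval h]; first by apply/hP/char_eigval => n; rewrite hy e.
  by apply: (eigval_inj q12 hF m1 s1 my sy); apply: serP => n; rewrite -h hy.
rewrite -hr mulnAC (LR_bin lk A1 A2 A3 A4 A5 A6 A7 pbS pb_delta) => /eqP.
rewrite eqn_pmul2l ?fact_gt0 // => /eqP ->; apply: eq_bigr => a _.
congr 'C(_, _); rewrite hF -mul_polyC mupMr //.
by rewrite rootC.
Qed.

End OneCharacter.

Lemma divisor_character y : divisor_l lam b q1 q2 l y ->
  exists E, [/\ character Bal E, eigsp Bal E != 0 &
     forall n, E (tW n) = eigval lam b q1 q2 y n].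
Proof.
move=> /divisor_newt[my sy dy]; have [t ->] := divisor_perm lk my sy dy.
pose E := Echi r Y Wb pb t.
have hE : character Bal E.
  split; first exact: (Echi1 lk A1 A2 A3 A4 A5 A6 A7 pbS pb_delta).
  split; first by move=> c a a'; apply: (Echi_lin lk A1 A2 A3 A4 A5 A6 A7 pbS pb_delta).
  by move=> a a'; apply: (EchiM lk A1 A2 A3 A4 A5 A6 A7 pbS pb_delta).
exists E; split=> //; first by rewrite -mxrank_eq0 rank_eigsp.
by apply/char_eigval => // p hp; apply: (Echi_fW lk A1 A2 A3 A4 A5 A6 A7 pbS pb_delta).
Qed.

End Main.

(** Both [phi] and [psi] are monic of degree [k], so the leading coefficient is [q1 - q2], and the
    field is algebraically closed. *)
Lemma Fpol_split k (lam : 'I_k -> CC * CC) b q1 q2 : q1 != q2 ->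
  exists r, Fpol lam b q1 q2 = (q1 - q2) *: newt r k.
Proof.
move=> q12; have q0 : q1 - q2 != 0 by rewrite subr_eq0.
have lF : (Fpol lam b q1 q2)`_k = q1 - q2.
  have hp := monicP (phi_monic lam b); have hs := monicP (psi_monic lam b).
  rewrite lead_coefE size_phi in hp; rewrite lead_coefE size_psi in hs.
  by rewrite /Fpol coefB !coefZ hp hs !mulr1.
have sF : size (Fpol lam b q1 q2) = k.+1.
  apply/eqP; rewrite eqn_leq; apply/andP; split; last first.
    by rewrite ltnNge; apply: contra_neqN q0 => /leq_sizeP /(_ k (leqnn k)) <-.
  apply: leq_trans (size_polyD _ _) _; rewrite size_polyN geq_max.
  by rewrite !(leq_trans (size_scale_leq _ _)) ?size_phi ?size_psi.
have [zs e] := closed_field_poly_normal (Fpol lam b q1 q2).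
rewrite lead_coefE sF lF in e.
have szs : size zs = k.
  by have := sF; rewrite e size_scale // size_prod_XsubC => -[].
by exists (nth 0 zs); rewrite {1}e (big_nth 0) big_mkord szs.
Qed.

Theorem theorem4p11 (q1 q2 : CC) (k : nat) (lam : 'I_k -> CC * CC) (b : 'I_k -> CC)
    (l : nat) :
  q1 != 0 -> q2 != 0 -> q1 != q2 ->
  (forall s, polynomial_wt (lam s)) -> (forall s, nondeg_wt (lam s)) ->
  cyclic_vac lam b ->
  (l <= k)%N ->
  exists Bm : 'A[CC]_(dW lam b l),
    is_BetheW q1 q2 Bm /\
    (* (i) *)
    (exists f : {mpoly CC[k]} -> 'M[CC]_(dW lam b l),
       f 1 = 1%:M /\
       (forall c p p', sym_l l p -> sym_l l p' -> f (c *: p + p') = c *: f p + f p') /\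
       (forall p p', sym_l l p -> sym_l l p' -> f (p * p') = f p *m f p') /\
       (forall p, sym_l l p -> (f p \in Bm)%MS) /\
       (forall a, (a \in Bm)%MS -> exists2 p, sym_l l p & f p = a) /\
       (forall p, sym_l l p -> (f p = 0 <-> in_eps_ideal lam b q1 q2 l p)) /\
       (forall m, f (RHS_pol k q1 q2 l)`_m = PhiW lam b q1 q2 l m) /\
       (forall m, (0 < m)%N -> PhiW_neg lam b q1 q2 l m = 0)) /\
    (* (ii) *)
    frobenius Bm /\ regular_iso Bm /\
    (* (iii) *)
    max_comm Bm /\ \rank Bm = 'C(k, l) /\
    (* (iv) *)
    (forall E, character Bm E -> eigsp Bm E != 0 -> \rank (eigsp Bm E) = 1%N) /\
    (* (v) *)
    (forall y, divisor_l lam b q1 q2 l y ->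
       exists E, [/\ character Bm E, eigsp Bm E != 0 &
                     forall r, E (tW lam b q1 q2 l r) = eigval lam b q1 q2 y r]) /\
    (forall E, character Bm E -> eigsp Bm E != 0 ->
       exists! y, divisor_l lam b q1 q2 l y /\
                  forall r, E (tW lam b q1 q2 l r) = eigval lam b q1 q2 y r) /\
    (* (vi) *)
    (forall E, character Bm E -> cyclic_module Bm (geneigsp Bm E)) /\
    (* (vii) *)
    (forall y E, divisor_l lam b q1 q2 l y -> character Bm E ->
       (forall r, E (tW lam b q1 q2 l r) = eigval lam b q1 q2 y r) ->
       forall rs : seq CC, uniq rs -> (forall a, root (Fpol lam b q1 q2) a -> a \in rs) ->
       \rank (geneigsp Bm E) =
         (\prod_(a <- rs) 'C(mup a (Fpol lam b q1 q2), mup a y))%N).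
Proof.
move=> _ _ q12 _ _ cyc lk.
have [r hF] := Fpol_split lam b q12.
have [c hc] := fin_all_exists (fun t : 'I_k => newt_expand r (size_pE lam b k t)).
pose Ch : 'M[CC]_k := \matrix_(j, t) c t j.
have hCh t : pE lam b k t = \sum_(j < k) Ch j t *: newt r j.
  by rewrite hc; apply: eq_bigr => j _; rewrite mxE.
(* Cyclicity of the vacuum enters here, as the invertibility of the Newton coefficients of [E]. *)
have Chu := Ch_unit hCh cyc.
have surj := rhoW_surj r lk (@Yrk k l Ch) (@Yalt k l Ch) (@Yninj k l Ch)
  (row_base_free _) (YW lam b Ch lk) (@WY k l lam b Ch lk Chu).
(* Symmetric polynomials lifting the coordinate vectors of [W]. *)
have [pb pbS pbd] := fin_all_exists2 (fun i => surj (delta_mx 0 i)).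
exists (@Balg CC {mpoly CC[k]} _ (fW r (Y l Ch) (Wbase lam b l) pb) pb).
split; first exact: BetheW_Bal.
split; first exact: part_i.
split; first exact: frobenius_Bal.
split; first exact: regular_Bal.
split; first exact: max_comm_Bal.
split; first exact: rank_Bal.
split; first by move=> E hE _; apply: rank_eigsp.
split; first by move=> y; apply: (divisor_character lk q12 hF hCh Chu pbS pbd).
split; first by move=> E hE _; apply: (character_divisor lk q12 hF hCh Chu pbS pbd).
split; first by move=> E _; apply: (cyclic_geneigsp lk Chu pbS pbd).
move=> y E dy hE hy rs urs hrs; exact: (rank_geneigsp lk q12 hF hCh Chu pbS pbd).
Qed.
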